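(* For every integer $n\ge 1$ and every Boolean function $f$ of the $n$ variables $x_1,\dots,x_n$, the limit \[\mathbb{P}_n(f)=\lim_{m\to\infty}\mathbb{P}_{m,n}(f)\] exists and is positive. Moreover: (i) there exist two constants $\alpha,\beta$ such that for every integer $n$, \[0<\alpha\le \mathbb{P}_n(\mathtt{True})=\mathbb{P}_n(\mathtt{False})\le \beta<\tfrac12;\] (ii) if $f$ is a literal function, then $\mathbb{P}_n(f)=\Theta(1/n^2)$ as $n\to\infty$; (iii) for every Boolean function $f$ with $L(f)\ge 3$, $\mathbb{P}_n(f)=\Theta(1/n^{L(f)})$ as $n\to\infty$.
   Context: Fix an integer $n\ge 1$. An associative tree is a rooted plane (ordered) tree in which every internal node has at least two children, every internal node is labelled by a connective $\land$ or $\lor$ in such a way that no internal node carries the same label as its parent (stratification), and every leaf is labelled by a literal from $\{x_1,\bar x_1,\dots,x_n,\bar x_n\}$ (a single leaf is also an associative tree). Interpreting $\bar x_i$ as the negation of $x_i$, each associative tree computes a Boolean function $\{\mathtt{True},\mathtt{False}\}^n\to\{\mathtt{True},\mathtt{False}\}$. The size of a tree is its total number of nodes (internal nodes and leaves). $\mathbb{P}_{m,n}(f)$ denotes the proportion of associative trees of size $m$ (on $n$ variables) computing $f$, among all associative trees of size $m$. A literal function is a function $(x_1,\dots,x_n)\mapsto x_i$ or $(x_1,\dots,x_n)\mapsto \bar x_i$. The complexity $L(f)$ is $0$ for the two constant functions, $2$ for literal functions, and otherwise the minimum size of an associative tree computing $f$. In the asymptotic statements as $n\to\infty$, $f$ is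 a fixed Boolean function of some fixed number $n_0$ of variables, regarded for $n\ge n_0$ as the function $(x_1,\dots,x_n)\mapsto f(x_1,\dots,x_{n_0})$ of $n$ variables. *)

(* Defs.v *)
From HB Require Import structures.
From mathcomp Require Import all_boot all_order all_algebra.
From mathcomp Require Import finmap.
From mathcomp Require Import all_classical all_reals all_analysis.

Set Implicit Arguments.
Unset Strict Implicit.
Unset Printing Implicit Defensive.

Import Order.TTheory GRing.Theory Num.Theory.
Import numFieldNormedType.Exports.

Local Open Scope classical_set_scope.
Local Open Scope ring_scope.

Definition assignment (n : nat) := {ffun 'I_n -> bool}.
Definition boolfun (n : nat) := {ffun assignment n -> bool}.

(* (i, true) is the literal x_i and (i, false) is its negation. *)
Definition literal (n : nat) := ('I_n * bool)%type.
Definition eval_literal n (x : assignment n) (l : literal n) : bool :=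
  if l.2 then x l.1 else ~~ x l.1.

Inductive connective := And | Or.

Definition bool_of_connective c := if c is And then true else false.
Definition connective_of_bool (b : bool) := if b then And else Or.
Lemma bool_of_connectiveK : cancel bool_of_connective connective_of_bool.
Proof. by case. Qed.
HB.instance Definition _ := Countable.copy connective (can_type bool_of_connectiveK).

(* Plane trees whose internal nodes have a finite sequence of children of
   arbitrary length; arity and stratification are imposed by [associative]. *)
Inductive tree (n : nat) :=
| Leaf of literal n
| Node of connective & seq (tree n).

Section TreeCountType.
Variable n : nat.

Lemma tree_nested_ind (P : tree n -> Prop) :
  (forall l, P (Leaf l)) ->
  (forall c ts, foldr (fun t => and (P t)) True ts -> P (Node c ts)) ->
  forall t, P t.
Proof.
move=> PL PN; fix IH 1 => -[l|c ts].
  exact: PL.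
apply: PN; elim: ts => [|t ts IHts]; first exact: Logic.I.
by split; [exact: IH | exact: IHts].
Qed.

Fixpoint encode_tree (t : tree n) : GenTree.tree (literal n) :=
  match t with
  | Leaf l => GenTree.Leaf l
  | Node c ts => GenTree.Node (bool_of_connective c) (map encode_tree ts)
  end.

Fixpoint decode_tree (t : GenTree.tree (literal n)) : tree n :=
  match t with
  | GenTree.Leaf l => Leaf l
  | GenTree.Node b ts => Node (connective_of_bool (b == 1%N)) (map decode_tree ts)
  end.

Lemma encode_treeK : cancel encode_tree decode_tree.
Proof.
elim/tree_nested_ind => //= c ts IH; congr Node; first by case: c.
by elim: ts IH => //= t ts IHts [-> /IHts ->].
Qed.

HB.instance Definition _ := Countable.copy (tree n) (can_type encode_treeK).

End TreeCountType.

Definition root_label n (t : tree n) : option connective :=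
  if t is Node c _ then Some c else None.

Fixpoint associative n (t : tree n) : bool :=
  if t is Node c ts then
    (2 <= size ts)%N &&
    all (fun s => (root_label s != Some c) && associative s) ts
  else true.

Fixpoint tree_size n (t : tree n) : nat :=
  if t is Node _ ts then (sumn (map (@tree_size n) ts)).+1 else 1%N.

Fixpoint eval_tree n (x : assignment n) (t : tree n) : bool :=
  match t with
  | Leaf l => eval_literal x l
  | Node And ts => all (eval_tree x) ts
  | Node Or ts => has (eval_tree x) ts
  end.

Definition tree_fun n (t : tree n) : boolfun n := [ffun x => eval_tree x t].

Definition trees_of_size n m : set (tree n) :=
  [set t | associative t /\ tree_size t = m].

Lemma finite_trees_of_size n m : finite_set (@trees_of_size n m).
Proof.
suff [s sP] : exists s : seq (tree n), forall t, (tree_size t <= m)%N -> t \in s.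
  by apply: (@sub_finite_set _ _ [set` s]) => // t [_ tm] /=; rewrite sP ?tm.
elim: m => [|m [s sP]]; first by exists [::] => -[].
have [ss ssP] : exists ss : seq (seq (tree n)),
    forall ts, (sumn (map (@tree_size n) ts) <= m)%N -> ts \in ss.
  suff [ss ssP] : exists ss : seq (seq (tree n)),
      forall ts, (size ts <= m)%N -> all (fun t => t \in s) ts -> ts \in ss.
    exists ss => ts tsm; apply: ssP; last first.
      elim: ts tsm => //= t ts IH le_m; rewrite sP ?IH//.
        exact: leq_trans (leq_addl _ _) le_m.
      exact: leq_trans (leq_addr _ _) le_m.
    apply: leq_trans tsm; elim: ts => //= t ts IH.
    by rewrite -add1n leq_add//; case: t.
  elim: {sP} m => [|k [ss ssP]]; first by exists [:: [::]] => -[].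
  exists ([::] :: [seq t :: ts | t <- s, ts <- ss]) => -[|t ts]//= le_k.
  case/andP => ts_s /(ssP _ le_k) ts_ss.
  by rewrite inE /=; apply: allpairs_f.
exists ([seq Leaf l | l <- enum {: 'I_n * bool}] ++
        [seq Node c ts | c <- [:: And; Or], ts <- ss]).
case=> [l _|c ts le_m]; rewrite mem_cat.
  by rewrite map_f ?mem_enum.
by apply/orP; right; apply: (@allpairs_f _ _ _ (@Node n)); [case: (c) | exact: ssP].
Qed.

(* P_{m,n}(f); by convention it is 0 for the sizes m such that there is no
   associative tree of size m, i.e., m = 0 and m = 2 when n >= 1. *)
Definition prob_size (R : realType) n (m : nat) (f : boolfun n) : R :=
  #|` fset_set (trees_of_size m `&` [set t | tree_fun t = f])|%:R /
  #|` fset_set (@trees_of_size n m)|%:R.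

(* P_n(f) *)
Definition prob (R : realType) n (f : boolfun n) : R :=
  limn (fun m => prob_size R m f).

Definition const_fun n (b : bool) : boolfun n := [ffun=> b].

Definition literal_fun n (l : literal n) : boolfun n :=
  [ffun x => eval_literal x l].

Definition is_constant n (f : boolfun n) : bool := [exists b, f == const_fun n b].

Definition is_literal n (f : boolfun n) : bool := [exists l, f == literal_fun l].

Definition min_tree_size n (f : boolfun n) (m : nat) : Prop :=
  (exists t, [/\ associative t, tree_fun t = f & tree_size t = m]) /\
  (forall t, associative t -> tree_fun t = f -> (m <= tree_size t)%N).

(* The default value 0 of [xget] is never used, see [ex_min_tree_size]. *)
Definition complexity n (f : boolfun n) : nat :=
  if is_constant f then 0%N
  else if is_literal f then 2%N
  else xget 0%N (min_tree_size f).

Section Existence.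
Variable n : nat.

Let computable (e : assignment n -> bool) :=
  exists2 t : tree n, associative t & forall x, eval_tree x t = e x.

Let children (c : connective) (t : tree n) :=
  if t is Node d ts then if d == c then ts else [:: t] else [:: t].

Let all_children c t : associative t ->
  all (fun s => (root_label s != Some c) && associative s) (children c t).
Proof.
case: t => [l|d ts] //= /[dup] /andP[_ h] h'.
by case: eqP => [<-//|/eqP dc] /=; rewrite h' andbT; apply/andP.
Qed.

Let size_children c t : associative t -> (0 < size (children c t))%N.
Proof. by case: t => [l|d ts] //= /andP[h _]; case: ifP => // _; apply: ltnW. Qed.

Let join c (t u : tree n) := Node c (children c t ++ children c u).

Let associative_join c t u :
  associative t -> associative u -> associative (join c t u).
Proof.
move=> tA uA /=; rewrite all_cat !all_children// size_cat !andbT.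
by rewrite -[2%N]/(1 + 1)%N leq_add// size_children.
Qed.

Let computable_and e1 e2 :
  computable e1 -> computable e2 -> computable (fun x => e1 x && e2 x).
Proof.
move=> [t tA te] [u uA ue]; exists (join And t u); first exact: associative_join.
have E x s : all (eval_tree x) (children And s) = eval_tree x s.
  by case: s => [l|[] ts] //=; rewrite andbT.
by move=> x; rewrite /= all_cat !E te ue.
Qed.

Let computable_or e1 e2 :
  computable e1 -> computable e2 -> computable (fun x => e1 x || e2 x).
Proof.
move=> [t tA te] [u uA ue]; exists (join Or t u); first exact: associative_join.
have E x s : has (eval_tree x) (children Or s) = eval_tree x s.
  by case: s => [l|[] ts] //=; rewrite orbF.
by move=> x; rewrite /= has_cat !E te ue.
Qed.

Let computable_eq e1 e2 : e1 =1 e2 -> computable e1 -> computable e2.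
Proof. by move=> e12 [t tA te]; exists t => // x; rewrite te. Qed.

Let computable_literal l : computable (fun x => eval_literal x l).
Proof. by exists (Leaf l). Qed.

Lemma ex_associative_tree (f : boolfun n) : (0 < n)%N ->
  exists2 t : tree n, associative t & tree_fun t = f.
Proof.
move=> n_gt0; pose i0 := Ordinal n_gt0.
have cT : computable xpredT.
  apply: computable_eq (computable_or (computable_literal (i0, true))
                                      (computable_literal (i0, false))) => x.
  by rewrite /eval_literal /= orbN.
have cF : computable xpred0.
  apply: computable_eq (computable_and (computable_literal (i0, true))
                                       (computable_literal (i0, false))) => x.
  by rewrite /eval_literal /= andbN.
have call (s : seq (literal n)) : computable (fun x => all (eval_literal x) s).
  by elim: s => //= l s IH; apply: computable_and.
have chas (s : seq (assignment n)) : computable (fun x => has (fun a : assignment n =>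
    all (eval_literal x) [seq (i, a i) | i <- enum 'I_n]) s).
  by elim: s => //= a s IH; apply: computable_or.
have [t tA te] := chas [seq a <- enum {: {ffun 'I_n -> bool}} | f a].
exists t => //; apply/ffunP => x; rewrite ffunE te.
have lit (a : assignment n) : all (eval_literal x) [seq (i, a i) | i <- enum 'I_n] = (a == x).
  rewrite all_map; apply/allP/eqP => [h|-> i _].
    apply/ffunP => i; have := h i (mem_enum _ _); rewrite /eval_literal /=.
    by case: (a i) (x i) => [] [].
  by rewrite /= /eval_literal /=; case: ifP => // ->.
under eq_has do rewrite lit.
by rewrite has_pred1 mem_filter mem_enum andbT.
Qed.

Lemma ex_min_tree_size (f : boolfun n) : (0 < n)%N ->
  exists m, min_tree_size f m.
Proof.
move=> /(ex_associative_tree f) [t0 t0A t0f].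
pose P m := `[< exists t : tree n, [/\ associative t, tree_fun t = f & tree_size t = m] >].
have exP : exists m, P m by exists (tree_size t0); apply/asboolP; exists t0.
case: (ex_minnP exP) => m /asboolP mP mmin; exists m; split => // t tA tf.
by apply: mmin; apply/asboolP; exists t.
Qed.

End Existence.

(* f, of n0 variables, regarded as a function of n0 + k variables. *)
Definition extend n0 (k : nat) (f : boolfun n0) : boolfun (n0 + k) :=
  [ffun x : assignment (n0 + k) => f [ffun i => x (lshift k i)]].

(* Main.v *)
(* Mark a uniform node in a tree and follow the path from the root to it: along
   this path, the siblings form layers. With T the generating function of the
   trees whose root has not a given label, (1+z)T^2 - (1+2nz)T + 2nz = 0, so
   with sigma = sqrt(2n) the radius of convergence is
   rho = 1/(sigma(sigma+2)), T(rho) = tau = sigma/(sigma+1), and the weights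
   rho^size of all the layers sum to 1. Since the ratio of two consecutive
   coefficients of T tends to 1/rho, the first j layers of a large marked tree
   behave like j independent layers drawn with these weights. A layer that
   contains a literal and its negation makes the function of the tree constant
   on everything below, and this happens almost surely along an infinite path;
   hence P_n(f) exists and is the supremum over j of the weight of the sequences
   of j layers that compute f whatever is plugged below them.

   A node has about sigma children, so a layer contains complementary leaves
   with probability bounded below, uniformly in n. This gives (i), and, putting
   a minimal tree for f in the first layer, the lower bounds in (ii) and (iii).
   For the upper bounds, call a node rich if it has many distinct leaves outside
   the essential variables of f. A few rich nodes can be turned simultaneously
   into constants by an assignment of the inessential variables, so that f is
   computed by what remains of the tree above them. A node that is not rich, or
   an essential leaf, costs a factor 1/n, and a rich node a factor 1/sqrt n. *)

Require Import Defs.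
From mathcomp Require Import all_boot all_order all_algebra.
From mathcomp Require Import finmap.
From mathcomp Require Import all_classical all_reals all_analysis.
From mathcomp Require Import ring lra zify.

Set Implicit Arguments.
Unset Strict Implicit.
Unset Printing Implicit Defensive.

Import Order.TTheory GRing.Theory Num.Theory.
Import numFieldNormedType.Exports.
Local Open Scope classical_set_scope.
Local Open Scope ring_scope.

(* mathcomp's [ssrfun.associative] hides the predicate on trees. *)
Local Notation associative := Defs.associative.

(** * Trees of bounded height and width *)

(** No infinite sum is formed: trees, words of siblings and contexts are enumerated with height and
    width bounded by [h], generating functions become finite sums, and the critical weights are
    limits in [h]. Singularity analysis is replaced by a contraction argument on the ratios of a
    three-term recurrence. For each function only a lower bound on its proportion is proved
    directly. This suffices: the lower bounds have total mass tending to 1, which is the total mass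
    of the proportions, so no function can exceed its bound in the limit. For the upper bounds, a
    context is weighted by rho^size * lambda^exponent, with lambda = delta * sigma. If delta is
    small in terms of [n0] and L, the total weight stays at most 2, while a context that computes f
    has exponent at least 2L; this gives 2 / lambda^(2L), of order n^(-L). The exponents are doubled
    because a rich node costs only 1/sqrt n. It has to cost something, since only boundedly many
    rich nodes can be made constant by one assignment. A literal has exponent 2, and not 1, because
    its leaf must hang from a node of the path. *)

Definition dual_connective c := if c is And then Or else And.

Lemma dual_connectiveK : involutive dual_connective.
Proof. by case. Qed.

Section Words.
Variable T : Type.

(** Truncation of the free monoid at length [k]: the weight of all words becomes a finite geometric
    sum, see [big_words_prod]. *)
Fixpoint words k (A : seq T) : seq (seq T) :=
  if k is k'.+1 then [::] :: [seq t :: ts | t <- A, ts <- words k' A]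
  else [:: [::]].

Lemma big_words (S : nmodType) k A (G : seq T -> S) :
  \sum_(ts <- words k.+1 A) G ts =
  G [::] + \sum_(t <- A) \sum_(ts <- words k A) G (t :: ts).
Proof. by rewrite /= big_cons big_allpairs_dep. Qed.

Lemma big_words_cond (S : nmodType) k A (P : pred (seq T)) (G : seq T -> S) :
  \sum_(ts <- words k.+1 A | P ts) G ts =
  (if P [::] then G [::] else 0) +
  \sum_(t <- A) \sum_(ts <- words k A | P (t :: ts)) G (t :: ts).
Proof.
rewrite big_mkcond big_words; congr (_ + _); apply: eq_bigr => t _.
by rewrite -big_mkcond.
Qed.

Lemma big_words_size_gt0 (S : nmodType) k A (G : seq T -> S) :
  G [::] + \sum_(ts <- words k A | (0 < size ts)%N) G ts =
  \sum_(ts <- words k A) G ts.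
Proof.
case: k => [|k]; first by rewrite big_cons big_nil big_seq1 addr0.
by rewrite big_words_cond big_words /= add0r.
Qed.

Lemma big_words_size_ge2 (S : zmodType) k A (G : seq T -> S) :
  \sum_(ts <- words k.+1 A | (2 <= size ts)%N) G ts =
  \sum_(t <- A) (\sum_(ts <- words k A) G (t :: ts) - G [:: t]).
Proof.
rewrite big_words_cond add0r; apply: eq_bigr => t _ /=.
rewrite -[in RHS]big_words_size_gt0 [RHS]addrAC subrr add0r.
by apply: eq_bigl => ts.
Qed.

Lemma big_words_prod (S : comPzRingType) (w : T -> S) k A :
  \sum_(ts <- words k A) \prod_(t <- ts) w t =
  \sum_(j < k.+1) (\sum_(t <- A) w t) ^+ j.
Proof.
elim: k => [|k IH]; first by rewrite big_seq1 big_nil big_ord1 expr0.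
rewrite big_words big_nil big_ord_recl expr0; congr (_ + _).
under eq_bigr do [under eq_bigr do rewrite big_cons; rewrite -mulr_sumr IH].
rewrite -mulr_suml mulr_sumr; apply: eq_bigr => j _.
by rewrite -exprS.
Qed.

Variable R : numDomainType.

(** The inclusion of [A] in [B] is phrased through sums of nonnegative functions, which is the form
    that the induction in [le_big_trees_upto] provides. *)
Lemma le_big_words (A B : seq T) k l (G : seq T -> R) :
  (forall F : T -> R, (forall t, 0 <= F t) -> \sum_(t <- A) F t <= \sum_(t <- B) F t) ->
  (k <= l)%N -> (forall ts, 0 <= G ts) ->
  \sum_(ts <- words k A) G ts <= \sum_(ts <- words l B) G ts.
Proof.
move=> AB; elim: k l G => [|k IH] [|l]// G kl G0.
- by rewrite big_seq1 big_words lerDl; do 2!apply: sumr_ge0 => ? _.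
- rewrite !big_words lerD2l.
  apply: le_trans (AB _ _) => [|t]; last by apply: sumr_ge0.
  by apply: ler_sum => t _; apply: IH.
Qed.

End Words.

Lemma mem_words (T : eqType) k (A : seq T) ts :
  (ts \in words k A) = (size ts <= k)%N && all (mem A) ts.
Proof.
elim: k ts => [|k IH] [|t ts] //=; rewrite inE //=.
apply/allpairsP/idP => [[[u us]/= [uA usA [-> ->]]]|].
  by rewrite uA andTb -IH.
by case/and3P => tsk tA tsA; exists (t, ts); split => //; rewrite IH; apply/andP.
Qed.

Lemma words_uniq (T : eqType) k (A : seq T) : uniq A -> uniq (words k A).
Proof.
move=> uA; elim: k => [|k IH] //=; apply/andP; split.
  by apply/negP => /allpairsP[[]]? ? /= [].
by apply: allpairs_uniq => // -[t ts] [u us] _ _ /= [-> ->].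
Qed.

Section Trees.
Variable n : nat.
Implicit Types (t u : tree n) (ts ls rs : seq (tree n)) (c : connective).

Definition forest_size ts := sumn (map (@tree_size n) ts).

Lemma forest_size_cat ts us :
  forest_size (ts ++ us) = (forest_size ts + forest_size us)%N.
Proof. by rewrite /forest_size map_cat sumn_cat. Qed.

Lemma tree_size_gt0 t : (0 < tree_size t)%N. Proof. by case: t. Qed.

Lemma size_le_forest_size ts : (size ts <= forest_size ts)%N.
Proof.
by elim: ts => //= t ts IH; rewrite -addn1 addnC leq_add ?tree_size_gt0.
Qed.

Lemma expr_forest_size (S : pzSemiRingType) (x : S) ts :
  x ^+ forest_size ts = \prod_(t <- ts) x ^+ tree_size t.
Proof.
elim: ts => [|t ts IH]; first by rewrite big_nil expr0.
by rewrite big_cons -IH -exprD.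
Qed.

(** Admissible children of a node labelled [dual_connective c]. Leaves belong to both classes. *)
Definition in_class c t := associative t && (root_label t != Some (dual_connective c)).

Definition leaves : seq (tree n) := [seq Leaf l | l <- enum {: literal n}].

(** One parameter bounds height and arity together. Both are at most the size, so every tree of size
    at most [h] in the class is listed. *)
Fixpoint trees_upto h c : seq (tree n) :=
  if h is h'.+1 then
    leaves ++
    [seq Node c ts | ts <- words h' (trees_upto h' (dual_connective c))
                   & (2 <= size ts)%N]
  else [::].

Lemma mem_trees_upto_class h c t : t \in trees_upto h c -> in_class c t.
Proof.
elim: h c t => [|h IH] c t //=; rewrite mem_cat => /orP[|].
  by case/mapP => l _ ->.
case/mapP => ts; rewrite mem_filter mem_words => /and3P[ts2 _ tsA] ->.
rewrite /in_class /= ts2 /=; apply/andP; split; last by case: c {tsA}.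
apply/allP => u uts; have /IH := allP tsA u uts.
by rewrite /in_class dual_connectiveK andbC.
Qed.

Lemma in_class_mem_trees_upto h c t :
  (tree_size t <= h)%N -> in_class c t -> t \in trees_upto h c.
Proof.
elim: h c t => [|h IH] c t; first by rewrite leqNgt tree_size_gt0.
rewrite /in_class mem_cat; case: t => [l _ _|d ts]; first by rewrite map_f// mem_enum.
rewrite [tree_size _]/= ltnS -/(forest_size ts) => tsh /andP[/= /andP[ts2 tsA] dc].
have {}dc : d = c by case: c d dc {tsA} => -[].
rewrite {d}dc in tsA *.
apply/orP; right; apply/mapP; exists ts => //.
rewrite mem_filter ts2 mem_words (leq_trans (size_le_forest_size _) tsh) /=.
apply/allP => u uts; apply: IH.
  apply: leq_trans tsh; rewrite /forest_size.
  elim: ts uts {ts2 tsA} => //= v ts IHts; rewrite inE => /predU1P[->|/IHts].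
    exact: leq_addr.
  by move=> /leq_trans; apply; apply: leq_addl.
by move/allP : tsA => /(_ _ uts); rewrite /in_class dual_connectiveK andbC.
Qed.

Lemma trees_upto_uniq h c : uniq (trees_upto h c).
Proof.
elim: h c => [|h IH] c //=; rewrite cat_uniq; apply/and3P; split.
- by rewrite map_inj_uniq ?enum_uniq// => l1 l2 [].
- by apply/hasPn => _ /mapP[ts _ ->]; apply/negP => /mapP[].
- by rewrite map_inj_uniq ?filter_uniq ?words_uniq// => ts us [].
Qed.

Lemma big_trees_upto (S : nmodType) h c (F : tree n -> S) :
  \sum_(t <- trees_upto h.+1 c) F t =
  \sum_(l : literal n) F (Leaf l) +
  \sum_(ts <- words h (trees_upto h (dual_connective c)) | (2 <= size ts)%N)
    F (Node c ts).
Proof. by rewrite /= big_cat /leaves big_map big_enum /= big_map big_filter. Qed.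

Lemma card_literal : #|{: literal n}| = n.*2.
Proof. by rewrite card_prod card_ord card_bool muln2. Qed.

(** The bracket contributes the words of length 2 to [h']; for [h' = 0] it is -1, but its factor
    [tree_gf x 0] is 0. The recursion is used at ['X] to read coefficients and at [rho] to get
    weights. *)
Fixpoint tree_gf (S : comPzRingType) (x : S) h : S :=
  if h is h'.+1 then
    x *+ n.*2 + x * tree_gf x h' * (\sum_(j < h') tree_gf x h' ^+ j - 1)
  else 0.

Lemma tree_gfS (S : comPzRingType) (x : S) h :
  tree_gf x h.+1 =
  x *+ n.*2 + x * tree_gf x h * (\sum_(j < h) tree_gf x h ^+ j - 1).
Proof. by []. Qed.

Lemma sum_trees_upto_expr (S : comPzRingType) (x : S) h c :
  \sum_(t <- trees_upto h c) x ^+ tree_size t = tree_gf x h.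
Proof.
elim: h c => [|h IH] c; first by rewrite big_nil.
rewrite big_trees_upto tree_gfS; congr (_ + _); first by rewrite /= sumr_const card_literal.
case: h IH => [|h] IH; first by rewrite big_mkcond big_seq1 /= mulr0 mul0r.
under eq_bigr do rewrite -/(forest_size _) exprS expr_forest_size.
rewrite -mulr_sumr -mulrA; congr (_ * _).
rewrite big_words_size_ge2.
rewrite -(IH (dual_connective c)) mulr_suml; apply: eq_bigr => t _.
rewrite big_seq1 -big_words_prod mulrBr mulr1 mulr_sumr.
by congr (_ - _); apply: eq_bigr => ts _; rewrite big_cons.
Qed.

Section Monotonicity.
Variable R : numDomainType.

Lemma le_big_trees_upto h k c (F : tree n -> R) :
  (h <= k)%N -> (forall t, 0 <= F t) ->
  \sum_(t <- trees_upto h c) F t <= \sum_(t <- trees_upto k c) F t.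
Proof.
elim: h k c F => [|h IH] [|k] c F // hk F0.
  by rewrite big_nil sumr_ge0.
rewrite !big_trees_upto lerD2l big_mkcond [leRHS]big_mkcond/=.
apply: le_big_words => // [G G0|ts]; [exact: IH|by case: ifP].
Qed.

Lemma big_trees_upto_size m h c (F : tree n -> R) : (m <= h)%N ->
  \sum_(t <- trees_upto h c | tree_size t == m) F t =
  \sum_(t <- trees_upto m c | tree_size t == m) F t.
Proof.
move=> mh; rewrite -!(big_filter _ (fun t => tree_size t == m)); apply: perm_big.
apply: uniq_perm; rewrite ?filter_uniq ?trees_upto_uniq// => t.
rewrite !mem_filter; case: eqP => //= tm.
apply/idP/idP => /mem_trees_upto_class tc; apply: in_class_mem_trees_upto => //.
  by rewrite tm.
by rewrite tm.
Qed.

End Monotonicity.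
End Trees.

(** * Ratio of consecutive terms of the counting sequence *)

Section RecurrentSequences.
Variable R : realType.

Lemma cvgn0_perturbed_contraction (q : R) (e d : nat -> R) :
  0 <= q < 1 -> (forall k, 0 <= e k) -> (forall k, e k.+1 <= q * e k + d k) ->
  d @ \oo --> 0 -> e @ \oo --> 0.
Proof.
move=> /andP[q0 q1] e0 ed d0; apply/cvgrPdist_le => eps eps0.
(* The value [eps / 2] is the fixed point of [x |-> q * x + (1 - q) * (eps / 2)]: after rank [K] the
   error is at most [eps / 2] plus a geometrically decaying term. *)
have /cvgrPdist_le/(_ ((1 - q) * (eps / 2))) := d0.
have /[swap]/[apply] : 0 < (1 - q) * (eps / 2) by rewrite mulr_gt0 ?subr_gt0 ?divr_gt0.
move=> [K _ hK].
have eK j : e (K + j)%N <= eps / 2 + q ^+ j * e K.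
  elim: j => [|j IH]; first by rewrite addn0 expr0 mul1r lerDr divr_ge0// ltW.
  rewrite addnS; apply: le_trans (ed _) _.
  have := hK (K + j)%N (leq_addr _ _); rewrite sub0r normrN => /(le_trans (ler_norm _)) dK.
  apply: le_trans (lerD (ler_wpM2l q0 IH) dK) _; rewrite exprS; lra.
have : (fun j => q ^+ j * e K) @ \oo --> 0 * e K.
  by apply: cvgMl; apply: cvg_expr; rewrite ger0_norm.
rewrite mul0r => /cvgrPdist_le/(_ (eps / 2)).
have /[swap]/[apply] : 0 < eps / 2 by rewrite divr_gt0.
move=> [J _ hJ]; exists (K + J)%N => // m /= Km.
rewrite sub0r normrN ger0_norm//.
have -> : m = (K + (m - K))%N by rewrite subnKC// (leq_trans (leq_addr _ _) Km).
apply: le_trans (eK _) _.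
have := hJ (m - K)%N; rewrite /= leq_subRL ?(leq_trans (leq_addr _ _) Km)// => /(_ Km).
by rewrite sub0r normrN => /(le_trans (ler_norm _)); lra.
Qed.

Lemma cvgn_invS (a : R) (p : nat) : (fun k => a / (k + p.+1)%:R) @ \oo --> (0 : R).
Proof.
rewrite -(mulr0 a); apply: cvgMr.
have := @cvg_harmonic R; rewrite -(cvg_shiftn p); apply: cvg_trans.
by apply: near_eq_cvg; apply: nearW => k; rewrite /= addnS.
Qed.

Variables (s : R) (v : nat -> R).
Let N := s ^+ 2.
Hypothesis s_gt1 : 1 < s.
Hypothesis v0_gt0 : 0 < v 0.
Hypothesis v1E : v 1%N = N * v 0.
Hypothesis vE : forall k, (k + 4)%:R * v k.+2 =
  2 * N * (k%:R + 5 / 2) * v k.+1 - (N ^+ 2 - 4 * N) * (k%:R + 1) * v k.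

Let s_gt0 : 0 < s. Proof. exact: lt_trans s_gt1. Qed.
Let N_gt1 : 1 < N. Proof. by rewrite /N exprn_egt1. Qed.
Let N_gt0 : 0 < N. Proof. exact: lt_trans N_gt1. Qed.
Let th_gt0 : 0 < s * (s + 2). Proof. by rewrite mulr_gt0 ?addr_gt0. Qed.

Hypothesis N_even : N = 2 \/ 4 <= N.

(** Here [N] stands for 2n. If [4 <= N], the subtracted term is controlled by the bound on the
    previous ratio; if [N = 2], the coefficient [N ^+ 2 - 4 * N] is negative and that term helps. *)
Lemma recurrence_ratio_ge k : 0 < v k /\ N * v k <= v k.+1.
Proof.
have N0 := N_gt0.
elim: k => [|k [vk rk]]; first by rewrite v0_gt0 v1E.
have vk1 : 0 < v k.+1 by apply: lt_le_trans rk; rewrite mulr_gt0.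
split=> //.
have k0 : 0 <= k%:R :> R by [].
rewrite -(ler_pM2l (x := (k + 4)%:R)); last by rewrite ltr0n addn4.
rewrite vE natrD.
have [N2|N4] := N_even.
  have h : 0 <= 4 * (k%:R + 1) * v k by rewrite !mulr_ge0 ?addr_ge0// ltW.
  have h' : 0 <= k%:R * v k.+1 by rewrite mulr_ge0 // ltW.
  by rewrite N2; nra.
have h : 0 <= (N - 4) * ((k%:R + 1) * (v k.+1 - N * v k)).
  by rewrite !mulr_ge0 ?subr_ge0// addr_ge0.
have h' : 0 <= k%:R * v k.+1 by rewrite mulr_ge0 // ltW.
by nra.
Qed.

Let r k := v k.+1 / v k.

Let v_gt0 k : 0 < v k. Proof. by case: (recurrence_ratio_ge k). Qed.

Let r_ge k : N <= r k.
Proof. by rewrite /r ler_pdivlMr//; case: (recurrence_ratio_ge k). Qed.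

Let r_gt0 k : 0 < r k. Proof. exact: lt_le_trans (r_ge k). Qed.

(** The ratios follow, up to O(1/k), the map [x |-> 2 * N - (N ^+ 2 - 4 * N) / x], which fixes
    [s * (s + 2)]. As [N <= r k], the distance to this fixed point shrinks by the factor [q < 1]. *)
Lemma cvgn_recurrence_ratio : r @ \oo --> s * (s + 2).
Proof.
pose b : R := `|N ^+ 2 - 4 * N|; pose q : R := b / (N * (s * (s + 2))).
have b0 : 0 <= b by exact: normr_ge0.
have Nth : 0 < N * (s * (s + 2)) by rewrite mulr_gt0.
have q01 : 0 <= q < 1.
  rewrite /q divr_ge0 ?(ltW Nth)//= ltr_pdivrMr// mul1r.
  rewrite (_ : _ * _ = N * N + 2 * (N * s)); last by rewrite /N; ring.
  have Ns := mulr_gt0 N_gt0 s_gt0.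
  have h : 0 < N * (N - 1) + N * (s - 1).
    by rewrite addr_gt0 ?mulr_gt0 ?subr_gt0.
  rewrite /b ltr_norml expr2; move: h; rewrite !mulrBr !mulr1.
  by have := N_gt0; move: (N * N) (N * s) Ns => A B; lra.
suff : (fun k => `|r k - s * (s + 2)|) @ \oo --> (0 : R).
  by move=> /norm_cvg0P/subr_cvg0.
(* The perturbation comes from (k + 5/2)/(k + 4) = 1 - (3/2)/(k + 4) and (k + 1)/(k + 4) = 1 - 3/(k
   + 4). *)
apply: (@cvgn0_perturbed_contraction q _
  (fun k => (3 * N + 3 * b / N) / (k + 4)%:R)) => //; last exact: cvgn_invS.
move=> k.
have k4 : 0 < k%:R + 4 :> R by rewrite ltr_wpDl.
have rE : r k.+1 = 2 * N * (k%:R + 5 / 2) / (k%:R + 4) -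
    (N ^+ 2 - 4 * N) * (k%:R + 1) / (k%:R + 4) / r k.
  have -> : r k.+1 = v k.+2 / v k.+1 by [].
  have -> : v k.+2 = ((k + 4)%:R * v k.+2) / (k%:R + 4).
    by rewrite natrD mulrAC divff ?mul1r ?gt_eqF.
  rewrite vE /r; have h1 := v_gt0 k; have h2 := v_gt0 k.+1.
  by field; rewrite (gt_eqF h1) (gt_eqF h2) (gt_eqF k4).
have -> : r k.+1 - s * (s + 2) =
   (- (3 * N) + 3 * (N ^+ 2 - 4 * N) / r k) / (k%:R + 4) +
   (N ^+ 2 - 4 * N) / (r k * (s * (s + 2))) * (r k - s * (s + 2)).
  have h := r_gt0 k; have s2 : 0 < s + 2 by rewrite addr_gt0.
  rewrite rE /N; field.
  by rewrite (gt_eqF h) (gt_eqF s2) (gt_eqF s_gt0) (gt_eqF k4).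
apply: le_trans (ler_normD _ _) _; rewrite [leLHS]addrC; apply: lerD.
  rewrite normrM; apply: ler_wpM2r => //; rewrite normrM; apply: ler_wpM2l => //.
  have rth : 0 < r k * (s * (s + 2)) by apply: mulr_gt0.
  rewrite ger0_norm ?invr_ge0 ?(ltW rth)// lef_pV2 ?posrE//.
  by rewrite ler_pM2r.
rewrite natrD normrM ler_pM//; last by rewrite ger0_norm// invr_ge0 ltW.
apply: le_trans (ler_normD _ _) _; rewrite normrN ger0_norm; last first.
  by rewrite mulr_ge0// ltW.
rewrite lerD2l normrM ler_pM//.
  by rewrite normrM ger0_norm.
by rewrite ger0_norm ?invr_ge0 ?(ltW (r_gt0 k))// lef_pV2 ?posrE.
Qed.

Variable T : nat -> R.
Hypothesis TE : forall k, v k = T k.+1 + T k.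

(** The recurrence concerns the sums of two consecutive terms. To return to [T], the quotient
    [y k = T k.+1 / v k] satisfies [y k.+1 = 1 - y k / r k], a contraction of rate 1/N with limiting
    fixed point 1/(1 + rho). *)
Lemma cvgn_alternating_ratio :
  (fun k => T k / T k.+1) @ \oo --> (s * (s + 2))^-1.
Proof.
set rho := (s * (s + 2))^-1.
have rho0 : 0 < rho by rewrite invr_gt0.
have rV : (fun k => (r k)^-1) @ \oo --> rho.
  by apply: cvgV; [rewrite gt_eqF|exact: cvgn_recurrence_ratio].
pose y k := T k.+1 / v k.
have yE k : y k.+1 = 1 - y k / r k.
  rewrite /y /r; have := TE k.+1 => h; have h1 := v_gt0 k; have h2 := v_gt0 k.+1.
  have -> : T k.+2 = v k.+1 - T k.+1 by rewrite h addrK.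
  by field; rewrite (gt_eqF h1) (gt_eqF h2).
have ycvg : y @ \oo --> (1 + rho)^-1.
  suff : (fun k => `|y k - (1 + rho)^-1|) @ \oo --> (0 : R).
    by move=> /norm_cvg0P/subr_cvg0.
  apply: (@cvgn0_perturbed_contraction N^-1 _
    (fun k => `|((r k)^-1 - rho) * (1 + rho)^-1|)) => //.
  - by rewrite invr_ge0 (ltW N_gt0) invf_lt1//.
  - move=> k; rewrite yE.
    have -> : 1 - y k / r k - (1 + rho)^-1 =
      - ((r k)^-1 * (y k - (1 + rho)^-1) + ((r k)^-1 - rho) * (1 + rho)^-1).
      have h1 : 0 < 1 + rho by rewrite addr_gt0.
      by have h := r_gt0 k; field; rewrite (gt_eqF h) (gt_eqF h1).
    rewrite normrN; apply: le_trans (ler_normD _ _) _.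
    rewrite lerD2r normrM; apply: ler_wpM2r => //.
    rewrite ger0_norm ?invr_ge0 ?(ltW (r_gt0 k))//.
    by rewrite lef_pV2 ?posrE.
  - rewrite -[X in _ --> X](@normr0 _ R) -(mul0r (1 + rho)^-1) -(subrr rho).
    by apply: cvg_norm; apply: cvgMl; apply: cvgB => //; exact: cvg_cst.
rewrite -(cvg_shiftS (fun k => T k / T k.+1)) /=.
have : (fun k => y k / r k / y k.+1) @ \oo --> (1 + rho)^-1 * rho / (1 + rho)^-1.
  apply: cvgM; first exact: cvgM.
  apply: cvgV; first by rewrite gt_eqF// invr_gt0 addr_gt0.
  by rewrite (cvg_shiftS y).
rewrite mulrAC divff ?mul1r ?gt_eqF ?invr_gt0 ?addr_gt0//.
apply: cvg_trans; apply: near_eq_cvg; near=> k.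
have h1 := v_gt0 k; have h2 := v_gt0 k.+1; rewrite /y /r.
have [->|T2] := eqVneq (T k.+2) 0; first by rewrite mul0r !invr0 !mulr0.
by field; rewrite T2 (gt_eqF h1) (gt_eqF h2).
Unshelve. all: by end_near. Qed.

End RecurrentSequences.

Section Counting.
Variables (R : realType) (n : nat).

Definition tree_count m : R := \sum_(t <- trees_upto n m And | tree_size t == m) 1.

Lemma tree_gf_coef h c m :
  (tree_gf n ('X : {poly R}) h)`_m =
  \sum_(t <- trees_upto n h c | tree_size t == m) 1.
Proof.
rewrite -(sum_trees_upto_expr n 'X h c) coef_sum [RHS]big_mkcond.
by apply: eq_bigr => t _; rewrite coefXn eq_sym; case: eqP.
Qed.

(** The count depends neither on the connective, because [tree_gf] does not, nor on the level,
    because the trees of size [m] are all present from level [m] on. *)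
Lemma sum_tree_size_eq h c m : (m <= h)%N ->
  \sum_(t <- trees_upto n h c | tree_size t == m) (1 : R) = tree_count m.
Proof.
move=> mh; rewrite /tree_count -!tree_gf_coef (tree_gf_coef h And m).
by rewrite big_trees_upto_size// -tree_gf_coef.
Qed.

Lemma tree_gf_coef_le h m : (m <= h)%N ->
  (tree_gf n ('X : {poly R}) h)`_m = tree_count m.
Proof. by move=> mh; rewrite (tree_gf_coef h And) sum_tree_size_eq. Qed.

Lemma tree_count_gt0 m : (0 < n)%N -> (3 <= m)%N -> 0 < tree_count m.
Proof.
move=> n0; case: m => // m m2; rewrite ltnS in m2.
pose t : tree n := Node And (nseq m (Leaf (Ordinal n0, true))).
have tm : tree_size t = m.+1.
  by rewrite /t /= map_nseq sumn_nseq mul1n.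
have tC : in_class And t.
  by rewrite /in_class /= size_nseq m2 /= all_nseq orbT.
have := in_class_mem_trees_upto (eq_leq tm) tC.
rewrite /tree_count big_mkcond => tU; rewrite (bigD1_seq t) ?trees_upto_uniq//.
rewrite tm eqxx ltr_pwDl// sumr_ge0// => u _.
by case: ifP.
Qed.

(* Modulo a high power of X, the polynomial P is a root of the quadratic
   equation (1 + X) P^2 - (1 + 2n X) P + 2n X = 0; S is the square root of
   its discriminant D, and 2 D S' = D' S. *)
Lemma tree_count_rec k :
  (k + 4)%:R * (tree_count k.+4 + tree_count k.+3) =
  2 * n.*2%:R * (k%:R + 5 / 2) * (tree_count k.+3 + tree_count k.+2)
  - (n.*2%:R ^+ 2 - 4 * n.*2%:R) * (k%:R + 1) * (tree_count k.+2 + tree_count k.+1).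
Proof.
pose h := k.+4.+1.
pose P : {poly R} := tree_gf n 'X h.
pose N : R := n.*2%:R.
have P0 : P`_0 = 0.
  by rewrite tree_gf_coef_le// /tree_count big_nil.
(* Without constant term, [P ^+ h] is divisible by ['X^h], so cutting the geometric sum only affects
   high degrees. *)
have [Q PE] : exists Q : {poly R}, P = 'X * Q.
  exists (\poly_(i < size P) P`_i.+1); apply/polyP => -[|i].
    by rewrite P0 coefXM.
  rewrite coefXM coef_poly /=; case: ltnP => // /leq_trans h1.
  by rewrite nth_default// h1.
(* Passing to the next level changes no coefficient of degree at most [h]. *)
have [Q1 PS] : exists Q1 : {poly R}, tree_gf n 'X h.+1 = P + 'X^(h.+1) * Q1.
  pose Z : {poly R} := tree_gf n 'X h.+1 - P.
  exists (\poly_(i < size Z) Z`_(i + h.+1)); rewrite -[LHS](subrK P) -/Z addrC.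
  congr (_ + _); apply/polyP => i. rewrite coefXnM; case: ltnP => hi.
    by rewrite /Z coefB !tree_gf_coef_le ?subrr// ltnW.
  rewrite coef_poly subnK//; case: ltnP => // hi'.
  by rewrite nth_default// (leq_trans hi')// leq_subr.
have geo : (\sum_(j < h) P ^+ j) * (1 - P) = 1 - P ^+ h.
  by rewrite -[RHS]opprB subrX1 -mulNr opprB mulrC.
have [W quad] : exists W : {poly R}, (1 + 'X) * P ^+ 2 - (1 + N *: 'X) * P + N *: 'X = 'X^(h.+1) * W.
  exists (Q1 * (1 - P) + Q ^+ h * P).
  have := PS; rewrite tree_gfS -/P -[_ *+ n.*2]scaler_nat -/N => E.
  have E2 : ('X^(h.+1) * Q1) * (1 - P) =
      (N *: 'X - P) * (1 - P) + 'X * P * (1 - P ^+ h - (1 - P)).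
    rewrite -geo -[_ * Q1](addKr P) -E; ring.
  have E3 : P ^+ h = 'X^h * Q ^+ h by rewrite PE exprMn.
  transitivity ('X^(h.+1) * Q1 * (1 - P) + 'X * ('X^h * Q ^+ h) * P); last by rewrite exprS; ring.
  by rewrite E2 -E3 -!mul_polyC; ring.
have Pcoef j : (j <= h)%N -> P`_j = tree_count j by exact: tree_gf_coef_le.
clearbody P; clear PS geo PE P0.
pose S : {poly R} := 1 + N *: 'X - 2 * (1 + 'X) * P.
pose D : {poly R} := 1 - (2 * N) *: 'X + (N ^+ 2 - 4 * N) *: 'X^2.
have SS : S ^+ 2 = D + 'X^(h.+1) * (4 * (1 + 'X) * W).
  have -> : 'X^(h.+1) * (4 * (1 + 'X) * W) = 4 * (1 + 'X) * ('X^(h.+1) * W) by ring.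
  rewrite -quad /S /D -!mul_polyC !(polyCB, polyCM, polyC_exp, polyC_natr).
  ring.
set W2 := 4 * _ * W in SS.
have dS : 2 * S * S^`() = D^`() + 'X^h * (h.+1%:R * W2 + 'X * W2^`()).
  have := congr1 (@deriv R) SS; clearbody W2.
  rewrite derivD expr2 (derivM S S) (derivM 'X^(h.+1) W2) derivXn /= -[_ *+ h.+1]mulr_natl exprS => E.
  have -> : D^`() + 'X^h * (h.+1%:R * W2 + 'X * W2^`()) =
    D^`() + ((h.+1%:R * 'X^h) * W2 + 'X * 'X^h * W2^`()) by ring.
  by rewrite -E; ring.
have DS : 2 * (D * S^`()) = S * D^`() +
    'X^h * (S * (h.+1%:R * W2 + 'X * W2^`()) - 2 * 'X * W2 * S^`()).
  have -> : 2 * (D * S^`()) = 2 * (D + 'X^(h.+1) * W2) * S^`() - 2 * ('X^(h.+1) * W2) * S^`() by ring.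
  rewrite -SS; have -> : 2 * S ^+ 2 * S^`() = S * (2 * S * S^`()) by ring.
  by rewrite dS exprS; ring.
have D'E : D^`() = - (2 * N)%:P + (2 * (N ^+ 2 - 4 * N)) *: 'X.
  rewrite /D derivD derivB derivZ derivZ derivX derivXn /= -[1]/(1%:P) derivC -!mul_polyC !(polyCB, polyCM, polyC_exp, polyC_natr); ring.
(* Since [h] is [k + 5], the coefficient at [k.+3] does not see the error term. *)
have := congr1 (fun p : {poly R} => p`_(k.+3)) DS.
rewrite /= [X in _ = X]coefD coefXnM (_ : (k.+3 < h)%N) ?addr0; last first.
  by rewrite /h ltnS leqW.
have -> : 2 * (D * S^`()) =
    2 *: (S^`() - (2 * N) *: ('X * S^`()) + (N ^+ 2 - 4 * N) *: ('X^2 * S^`())).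
  rewrite /D -!mul_polyC !(polyCB, polyCM, polyC_exp, polyC_natr); ring.
have -> : S * D^`() = (2 * (N ^+ 2 - 4 * N)) *: ('X * S) - (2 * N) *: S.
  rewrite D'E -!mul_polyC !(polyCB, polyCM, polyC_exp, polyC_natr); ring.
have SE j : (j.+2 <= h)%N -> S`_j.+2 = - 2 * (tree_count j.+2 + tree_count j.+1).
  move=> jh; have -> : S = 1 + N *: 'X - (2 *: P + 2 *: ('X * P)).
    rewrite /S -!mul_polyC !(polyCB, polyCM, polyC_exp, polyC_natr); ring.
  rewrite !coefE /= !Pcoef//; last exact: ltnW.
  ring.
have S4 := SE k.+2 (leqnSn _); have S3 := SE k.+1 (leqW (leqnSn _)).
have S2 := SE k (leqW (leqW (leqnSn _))).
clearbody S; rewrite !(coefZ, coefD, coefB, coefN, coefXM, coefXnM) !coef_deriv.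
rewrite ![k.+3.-1]/= !subSS subn0 {}S4 {}S3 {}S2 -/N.
clear D DS dS D'E SS quad W2 W SE S Pcoef P h; clearbody N.
rewrite -!(mulr_natr (_ * _)) natrD -[k.+4%:R]natr1 -[k.+3%:R]natr1 -[k.+2%:R]natr1 -[k.+1%:R]natr1 /=.
move: (tree_count _) (tree_count _) (tree_count _) (tree_count _) (k%:R) => a b c d K E.
apply: (@mulfI _ (-4)); first by rewrite oppr_eq0.
rewrite -[RHS]addr0 -(subrr (2 * (N ^+ 2 - 4 * N) * (-2 * (b + a)) -
  2 * N * (-2 * (c + b)))) -{1}E.
by field.
Qed.

Lemma tree_count_le3 m : (m <= 3)%N ->
  tree_count m = n.*2%:R *+ (m == 1%N) + n.*2%:R ^+ 2 *+ (m == 3%N).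
Proof.
move=> m3; rewrite -(tree_gf_coef_le m3).
have -> : tree_gf n ('X : {poly R}) 3 = n.*2%:R *: 'X + n.*2%:R ^+ 2 *: 'X^3.
  have gf0 : tree_gf n ('X : {poly R}) 0 = 0 by [].
  have gf1 : tree_gf n ('X : {poly R}) 1 = n.*2%:R * 'X.
    by rewrite tree_gfS gf0 mulr0 mul0r addr0 mulr_natl.
  have gf2 : tree_gf n ('X : {poly R}) 2 = n.*2%:R * 'X.
    by rewrite tree_gfS gf1 big_ord1 expr0 subrr mulr0 addr0 mulr_natl.
  rewrite tree_gfS gf2 big_ord_recl big_ord1 expr0 addrAC subrr add0r expr1.
  by rewrite -!mul_polyC !(polyC_exp, polyC_natr) -mulr_natl; ring.
by rewrite coefD !coefZ coefX coefXn !mulr_natr.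
Qed.

Definition sigma_of : R := Num.sqrt n.*2%:R.
Definition rho_of : R := (sigma_of * (sigma_of + 2))^-1.
Definition tau_of : R := sigma_of / (sigma_of + 1).
Local Notation sigma := sigma_of.
Local Notation rho := rho_of.

Hypothesis n_gt0 : (0 < n)%N.

Lemma sigma2 : sigma ^+ 2 = n.*2%:R. Proof. by rewrite sqr_sqrtr. Qed.

Lemma sigma_gt1 : 1 < sigma.
Proof.
by rewrite -[ltLHS]sqrtr1 ltr_sqrt ?ltr0n ?double_gt0// ltr1n -addnn; lia.
Qed.

Lemma sigma_gt0 : 0 < sigma. Proof. exact: lt_trans sigma_gt1. Qed.

Lemma rho_gt0 : 0 < rho.
Proof. by rewrite invr_gt0 mulr_gt0 ?addr_gt0 ?sigma_gt0. Qed.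

Lemma rho_lt1 : rho < 1.
Proof.
rewrite invf_lt1 ?mulr_gt0 ?addr_gt0 ?sigma_gt0//.
by have := sigma_gt1; nra.
Qed.

Lemma cvgn_tree_count_ratio :
  (fun m => tree_count m / tree_count m.+1) @ \oo --> rho.
Proof.
rewrite -(cvg_shiftS (fun m => tree_count m / tree_count m.+1)) /=.
apply: (@cvgn_alternating_ratio _ sigma (fun k => tree_count k.+2 + tree_count k.+1)
   _ _ _ _ _ (fun k => tree_count k.+1)) => //.
- exact: sigma_gt1.
- by rewrite !tree_count_le3// !(mulr0n, mulr1n, addr0, add0r) ltr0n double_gt0.
- by rewrite !tree_count_le3// sigma2 !(mulr0n, mulr1n, addr0, add0r) expr2.
- by move=> k; rewrite sigma2 tree_count_rec.
- rewrite sigma2; case: n n_gt0 => [//|[|m]] _; [by left|right].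
  by rewrite (ler_nat _ 4).
Qed.

End Counting.

(** * Critical Boltzmann weights *)

Lemma eq_cvgn (R : realType) (f g : nat -> R) (l : R) :
  f =1 g -> g @ \oo --> l -> f @ \oo --> l.
Proof. by move=> /funext ->. Qed.

Section Boltzmann.
Variables (R : realType) (n : nat).
Hypothesis n_gt0 : (0 < n)%N.
Local Notation sigma := (sigma_of R n).
Local Notation rho := (rho_of R n).
Local Notation tau := (tau_of R n).
Local Notation tau_ h := (tree_gf n rho h).

Lemma geometric_sum_le (x : R) h : 0 <= x < 1 -> \sum_(j < h) x ^+ j <= (1 - x)^-1.
Proof.
move=> /andP[x0 x1]; rewrite -div1r ler_pdivlMr ?subr_gt0// mulrC.
by rewrite -[leLHS]opprK -mulNr opprB -subrX1 opprB gerBl exprn_ge0.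
Qed.

Lemma tau_ge0 : 0 <= tau.
Proof. by have := sigma_gt0 R n_gt0 => s; rewrite divr_ge0 ?addr_ge0 ?ltW. Qed.

Lemma tau_lt1 : tau < 1.
Proof.
have := sigma_gt0 R n_gt0 => s.
by rewrite ltr_pdivrMr ?addr_gt0// mul1r ltrDl.
Qed.

Lemma onem_tauV : (1 - tau)^-1 = sigma + 1.
Proof.
have s := sigma_gt0 R n_gt0; have s1 : 0 < sigma + 1 by rewrite addr_gt0.
have -> : 1 - tau = (sigma + 1)^-1 by rewrite /tau_of; field; rewrite gt_eqF.
by rewrite invrK.
Qed.

(** As 1/(1 - tau) = sigma + 1, this is the fixed-point equation T = 2n x + x T (1/(1 - T) - 1) at x
    = rho. The truncations iterate a smaller map from 0, so they stay below [tau]. *)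
Lemma tauE : tau = rho *+ n.*2 + rho * tau * sigma.
Proof.
have s := sigma_gt0 R n_gt0; have s1 : 0 < sigma + 1 by rewrite addr_gt0.
have s2 : 0 < sigma + 2 by rewrite addr_gt0.
rewrite -mulr_natl -sigma2 /tau_of /rho_of; field.
by rewrite !gt_eqF.
Qed.

Lemma tau_h_bounds h : 0 <= tau_ h <= tau.
Proof.
have r0 := rho_gt0 R n_gt0.
apply/andP; split.
  by rewrite -(sum_trees_upto_expr _ _ h And); apply: sumr_ge0 => t _; rewrite exprn_ge0// ltW.
elim: h => [|h IH]; first exact: tau_ge0.
have t0 : 0 <= tau_ h.
  by rewrite -(sum_trees_upto_expr _ _ h And); apply: sumr_ge0 => t _; rewrite exprn_ge0// ltW.
rewrite tree_gfS [leRHS]tauE lerD2l.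
have [->|h0] := posnP h.
  by rewrite mulr0 mul0r mulr_ge0 ?(ltW (sigma_gt0 R n_gt0))// mulr_ge0 ?tau_ge0 ?(ltW r0).
apply: ler_pM; rewrite ?mulr_ge0 ?(ltW r0)//.
- by case: h h0 {IH t0} => // h _; rewrite big_ord_recl expr0 addrAC subrr add0r sumr_ge0// => j _;
  rewrite exprn_ge0// -(sum_trees_upto_expr _ _ h.+1 And); apply: sumr_ge0 => t _; rewrite exprn_ge0// ltW.
- by rewrite ler_wpM2l// ltW.
- rewrite lerBlDr -onem_tauV; apply: le_trans (geometric_sum_le _ _) _.
    by rewrite t0 (le_lt_trans IH tau_lt1).
  by rewrite lef_pV2 ?posrE ?subr_gt0 ?tau_lt1// ?(le_lt_trans IH tau_lt1)// lerB.
Qed.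

Lemma tau_h_ge0 h : 0 <= tau_ h. Proof. by case/andP: (tau_h_bounds h). Qed.
Lemma tau_h_le h : tau_ h <= tau. Proof. by case/andP: (tau_h_bounds h). Qed.
Lemma tau_h_lt1 h : tau_ h < 1. Proof. exact: le_lt_trans (tau_h_le h) tau_lt1. Qed.

Lemma cvgn_geometric_tau_h (t : R) : (fun h => tau_ h) @ \oo --> t -> t < 1 ->
  (fun h => \sum_(j < h) tau_ h ^+ j) @ \oo --> (1 - t)^-1.
Proof.
move=> tt t1.
have E h : \sum_(j < h) tau_ h ^+ j = (1 - tau_ h ^+ h) / (1 - tau_ h).
  have h1 : 0 < 1 - tau_ h by rewrite subr_gt0 tau_h_lt1.
  by rewrite -[X in X / _]opprB subrX1 -mulNr opprB mulrAC divff ?mul1r// gt_eqF.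
apply: (eq_cvgn E).
have -> : (1 - t)^-1 = (1 - 0) * (1 - t)^-1 by rewrite subr0 mul1r.
apply: cvgM.
  apply: cvgB; first exact: cvg_cst.
  apply: (@squeeze_cvgr _ _ _ _ (fun=> 0) (fun h => tau ^+ h)).
  - apply: nearW => h; rewrite exprn_ge0 ?tau_h_ge0//=.
    by rewrite lerXn2r ?nnegrE ?tau_ge0 ?tau_h_ge0 ?tau_h_le.
  - exact: cvg_cst.
  - by apply: cvg_expr; rewrite ger0_norm ?tau_ge0 ?tau_lt1.
apply: cvgV; first by rewrite subr_eq0 gt_eqF.
by apply: cvgB => //; exact: cvg_cst.
Qed.

(** The truncations increase to some [t <= tau] that solves the same equation. At the critical point
    its discriminant vanishes: the equation reads ((sigma + 1) t - sigma)^2 = 0, whose only solution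
    is [tau]. *)
Lemma cvgn_tau_h : (fun h => tau_ h) @ \oo --> tau.
Proof.
have r0 := rho_gt0 R n_gt0.
have nd : nondecreasing_seq (fun h => tau_ h).
  move=> h k hk; rewrite -!(sum_trees_upto_expr _ _ _ And).
  by apply: le_big_trees_upto => // t; rewrite exprn_ge0// ltW.
have cv : cvgn (fun h => tau_ h).
  apply: nondecreasing_is_cvgn => //; exists tau => _ [h _ <-]; exact: tau_h_le.
set t := limn (fun h => tau_ h).
have tt : (fun h => tau_ h) @ \oo --> t := cv.
have tle : t <= tau by apply: limr_le => //; apply: nearW => h; exact: tau_h_le.
have t1 : t < 1 := le_lt_trans tle tau_lt1.
have tE : t = rho *+ n.*2 + rho * t * ((1 - t)^-1 - 1).
  have := tt; rewrite -(cvg_shiftS (fun h => tau_ h)) => tS.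
  apply: (cvg_unique _ tS) => //.
  apply: (eq_cvgn (fun h => tree_gfS n rho h)).
  apply: cvgD; first exact: cvg_cst.
  apply: cvgM; first by apply: cvgMr.
  by apply: cvgB; [exact: cvgn_geometric_tau_h|exact: cvg_cst].
suff -> : tau = t by [].
have s := sigma_gt0 R n_gt0; have s1 : 0 < sigma + 1 by rewrite addr_gt0.
have s2 : 0 < sigma + 2 by rewrite addr_gt0.
have h1 : 0 < 1 - t by rewrite subr_gt0.
have /eqP : ((sigma + 1) * t - sigma) ^+ 2 = 0.
  transitivity (sigma * (sigma + 2) * ((1 - t) * (rho *+ n.*2 + rho * t * ((1 - t)^-1 - 1)) - t * (1 - t))).
    rewrite -[rho *+ _]mulr_natl -sigma2 /rho_of; field.
    by rewrite !gt_eqF.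
  by rewrite -tE [(1 - t) * t]mulrC subrr mulr0.
rewrite sqrf_eq0 subr_eq0 => /eqP E.
by rewrite /tau_of -[X in X / _]E mulrAC divff ?mul1r// gt_eqF.
Qed.

Definition words_weight h : R := \sum_(j < h.+1) tau_ h ^+ j.

Lemma words_weightE h c :
  \sum_(ts <- words h (trees_upto n h c)) rho ^+ forest_size ts = words_weight h.
Proof.
under eq_bigr do rewrite expr_forest_size.
by rewrite big_words_prod sum_trees_upto_expr.
Qed.

Lemma words_weight_le h : words_weight h <= sigma + 1.
Proof.
rewrite -onem_tauV; apply: le_trans (geometric_sum_le _ _) _.
  by rewrite tau_h_ge0 tau_h_lt1.
by rewrite lef_pV2 ?posrE ?subr_gt0 ?tau_lt1 ?tau_h_lt1// lerB// tau_h_le.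
Qed.

Lemma words_weight_ge1 h : 1 <= words_weight h.
Proof.
rewrite /words_weight big_ord_recl expr0 lerDl sumr_ge0// => j _.
by rewrite exprn_ge0// tau_h_ge0.
Qed.

Lemma cvgn_words_weight : words_weight @ \oo --> sigma + 1.
Proof.
have E h : words_weight h = \sum_(j < h) tau_ h ^+ j + tau_ h ^+ h.
  by rewrite /words_weight big_ord_recr.
apply: (eq_cvgn E).
rewrite -(addr0 (sigma + 1)); apply: cvgD.
  rewrite -onem_tauV; apply: cvgn_geometric_tau_h; [exact: cvgn_tau_h|exact: tau_lt1].
apply: (@squeeze_cvgr _ _ _ _ (fun=> 0) (fun h => tau ^+ h)).
- apply: nearW => h; rewrite exprn_ge0 ?tau_h_ge0//=.
  by rewrite lerXn2r ?nnegrE ?tau_ge0 ?tau_h_ge0 ?tau_h_le.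
- exact: cvg_cst.
- by apply: cvg_expr; rewrite ger0_norm ?tau_ge0 ?tau_lt1.
Qed.

(** Criticality: a layer is a node of weight rho with a word of weight sigma + 1 on each side of the
    path, the empty pair being excluded; the total weight is 1. *)
Lemma rho_sigma : rho * ((sigma + 1) ^+ 2 - 1) = 1.
Proof.
have s := sigma_gt0 R n_gt0; have s2 : 0 < sigma + 2 by rewrite addr_gt0.
by rewrite /rho_of; field; rewrite !gt_eqF.
Qed.

End Boltzmann.

(** * Layers and contexts *)

Section Contexts.
Variable n : nat.
Implicit Types (c : connective) (t u : tree n) (ts ls rs : seq (tree n)).

Definition layer := (seq (tree n) * seq (tree n))%type.
Implicit Types (p : layer) (w : seq layer).

Definition layer_size p := (forest_size p.1 + forest_size p.2).+1.
Definition context_size w := sumn (map layer_size w).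

Fixpoint plug c w u : tree n :=
  if w is p :: w' then Node c (p.1 ++ plug (dual_connective c) w' u :: p.2) else u.

Definition eval_forest (x : assignment n) c ts : bool :=
  if c is And then all (eval_tree x) ts else has (eval_tree x) ts.

Definition connect c : bool -> bool -> bool := if c is And then andb else orb.

Lemma eval_Node x c ts : eval_tree x (Node c ts) = eval_forest x c ts.
Proof. by case: c. Qed.

Lemma eval_forest_cat x c ls rs :
  eval_forest x c (ls ++ rs) = connect c (eval_forest x c ls) (eval_forest x c rs).
Proof. by case: c; rewrite /= ?all_cat ?has_cat. Qed.

Lemma eval_forest_cons x c t ts :
  eval_forest x c (t :: ts) = connect c (eval_tree x t) (eval_forest x c ts).
Proof. by case: c. Qed.

Fixpoint eval_context (x : assignment n) c w (b : bool) : bool :=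
  if w is p :: w' then
    connect c (eval_forest x c (p.1 ++ p.2)) (eval_context x (dual_connective c) w' b)
  else b.

Lemma eval_plug x c w u :
  eval_tree x (plug c w u) = eval_context x c w (eval_tree x u).
Proof.
elim: w c => [//|p w IH] c /=; rewrite -IH -[LHS]/(eval_tree x (Node c _)) eval_Node.
rewrite !eval_forest_cat eval_forest_cons.
by rewrite /connect; case: c; [rewrite andbA andbAC | rewrite orbA orbAC].
Qed.

Lemma tree_size_plug c w u : tree_size (plug c w u) = (context_size w + tree_size u)%N.
Proof.
elim: w c => [//|p w IH] c /=; rewrite -/(forest_size _) forest_size_cat.
rewrite /forest_size /= IH /context_size /= /layer_size /forest_size; lia.
Qed.

Definition context_computes c w (f : boolfun n) :=
  [forall x, forall b, eval_context x c w b == f x].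

Lemma context_computesP c w (f : boolfun n) :
  reflect (forall x b, eval_context x c w b = f x) (context_computes c w f).
Proof.
apply: (iffP forallP) => [h x b|h x]; first by have /forallP/(_ b)/eqP := h x.
by apply/forallP => b; rewrite h.
Qed.

Definition layers h c : seq layer :=
  let W := words h (trees_upto n h (dual_connective c)) in
  [seq p <- [seq (ls, rs) | ls <- W, rs <- W] | (0 < size p.1 + size p.2)%N].

Fixpoint contexts j h c : seq (seq layer) :=
  if j is j'.+1 then
    [seq p :: w | p <- layers h c, w <- contexts j' h (dual_connective c)]
  else [:: [::]].

Lemma big_contexts (S : nmodType) j h c (F : seq layer -> S) :
  \sum_(w <- contexts j.+1 h c) F w =
  \sum_(p <- layers h c) \sum_(w <- contexts j h (dual_connective c)) F (p :: w).
Proof. by rewrite /= big_allpairs_dep. Qed.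

Lemma big_layers (S : nmodType) h c (F : layer -> S) :
  let W := words h (trees_upto n h (dual_connective c)) in
  \sum_(p <- layers h c) F p =
  \sum_(ls <- W) \sum_(rs <- W | (0 < size ls + size rs)%N) F (ls, rs).
Proof.
move=> W; rewrite big_filter big_mkcond big_allpairs; apply: eq_bigr => ls _.
by rewrite [RHS]big_mkcond.
Qed.

Lemma big_layers_nil (S : nmodType) h c (F : layer -> S) :
  let W := words h (trees_upto n h (dual_connective c)) in
  F ([::], [::]) + \sum_(p <- layers h c) F p =
  \sum_(ls <- W) \sum_(rs <- W) F (ls, rs).
Proof.
move=> W; rewrite big_layers -/W.
rewrite -[LHS]addr0 -[in LHS]big_words_size_gt0 -[RHS]big_words_size_gt0 addr0.
rewrite addrA; congr (_ + _).
  by rewrite -[RHS]big_words_size_gt0.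
by apply: eq_bigr => ls ls0; apply: eq_bigl => rs; rewrite addn_gt0 ls0.
Qed.

End Contexts.

(** * Trees with a marked node and the layers above it *)

Section Marking.
Variables (R : realType) (n : nat).
Implicit Types (c : connective).

(** A word with a marked letter splits in one way into prefix, letter and suffix. Summing the sizes
    of all its letters gives [forest_size], and bounding the lengths on both sides only loses
    terms. *)
Lemma le_marked_words (A : seq (tree n)) k l (G : seq (tree n) -> R) :
  (forall ts, 0 <= G ts) ->
  \sum_(ls <- words k A) \sum_(u <- A) \sum_(rs <- words l A)
    (tree_size u)%:R * G (ls ++ u :: rs) <=
  \sum_(ts <- words (k + l).+1 A) (forest_size ts)%:R * G ts.
Proof.
elim: k G => [|k IH] G G0.
  rewrite big_seq1 big_words mul0r add0r; apply: ler_sum => u _.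
  apply: ler_sum => ts _; apply: ler_wpM2r => //.
  by rewrite ler_nat leq_addr.
rewrite big_words [leRHS]big_words mul0r add0r.
under [leRHS]eq_bigr do [under eq_bigr do
  rewrite -[forest_size (_ :: _)]/(tree_size _ + forest_size _)%N natrD mulrDl;
  rewrite big_split].
rewrite big_split; apply: lerD.
  apply: ler_sum => u _; apply: le_big_words => //.
  - by rewrite leqW ?leq_addl.
  - by move=> ts; rewrite mulr_ge0.
by apply: ler_sum => t _; apply: (IH (fun ts => G (t :: ts))).
Qed.

(* The factor [tree_size] counts the choices of a marked node: below the root,
   that node lies in a child [u], and the siblings of [u] form a layer. *)
Lemma le_marked_layer h H c (F : tree n -> R) : (h.*2 < H)%N ->
  (forall t, 0 <= F t) ->
  \sum_(p <- layers n h c) \sum_(u <- trees_upto n H (dual_connective c))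
    (tree_size u)%:R * F (Node c (p.1 ++ u :: p.2)) <=
  \sum_(t <- trees_upto n H.+1 c) (tree_size t)%:R * F t.
Proof.
move=> hH F0; rewrite big_trees_upto.
apply: (@le_trans _ _ (\sum_(ts <- words H (trees_upto n H (dual_connective c)) | (2 <= size ts)%N)
   (forest_size ts)%:R * F (Node c ts))); last first.
  apply: ler_wpDl; first by apply: sumr_ge0 => l _; rewrite mulr_ge0.
  apply: ler_sum => ts _; apply: ler_wpM2r => //.
  by rewrite ler_nat /= leqnSn.
set A := trees_upto n H _.
pose G ts := if (2 <= size ts)%N then F (Node c ts) else 0.
have G0 ts : 0 <= G ts by rewrite /G; case: ifP.
have -> : \sum_(ts <- words H A | (2 <= size ts)%N) (forest_size ts)%:R * F (Node c ts) =
    \sum_(ts <- words H A) (forest_size ts)%:R * G ts.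
  rewrite big_mkcond; apply: eq_bigr => ts _; rewrite /G; case: ifP => //.
  by rewrite mulr0.
have mono k l (B : seq (tree n) -> R) : (k <= l)%N -> (forall ts, 0 <= B ts) ->
   \sum_(ts <- words k (trees_upto n h (dual_connective c))) B ts <=
   \sum_(ts <- words l A) B ts.
  move=> kl B0; apply: le_big_words => // E E0; apply: le_big_trees_upto => //.
  by rewrite (leq_trans _ hH)// -addnn leqW// leq_addr.
apply: (@le_trans _ _ (\sum_(ts <- words (h + h).+1 A) (forest_size ts)%:R * G ts)); last first.
  by apply: le_big_words => // [|ts]; rewrite ?addnn// mulr_ge0.
apply: le_trans (le_marked_words A h h G0).
rewrite big_layers.
have -> : \sum_(ls <- words h (trees_upto n h (dual_connective c)))
    \sum_(rs <- words h (trees_upto n h (dual_connective c)) | (0 < size ls + size rs)%N)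
    \sum_(u <- A) (tree_size u)%:R * F (Node c (ls ++ u :: rs)) =
  \sum_(ls <- words h (trees_upto n h (dual_connective c))) \sum_(u <- A)
    \sum_(rs <- words h (trees_upto n h (dual_connective c)))
    (tree_size u)%:R * G (ls ++ u :: rs).
  apply: eq_bigr => ls _; rewrite exchange_big /=; apply: eq_bigr => u _.
  rewrite big_mkcond; apply: eq_bigr => rs _.
  by rewrite /G size_cat /= addnS ltnS; case: ifP => //; rewrite mulr0.
apply: le_trans (mono _ _ _ (leqnn h) _) _.
  by move=> ls; do 2!apply: sumr_ge0 => ? _; rewrite mulr_ge0.
apply: ler_sum => ls _; apply: ler_sum => u _; apply: mono => // rs.
by rewrite mulr_ge0.
Qed.

Lemma le_marked_context j h H c (F : tree n -> R) : (h.*2 < H)%N ->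
  (forall t, 0 <= F t) ->
  \sum_(w <- contexts n j h c)
    \sum_(u <- trees_upto n H (iter j dual_connective c))
    (tree_size u)%:R * F (plug c w u) <=
  \sum_(t <- trees_upto n (H + j) c) (tree_size t)%:R * F t.
Proof.
move=> hH; elim: j c F => [|j IH] c F F0; first by rewrite big_seq1 addn0.
rewrite big_contexts addnS.
apply: le_trans (le_marked_layer (h := h) _ _ F0); last first.
  by rewrite (leq_trans hH)// leq_addr.
apply: ler_sum => p _; rewrite iterSr.
exact: (IH (dual_connective c) (fun u => F (Node c (p.1 ++ u :: p.2)))).
Qed.

Definition fun_count c m (f : boolfun n) : R :=
  \sum_(t <- trees_upto n m c | (tree_size t == m) && (tree_fun t == f)) 1.

Lemma sum_fun_count c m : \sum_f fun_count c m f = tree_count R n m.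
Proof.
rewrite -(sum_tree_size_eq R n c (leqnn m)) (exchange_big_dep (fun t => tree_size t == m)) /=.
  apply: eq_bigr => t tm; rewrite (big_pred1 (tree_fun t))// => f.
  by rewrite tm eq_sym.
by move=> f t _ /andP[].
Qed.

(** Plugging any tree of size [m - context_size w] below a context that computes [f] gives a tree of
    size [m] for [f], with as many possible marks as the plugged tree has nodes. On the right, every
    tree has [m] marks. *)
Lemma le_fun_count j h c m f :
  \sum_(w <- contexts n j h c | context_computes c w f)
    (m - context_size w)%:R * (if (context_size w <= m)%N
       then tree_count R n (m - context_size w) else 0) <=
  m%:R * fun_count c m f.
Proof.
pose H := (m + h.*2).+1.
pose F (t : tree n) : R := if (tree_size t == m) && (tree_fun t == f) then 1 else 0.
have F0 t : 0 <= F t by rewrite /F; case: ifP.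
have -> : m%:R * fun_count c m f =
    \sum_(t <- trees_upto n (H + j) c) (tree_size t)%:R * F t.
  rewrite /fun_count mulr_sumr big_mkcondr.
  rewrite -(big_trees_upto_size _ (h := H + j)); last by rewrite /H; lia.
  rewrite big_mkcond; apply: eq_bigr => t _; rewrite /F.
  by case: (tree_size t =P m) => [->|_] /=; [case: ifP|]; rewrite ?mulr1 ?mulr0.
apply: le_trans (le_marked_context j (h := h) c _ F0); last by rewrite /H; lia.
rewrite big_mkcond; apply: ler_sum => w _.
case: ifPn => [/context_computesP wf|_]; last first.
  by apply: sumr_ge0 => u _; rewrite mulr_ge0.
case: leqP => wm; last first.
  by rewrite mulr0; apply: sumr_ge0 => u _; rewrite mulr_ge0.
rewrite -(sum_tree_size_eq R n (iter j dual_connective c) (h := H)); last by rewrite /H; lia.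
rewrite mulr_sumr big_mkcond; apply: ler_sum => u _.
case: eqP => [um|_]; last by rewrite mulr_ge0.
rewrite mulr1 um /F tree_size_plug um subnKC// eqxx /=.
suff -> : tree_fun (plug c w u) == f by rewrite mulr1.
by apply/eqP/ffunP => x; rewrite ffunE eval_plug wf.
Qed.

End Marking.

(** * Existence of the limit *)

Section SupremumLimit.
Variables (R : realType) (I : finType) (K : Type).
Variables (x : nat -> I -> R) (p : K -> I -> R).
Hypothesis x_ge0 : forall m i, 0 <= x m i.
Hypothesis sum_x : \forall m \near \oo, \sum_i x m i = 1.
Hypothesis p_le_x : forall k i e, 0 < e -> \forall m \near \oo, p k i - e <= x m i.
Hypothesis sum_p : forall e, 0 < e -> exists k, 1 - e <= \sum_i p k i.

(** The value [x m i] is 1 minus the other values. These are bounded below by some [p k1] whose mass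
    is almost 1, so [x m i] cannot exceed [p k1 i] by much. *)
Lemma supremum_limit i : exists l : R,
  [/\ (fun m => x m i) @ \oo --> l, forall k, p k i <= l &
      forall C, (forall k, p k i <= C) -> l <= C].
Proof.
have p_le1 k : p k i <= 1.
  apply/ler_addgt0Pr => e e0; rewrite -lerBlDr.
  have [m [h1 h2]] := @filter_ex _ _ _ _ (filterI (p_le_x k i e0) sum_x).
  apply: le_trans h1 _; rewrite -h2 (bigD1 i)//= lerDl.
  exact: sumr_ge0.
pose S := [set p k i | k in setT].
have [k0 _] := sum_p ltr01.
have supS : has_sup S.
  by split; [exists (p k0 i), k0|exists 1 => _ [k _ <-]].
have p_le k : p k i <= sup S by apply: sup_upper_bound => //; exists k.
exists (sup S); split => // [|C hC]; last first.
  by apply: sup_le_ub => [|_ [k _ <-]//]; case: supS.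
apply/cvgrPdist_le => e e0; have e2 : 0 < e / 2 by rewrite divr_gt0.
have [_ [k _ <-] hk] := sup_adherent e2 supS.
have [k1 hk1] := sum_p e2.
(* The errors on the other indices must add up to at most [e / 2]. *)
pose d := e / 2 / (#|I|.+1)%:R.
have d0 : 0 < d by rewrite divr_gt0.
have all_le : \forall m \near \oo, forall j, p k1 j - d <= x m j.
  by apply: filter_forall => j; exact: p_le_x.
have klx := p_le_x k i e2.
near=> m; rewrite ler_distlC; apply/andP; split.
  have : p k i - e / 2 <= x m i by near: m.
  lra.
have Sx : \sum_i x m i = 1 by near: m.
have lx : forall j, p k1 j - d <= x m j by near: m.
have h : \sum_(j | j != i) (p k1 j - d) <= \sum_(j | j != i) x m j.
  by apply: ler_sum => j _.
have : \sum_(j | j != i) d <= e / 2.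
  rewrite sumr_const -[d *+ _]mulr_natr /d -(mulrA (e / 2)) ler_piMr ?(ltW e2)//.
  rewrite mulrC ler_pdivrMr// mul1r ler_nat.
  by rewrite (leq_trans (max_card _))// cardE.
move: Sx hk1 h; rewrite (bigD1 i)//= [in X in _ <= X -> _](bigD1 i)//= sumrB.
by have := p_le k1; lra.
Unshelve. all: by end_near. Qed.

End SupremumLimit.

Section Limit.
Variables (R : realType) (n : nat).
Hypothesis n_gt0 : (0 < n)%N.
Local Notation sigma := (sigma_of R n).
Local Notation rho := (rho_of R n).
Local Notation T := (tree_count R n).
Implicit Types (c : connective) (f : boolfun n) (p : layer n) (w : seq (layer n)).

Definition context_weight j h c f : R :=
  \sum_(w <- contexts n j h c | context_computes c w f) rho ^+ context_size w.

Lemma cvgn_tree_count_shift s : (fun m => T m / T (m + s)%N) @ \oo --> rho ^+ s.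
Proof.
elim: s => [|s IH].
  rewrite expr0; apply: (@cvg_trans _ (cst (1 : R) @ \oo)); last exact: cvg_cst.
  apply: near_eq_cvg.
  near=> m; rewrite addn0 divff// gt_eqF// tree_count_gt0//.
  by near: m; exact: nbhs_infty_ge.
rewrite exprS mulrC.
have h : (fun m => T (m + s)%N / T (m + s).+1) @ \oo --> rho.
  have := @cvgn_tree_count_ratio R n n_gt0.
  by rewrite -(cvg_shiftn s (fun m => T m / T m.+1)).
apply: cvg_trans (cvgM IH h); apply: near_eq_cvg; near=> m.
rewrite addnS /= mulrA divfK// gt_eqF// tree_count_gt0// (@leq_trans m)// ?leq_addr//.
by near: m; exact: nbhs_infty_ge.
Unshelve. all: by end_near. Qed.

Lemma cvgn_marked_ratio s :
  (fun m => (m - s)%:R * (if (s <= m)%N then T (m - s)%N else 0) / (m%:R * T m))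
  @ \oo --> rho ^+ s.
Proof.
rewrite -(cvg_shiftn s (fun m => (m - s)%:R *
  (if (s <= m)%N then T (m - s)%N else 0) / (m%:R * T m))) /=.
have h : (fun m => 1 - s%:R / (m + s.+1)%:R : R) @ \oo --> (1 : R).
  by have := cvgB (cvg_cst (1 : R)) (@cvgn_invS R s%:R s); rewrite subr0; apply.
have h1 : (fun m => 1 - s%:R / (m + s)%:R : R) @ \oo --> (1 : R).
  rewrite -(cvg_shiftS (fun m => 1 - s%:R / (m + s)%:R : R)).
  by apply: (eq_cvgn _ h) => m /=; rewrite addSnnS.
rewrite -(mul1r (rho ^+ s)).
apply: cvg_trans (cvgM h1 (cvgn_tree_count_shift (s := s))); apply: near_eq_cvg.
near=> m; rewrite addnK leq_addl /=.
have m0 : (0 < m)%N by near: m; exact: nbhs_infty_ge.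
have ms : 0 < (m + s)%:R :> R by rewrite ltr0n addn_gt0 m0.
have -> : 1 - s%:R / (m + s)%:R = m%:R / (m + s)%:R :> R.
  rewrite -[X in X - _](@divff _ (m + s)%:R) ?gt_eqF// -mulrBl natrD; congr (_ / _).
  by rewrite addrK.
by rewrite invfM mulrACA.
Unshelve. all: by end_near. Qed.

(** For fixed [j] and [h] there are finitely many contexts, so [le_fun_count] passes to the limit
    term by term. *)
Lemma le_context_weight_near j h c f e : 0 < e ->
  \forall m \near \oo, context_weight j h c f - e <= fun_count R c m f / T m.
Proof.
move=> e0.
pose F w m := (m - context_size w)%:R * (if (context_size w <= m)%N
       then T (m - context_size w)%N else 0) / (m%:R * T m).
have : (fun m => \sum_(w <- contexts n j h c | context_computes c w f) F w m)
    @ \oo --> context_weight j h c f.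
  rewrite /context_weight; elim: (contexts n j h c) => [|w s IH].
    rewrite big_nil; apply: eq_cvgn (cvg_cst (0 : R)) => m.
    by rewrite big_nil.
  rewrite big_cons; case: ifPn => wf.
    apply: (eq_cvgn _ (cvgD (cvgn_marked_ratio (s := context_size w)) IH)) => m.
    by rewrite big_cons wf.
  by apply: (eq_cvgn _ IH) => m; rewrite big_cons (negPf wf).
move=> /cvgrPdist_le/(_ e e0); apply: filterS2 (nbhs_infty_ge 3) => m m3 hm.
have m0 : 0 < m%:R :> R by rewrite ltr0n (leq_trans _ m3).
have T0 : 0 < T m by apply: tree_count_gt0.
apply: le_trans (_ : \sum_(w <- contexts n j h c | context_computes c w f) F w m <= _).
  by move: hm; rewrite ler_distlC => /andP[].
rewrite -mulr_suml ler_pdivrMr ?mulr_gt0//.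
apply: le_trans (le_fun_count _ _ _ _ _ _) _.
by rewrite mulrCA mulfVK// gt_eqF.
Qed.

Definition neg_literal (l : literal n) : literal n := (l.1, ~~ l.2).

Definition complementary (ts : seq (tree n)) :=
  [exists l : literal n, (Leaf l \in ts) && (Leaf (neg_literal l) \in ts)].

Definition absorbing p := complementary (p.1 ++ p.2).

Lemma eval_neg_literal x l : eval_literal x (neg_literal l) = ~~ eval_literal x l.
Proof. by case: l => i []; rewrite /eval_literal //= negbK. Qed.

Lemma eval_complementary x c ts : complementary ts ->
  eval_forest x c ts = ~~ bool_of_connective c.
Proof.
case/existsP => l /andP[l1 l2]; case: c => /=.
  apply/allP => h; have := h _ l1; have := h _ l2.
  by rewrite /= eval_neg_literal => /negP.
apply/hasP; have [lx|lx] := boolP (eval_literal x l); first by exists (Leaf l).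
by exists (Leaf (neg_literal l)) => //=; rewrite eval_neg_literal.
Qed.

Lemma absorbing_computes c p w : absorbing p ->
  context_computes c (p :: w) (const_fun n (~~ bool_of_connective c)).
Proof.
move=> pA; apply/context_computesP => x b /=; rewrite (eval_complementary x c pA) ffunE.
by case: c.
Qed.

Lemma context_computes_cons c p w (g f : boolfun n) :
  context_computes (dual_connective c) w g ->
  (forall x, f x = connect c (eval_forest x c (p.1 ++ p.2)) (g x)) ->
  context_computes c (p :: w) f.
Proof.
move=> /context_computesP wg fE; apply/context_computesP => x b /=.
by rewrite wg fE.
Qed.

Lemma context_computes_inj c w (f g : boolfun n) :
  context_computes c w f -> context_computes c w g -> f = g.
Proof.
move=> /context_computesP wf /context_computesP wg; apply/ffunP => x.
by rewrite -(wf x true) wg.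
Qed.

Definition computing c w := [exists f : boolfun n, context_computes c w f].

Lemma not_computing c w : ~~ computing c w -> all (predC absorbing) w.
Proof.
elim: w c => //= p w IH c; apply: contraR; rewrite negb_and negbK => /orP[pA|wA].
  by apply/existsP; eexists; exact: absorbing_computes pA.
have /negbNE/existsP[g wg] := contra (IH (dual_connective c)) wA.
apply/existsP; exists [ffun x => connect c (eval_forest x c (p.1 ++ p.2)) (g x)].
by apply: context_computes_cons wg _ => x; rewrite ffunE.
Qed.

Lemma expr_context_size (S : pzSemiRingType) (z : S) w :
  z ^+ context_size w = \prod_(p <- w) z ^+ layer_size p.
Proof.
elim: w => [|p w IH]; first by rewrite big_nil expr0.
by rewrite big_cons -IH -exprD.
Qed.

Lemma big_contexts_prod j h c (g : layer n -> R) V :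
  (forall d, \sum_(p <- layers n h d) g p = V) ->
  \sum_(w <- contexts n j h c) \prod_(p <- w) g p = V ^+ j.
Proof.
move=> gV; elim: j c => [|j IH] c; first by rewrite big_seq1 big_nil expr0.
rewrite big_contexts.
under eq_bigr => p _ do (under eq_bigr do rewrite big_cons; rewrite -mulr_sumr IH).
by rewrite -mulr_suml gV exprS.
Qed.

Lemma le_big_contexts_prod j h c (g : layer n -> R) V :
  (forall p, 0 <= g p) -> (forall d, \sum_(p <- layers n h d) g p <= V) ->
  \sum_(w <- contexts n j h c) \prod_(p <- w) g p <= V ^+ j.
Proof.
move=> g0 gV.
have V0 : 0 <= V by apply: le_trans (gV c); apply: sumr_ge0.
elim: j c => [|j IH] c; first by rewrite big_seq1 big_nil expr0.
rewrite big_contexts exprS; apply: le_trans (_ : \sum_(p <- layers n h c) g p * V ^+ j <= _).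
  apply: ler_sum => p _.
  under eq_bigr do rewrite big_cons.
  by rewrite -mulr_sumr ler_wpM2l.
by rewrite -mulr_suml ler_wpM2r ?exprn_ge0.
Qed.

Definition layers_weight h : R := rho * (words_weight R n h ^+ 2 - 1).

Lemma layers_weightE h c :
  \sum_(p <- layers n h c) rho ^+ layer_size p = layers_weight h.
Proof.
pose G (p : layer n) : R := rho ^+ layer_size p.
have := big_layers_nil h c G; rewrite /= => E.
have G0 : G ([::], [::]) = rho by rewrite /G -[layer_size _]/1%N expr1.
apply: (addrI (G ([::], [::]))); rewrite E G0.
rewrite /layers_weight mulrBr mulr1 addrC subrK.
rewrite expr2 -{1}(words_weightE R n h (dual_connective c)) mulr_suml mulr_sumr.
apply: eq_bigr => ls _; rewrite -(words_weightE R n h (dual_connective c)) !mulr_sumr.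
by apply: eq_bigr => rs _; rewrite /G /layer_size /= exprS exprD.
Qed.

Lemma layers_weight_ge0 h : 0 <= layers_weight h.
Proof.
rewrite -(layers_weightE h And); apply: sumr_ge0 => p _.
by rewrite exprn_ge0// ltW// rho_gt0.
Qed.

Lemma layers_weight_le1 h : layers_weight h <= 1.
Proof.
rewrite -(rho_sigma R n_gt0) ler_wpM2l ?(ltW (rho_gt0 _ _))// lerB// lerXn2r ?nnegrE//.
- by apply: le_trans (words_weight_ge1 R n_gt0 h).
- by rewrite addr_ge0// ltW// sigma_gt0.
- exact: words_weight_le.
Qed.

Lemma cvgn_layers_weight : layers_weight @ \oo --> (1 : R).
Proof.
rewrite -(rho_sigma R n_gt0); apply: cvgMr; apply: cvgB; last exact: cvg_cst.
by rewrite expr2; apply: cvgM; exact: cvgn_words_weight.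
Qed.

Definition absorbing_weight h c : R :=
  \sum_(p <- layers n h c | absorbing p) rho ^+ layer_size p.

Lemma mem_layers h c (ls rs : seq (tree n)) :
  let A := trees_upto n h (dual_connective c) in
  ((ls, rs) \in layers n h c) =
  [&& 0 < size ls + size rs, size ls <= h, all (mem A) ls, size rs <= h & all (mem A) rs]%N.
Proof.
rewrite mem_filter /=; congr (_ && _).
apply/allpairsP/idP => [[[l1 r1] /=]|].
  by rewrite !mem_words => -[/andP[h1 h2] /andP[h3 h4] [-> ->]]; rewrite h1 h2 h3 h4.
by case/and4P => h1 h2 h3 h4; exists (ls, rs); rewrite /= !mem_words h1 h2 h3 h4.
Qed.

Lemma layers_uniq h c : uniq (layers n h c).
Proof.
rewrite filter_uniq// allpairs_uniq ?words_uniq ?trees_upto_uniq//.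
by move=> [? ?] [].
Qed.

Lemma mem_Leaf_trees_upto h c l : (0 < h)%N -> Leaf l \in trees_upto n h c.
Proof. by move=> h0; apply: in_class_mem_trees_upto. Qed.

(** A layer made of x_1 and its negation has size 3. This bound degrades with n, but is enough for
    the existence and the positivity of the limit at fixed n. *)
Lemma absorbing_weight_ge h c : (2 <= h)%N -> rho ^+ 3 <= absorbing_weight h c.
Proof.
move=> h2; pose l : literal n := (Ordinal n_gt0, true).
pose p : layer n := ([:: Leaf l; Leaf (neg_literal l)], [::]).
have h0 : (0 < h)%N := ltnW h2.
have pL : p \in layers n h c by rewrite mem_layers /= h2 !mem_Leaf_trees_upto.
have pA : absorbing p.
  by apply/existsP; exists l; rewrite /= !inE !eqxx orbT.
rewrite /absorbing_weight big_mkcond (bigD1_seq p) ?layers_uniq//= pA.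
rewrite lerDl; apply: sumr_ge0 => q _; case: ifP => // _.
by rewrite exprn_ge0// ltW// rho_gt0.
Qed.

(** All contexts with [j] layers weigh [layers_weight h ^+ j]. A context that computes no function
    has no absorbing layer, and each of its layers is drawn from a total weight of at most
    [1 - rho ^+ 3]. *)
Lemma sum_context_weight_ge j h c : (2 <= h)%N ->
  layers_weight h ^+ j - (1 - rho ^+ 3) ^+ j <= \sum_f context_weight j h c f.
Proof.
move=> h2; rewrite (exchange_big_dep (computing c)) /=; last first.
  by move=> f w _ wf; apply/existsP; exists f.
have -> : \sum_(w <- contexts n j h c | computing c w)
     \sum_(f | context_computes c w f) rho ^+ context_size w =
  \sum_(w <- contexts n j h c | computing c w) rho ^+ context_size w.
  apply: eq_bigr => w /existsP[f wf]; rewrite (big_pred1 f)// => g.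
  by apply/idP/eqP => [wg|->//]; apply: context_computes_inj wg wf.
rewrite lerBlDr.
rewrite -(big_contexts_prod j c (layers_weightE h)).
under eq_bigr do rewrite -expr_context_size.
rewrite (bigID (computing c)) /= lerD2l.
pose g p : R := if absorbing p then 0 else rho ^+ layer_size p.
have g0 p : 0 <= g p by rewrite /g; case: ifP => // _; rewrite exprn_ge0// ltW// rho_gt0.
apply: le_trans (_ : _ <= \sum_(w <- contexts n j h c) \prod_(p <- w) g p) _; last first.
  apply: le_big_contexts_prod => // d.
  rewrite lerBrDr; apply: le_trans (layers_weight_le1 h).
  rewrite -(layers_weightE h d) [leRHS](bigID absorbing) /= [leLHS]addrC; apply: lerD.
    exact: absorbing_weight_ge.
  rewrite [leRHS]big_mkcond; apply: ler_sum => p _; rewrite /g.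
  by case: ifP.
rewrite big_mkcond; apply: ler_sum => w _; case: ifPn => [wN|_]; last first.
  by apply: prodr_ge0.
have := not_computing wN; rewrite expr_context_size.
elim: w {wN} => [|p w IH] /=; first by rewrite !big_nil.
move=> /andP[pN /IH wN]; rewrite !big_cons /g (negPf pN) ler_wpM2l//.
by rewrite exprn_ge0// ltW// rho_gt0.
Qed.

(** The depth is fixed first, to make the power of [1 - rho ^+ 3] small; only then is [h] taken
    large enough for [layers_weight h] to this power to be close to 1. *)
Lemma sum_context_weight_near e : 0 < e -> exists j h, forall c,
  1 - e <= \sum_f context_weight j.+1 h c f.
Proof.
move=> e0; have e2 : 0 < e / 2 by rewrite divr_gt0.
have r0 := rho_gt0 R n_gt0; have r1 := rho_lt1 R n_gt0.
have q : `|1 - rho ^+ 3| < 1.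
  rewrite ger0_norm ?subr_ge0 ?exprn_ile1 ?ltW//.
  by rewrite gtrBl exprn_gt0.
have /cvgrPdist_le/(_ (e / 2) e2) := cvg_expr q.
case=> J _ hJ; have := hJ J.+1 (leqnSn J); rewrite sub0r normrN => qJ.
have : (fun h => layers_weight h ^+ J.+1) @ \oo --> (1 : R).
  rewrite -(expr1n _ J.+1); elim: J.+1 => [|k IH].
    by apply: eq_cvgn (cvg_cst _) => h; rewrite !expr0.
  rewrite exprS; apply: (@eq_cvgn _ _ (fun h => layers_weight h * layers_weight h ^+ k)).
    by move=> h; rewrite exprS.
  by apply: cvgM => //; exact: cvgn_layers_weight.
move=> /cvgrPdist_le/(_ (e / 2) e2) [H _ hH].
exists J, (maxn H 2) => c.
have := hH (maxn H 2) (leq_maxl _ _); rewrite /= ler_distlC => /andP[h1 _].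
apply: le_trans (sum_context_weight_ge J.+1 c (leq_maxr _ _)).
by move: qJ; rewrite ler_norml => /andP[_]; lra.
Qed.

End Limit.

(** * The limits P_n(f) as suprema of context weights *)

Section LimitProbability.
Variables (R : realType) (n : nat).
Implicit Types (c : connective) (f : boolfun n).

Lemma card_fset_set_seq (T : choiceType) (A : set T) (s : seq T) :
  uniq s -> (forall t, A t <-> t \in s) -> #|` fset_set A| = size s.
Proof.
move=> us As; have -> : A = [set` [fset t in s]%fset].
  by apply/seteqP; split => t /=; rewrite inE; apply As.
by rewrite set_fsetK card_fseq undup_id.
Qed.

Lemma natr_size_filter (T : Type) (s : seq T) (P : pred T) :
  (size [seq t <- s | P t])%:R = \sum_(t <- s | P t) 1 :> R.
Proof. by rewrite size_filter -sum1_count natr_sum. Qed.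

(** From size 2 on, the root label separates the two classes; a single leaf would be counted
    twice. *)
Lemma card_trees_of_size m (P : pred (tree n)) : (2 <= m)%N ->
  #|` fset_set (@trees_of_size n m `&` [set t | P t])|%:R =
  \sum_(t <- trees_upto n m And | (tree_size t == m) && P t) 1 +
  \sum_(t <- trees_upto n m Or | (tree_size t == m) && P t) 1 :> R.
Proof.
move=> m2; pose s c := [seq t <- trees_upto n m c | (tree_size t == m) && P t].
have classP c t : in_class c t -> (2 <= tree_size t)%N -> root_label t = Some c.
  case: t => // d ts /andP[_] /= dc _; congr Some.
  by case: c d dc => -[].
have sP c t : t \in s c -> root_label t = Some c.
  rewrite mem_filter => /andP[/andP[/eqP tm _]] /mem_trees_upto_class tc.
  by apply: classP => //; rewrite tm.
rewrite (@card_fset_set_seq _ _ (s And ++ s Or)).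
- by rewrite size_cat natrD !natr_size_filter.
- rewrite cat_uniq !filter_uniq ?trees_upto_uniq//= andbT.
  by apply/hasPn => t /sP tO; apply/negP => /sP; rewrite tO.
- move=> t; rewrite mem_cat !mem_filter; split.
    move=> [[tA tm] /= ->]; rewrite tm eqxx /=.
    have tU c : root_label t != Some (dual_connective c) -> t \in trees_upto n m c.
      by move=> h; apply: in_class_mem_trees_upto; [rewrite tm|rewrite /in_class tA].
    case tr : (root_label t) => [[]|]; apply/orP.
    + by left; apply: tU; rewrite tr.
    + by right; apply: tU; rewrite tr.
    + by left; apply: tU; rewrite tr.
  by case/orP => /andP[/andP[/eqP tm Pt] /mem_trees_upto_class/andP[tA _]]; split.
Qed.

Lemma prob_sizeE m f : (2 <= m)%N ->
  prob_size R m f =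
  (fun_count R And m f + fun_count R Or m f) / (2 * tree_count R n m).
Proof.
move=> m2; rewrite /prob_size.
have -> : [set t | tree_fun t = f] = [set t | tree_fun t == f].
  by apply/seteqP; split => t /= /eqP.
congr (_ / _); first exact: (card_trees_of_size (fun t => tree_fun t == f)).
have -> : @trees_of_size n m = trees_of_size m `&` [set t | predT t].
  by apply/seteqP; split => [t|t []].
rewrite card_trees_of_size// mulr_natl mulr2n.
rewrite -{1}(sum_tree_size_eq R n And (leqnn m)) -(sum_tree_size_eq R n Or (leqnn m)).
by congr (_ + _); apply: eq_bigl => t; rewrite andbT.
Qed.

Hypothesis n_gt0 : (0 < n)%N.

(** The index of the lower bounds is the pair [(j, h)]. Each root label accounts for half of the
    trees, whence the average over [And] and [Or]. *)
Lemma prob_supremum f :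
  [/\ (fun m => prob_size R m f) @ \oo --> prob R f,
      forall j h, (context_weight R j.+1 h And f + context_weight R j.+1 h Or f) / 2
        <= prob R f &
      forall C, (forall j h c, context_weight R j.+1 h c f <= C) -> prob R f <= C].
Proof.
pose x m (f : boolfun n) := prob_size R m f.
pose p (k : nat * nat) (f : boolfun n) : R :=
  (context_weight R k.1.+1 k.2 And f + context_weight R k.1.+1 k.2 Or f) / 2.
have [| | | |l [xl pl lC]] := @supremum_limit R _ _ x p _ _ _ _ f.
- by move=> m g; rewrite /x /prob_size divr_ge0.
- near=> m.
  have m3 : (3 <= m)%N by near: m; exact: nbhs_infty_ge.
  under eq_bigr do rewrite /x prob_sizeE ?(ltnW m3)//.
  rewrite -mulr_suml big_split /= !sum_fun_count -mulr2n -[_ *+ 2]mulr_natl divff//.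
  by rewrite gt_eqF// mulr_gt0// tree_count_gt0.
- move=> k g e e0.
  have h c := le_context_weight_near (R := R) n_gt0 k.1.+1 k.2 c g e0.
  have hA := h And; have hO := h Or.
  near=> m.
  have m3 : (3 <= m)%N by near: m; exact: nbhs_infty_ge.
  have T0 : 0 < tree_count R n m by rewrite tree_count_gt0.
  rewrite /x prob_sizeE ?(ltnW m3)// [2 * _]mulrC invfM mulrA mulrDl.
  have : context_weight R k.1.+1 k.2 And g - e <= fun_count R And m g / tree_count R n m.
    by near: m.
  have : context_weight R k.1.+1 k.2 Or g - e <= fun_count R Or m g / tree_count R n m.
    by near: m.
  by rewrite /p; lra.
- move=> e e0; have [j [h hc]] := sum_context_weight_near (R := R) n_gt0 e0.
  exists (j, h); rewrite -mulr_suml big_split /=.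
  by have := hc And; have := hc Or; lra.
have -> : prob R f = l by exact: cvg_lim.
split=> // [j h|C hC]; first exact: (pl (j, h)).
apply: lC => k; rewrite /p.
by have := hC k.1 k.2 And; have := hC k.1 k.2 Or; lra.
Unshelve. all: by end_near. Qed.

Lemma cvgn_prob f : (fun m => prob_size R m f) @ \oo --> prob R f.
Proof. by case: (prob_supremum f). Qed.

Lemma prob_ge_context_weight f j h :
  (context_weight R j.+1 h And f + context_weight R j.+1 h Or f) / 2 <= prob R f.
Proof. by case: (prob_supremum f). Qed.

Lemma prob_le_context_weight f C :
  (forall j h c, context_weight R j.+1 h c f <= C) -> prob R f <= C.
Proof. by case: (prob_supremum f) => _ _; apply. Qed.

Lemma prob_ge0 f : 0 <= prob R f.
Proof.
apply: le_trans (prob_ge_context_weight f 0 0).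
by rewrite divr_ge0// addr_ge0//; apply: sumr_ge0 => w _; rewrite exprn_ge0// ltW// rho_gt0.
Qed.

Lemma sum_prob : \sum_(f : boolfun n) prob R f = 1.
Proof.
have : (fun m => \sum_(f : boolfun n) prob_size R m f) @ \oo --> \sum_(f : boolfun n) prob R f.
  elim: (index_enum _) => [|f s IH].
    by rewrite big_nil; apply: eq_cvgn (cvg_cst (0 : R)) => m; rewrite big_nil.
  rewrite big_cons; apply: (eq_cvgn _ (cvgD (@cvgn_prob f) IH)) => m.
  by rewrite big_cons.
move=> h; apply: (cvg_unique _ h) => //.
apply: (@cvg_trans _ (cst (1 : R) @ \oo)); last exact: cvg_cst.
apply: near_eq_cvg; near=> m.
have m3 : (3 <= m)%N by near: m; exact: nbhs_infty_ge.
under eq_bigr do rewrite prob_sizeE ?(ltnW m3)//.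
rewrite -mulr_suml big_split /= !sum_fun_count -mulr2n -[_ *+ 2]mulr_natl divff//.
by rewrite gt_eqF// mulr_gt0// tree_count_gt0.
Unshelve. all: by end_near. Qed.

Fixpoint dual_tree (t : tree n) : tree n :=
  match t with
  | Leaf l => Leaf (neg_literal l)
  | Node c ts => Node (dual_connective c) (map dual_tree ts)
  end.

Lemma dual_treeK : involutive dual_tree.
Proof.
elim/tree_nested_ind => /= [[i b]|c ts IH]; first by rewrite /neg_literal /= negbK.
rewrite dual_connectiveK -map_comp; congr Node.
by elim: ts IH => //= t ts IHts [-> /IHts ->].
Qed.

Lemma tree_size_dual t : tree_size (dual_tree t) = tree_size t.
Proof.
elim/tree_nested_ind: t => //= c ts IH; congr _.+1; rewrite -map_comp.
by elim: ts IH => //= t ts IHts [-> /IHts ->].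
Qed.

Lemma associative_dual t : associative (dual_tree t) = associative t.
Proof.
elim/tree_nested_ind: t => //= c ts IH; rewrite size_map all_map; congr (_ && _).
elim: ts IH => //= t ts IHts [tE /IHts ->]; rewrite tE; congr (_ && _ && _).
by case: t {tE} => // d us; case: (c) (d) => -[].
Qed.

Lemma eval_dual x t : eval_tree x (dual_tree t) = ~~ eval_tree x t.
Proof.
elim/tree_nested_ind: t => [l|c ts IH]; first exact: eval_neg_literal.
rewrite -[dual_tree _]/(Node _ _) !eval_Node.
elim: ts IH => [_|t ts IHts [tE tsE]]; first by case: (c).
by rewrite map_cons !eval_forest_cons tE IHts//; case: (c) => /=; rewrite ?negb_and ?negb_or.
Qed.

(** De Morgan duality is a size-preserving involution of the associative trees that negates the
    computed function. *)
Lemma prob_true_false : prob R (const_fun n true) = prob R (const_fun n false).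
Proof.
congr (limn _); apply/funext => m; congr (_%:R / _).
pose A b := trees_of_size m `&` [set t | tree_fun t = const_fun n b].
have finA b : finite_set (A b) by apply: finite_setIl; exact: finite_trees_of_size.
have AP b t : A b t -> A (~~ b) (dual_tree t).
  move=> [[tA tm] tf]; split; first by split; rewrite ?associative_dual ?tree_size_dual.
  apply/ffunP => x; rewrite !ffunE eval_dual.
  by have /ffunP/(_ x) := tf; rewrite !ffunE => ->.
rewrite -/(A true) -/(A false).
rewrite (@card_fset_set_seq _ (A true) [seq dual_tree t | t <- fset_set (A false)]).
- by rewrite size_map.
- by rewrite map_inj_uniq ?fset_uniq//; exact: inv_inj dual_treeK.
- move=> t; split => [tA|/mapP[u]].
    rewrite -[t]dual_treeK map_f// in_fset_set// inE; exact: (AP true).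
  by rewrite in_fset_set// inE => uA ->; exact: (AP false).
Qed.

End LimitProbability.

(** * Words with few distinct leaves *)

Section FewDistinctLeaves.
Variables (R : realType) (n : nat).
Implicit Types (c : connective) (t : tree n) (ts ls rs : seq (tree n)).
Implicit Types (D : {set literal n}) (O : pred (literal n)).

Definition leaf_set O ts : {set literal n} := [set l | O l && (Leaf l \in ts)].

Definition fresh_leaf O D t := if t is Leaf l then O l && (l \notin D) else false.

Lemma card_leaf_set_cons O D t ts :
  #|leaf_set O (t :: ts) :\: D| =
  if t is Leaf l then
    if O l && (l \notin D) then #|leaf_set O ts :\: (l |: D)|.+1
    else #|leaf_set O ts :\: D|
  else #|leaf_set O ts :\: D|.
Proof.
case: t => [l|d us]; last first.
  by apply: eq_card => l; rewrite !inE.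
have memE k : (k \in leaf_set O (Leaf l :: ts)) = (O k && ((k == l) || (Leaf k \in ts))).
  by rewrite !inE; congr (_ && (_ || _)); apply/eqP/eqP => [[]|->].
case: ifPn => [/andP[Ol lD]|].
  rewrite (_ : _ :\: D = l |: (leaf_set O ts :\: (l |: D))).
    by rewrite cardsU1 !inE eqxx add1n.
  apply/setP => k; rewrite finset.in_setD memE !inE negb_or.
  by case: eqP => [->|_] /=; rewrite ?lD ?Ol.
rewrite negb_and negbK => lD; apply: eq_card => k; rewrite !finset.in_setD memE inE.
by case: eqP lD => [->|//] /orP[/negPf->|->].
Qed.

(* Reading a word from left to right, [b d] bounds the weight of the words
   that contain fewer than [d] distinct leaves of [O] outside [D]. *)
Lemma few_distinct_leaves (A : seq (tree n)) (v : tree n -> R) O K (b : nat -> R) :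
  (forall t, 0 <= v t) -> (forall d, 0 <= b d) ->
  (forall D d, D \subset O -> (#|D| + d.+1 <= K)%N ->
    1 + \sum_(t <- A) v t * (if fresh_leaf O D t then b d else b d.+1) <= b d.+1) ->
  forall k D d, D \subset O -> (#|D| + d <= K)%N ->
  \sum_(ts <- words k A | (#|leaf_set O ts :\: D| < d)%N) \prod_(t <- ts) v t <= b d.
Proof.
move=> v0 b0 hb; elim=> [|k IH] D [|d] DO Dd.
- by rewrite big_pred0// => ts; rewrite ltn0.
- rewrite big_mkcond big_seq1 big_nil; apply: le_trans (hb D d DO Dd).
  case: ifP => _; rewrite ?lerDl ?addr_ge0//; apply: sumr_ge0 => t _;
  by rewrite mulr_ge0//; case: ifP.
- by rewrite big_pred0// => ts; rewrite ltn0.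
rewrite big_words_cond; apply: le_trans (hb D d DO Dd); apply: lerD.
  by rewrite big_nil; case: ifP.
apply: ler_sum => t _.
under eq_bigr do rewrite big_cons.
rewrite -mulr_sumr ler_wpM2l//.
under eq_bigl do rewrite card_leaf_set_cons.
rewrite /fresh_leaf; case: t => [l|e us]; last exact: IH.
case: ifPn => [/andP[Ol lD]|_]; last exact: IH.
apply: IH.
  by apply/fintype.subsetP => m; rewrite finset.in_setU1 => /predU1P[->//|/(fintype.subsetP DO)].
by rewrite cardsU1 lD -addnA addnCA add1n.
Qed.

End FewDistinctLeaves.

(** * Weight of the absorbing layers *)

Section AbsorbingWeight.
Variables (R : realType) (n : nat).
Hypothesis n_gt0 : (0 < n)%N.
Local Notation sigma := (sigma_of R n).
Local Notation rho := (rho_of R n).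
Local Notation tau := (tau_of R n).
Implicit Types (c : connective) (t : tree n) (ts ls rs : seq (tree n)).
Implicit Types (D : {set literal n}).

Let sigma_gt0 := sigma_gt0 R n_gt0.
Let rho_gt0 := rho_gt0 R n_gt0.

(** The bound is linear, e/q with q = (2n - d) rho. Until [d] distinct leaves have been read, at
    least 2n - d leaves are fresh; each lowers the bound by 1/q, and together they pay for the term
    1 of the empty word. The remaining factor is a truncation of tau, below 1. *)
Lemma few_distinct_leaves_weight h c k d : (d < n.*2)%N ->
  \sum_(ts <- words k (trees_upto n h.+1 c) | (#|leaf_set predT ts| < d)%N)
    rho ^+ forest_size ts <= d%:R / ((n.*2 - d)%:R * rho).
Proof.
move=> dn; have dn0 : 0 < (n.*2 - d)%:R * rho by rewrite mulr_gt0// ltr0n subn_gt0.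
under eq_bigr do rewrite expr_forest_size.
under eq_bigl do rewrite -[leaf_set _ _]finset.setD0.
apply: (@few_distinct_leaves R n _ _ predT d (fun e => e%:R / ((n.*2 - d)%:R * rho))).
- by move=> t; rewrite exprn_ge0// ltW.
- by move=> e; rewrite divr_ge0// ltW.
- move=> D e _ De.
  set q := _ * rho.
  have E (t : tree n) : rho ^+ tree_size t * (if fresh_leaf predT D t then e%:R / q else e.+1%:R / q) =
     rho ^+ tree_size t * (e.+1%:R / q) -
     (if t is Leaf l then if l \notin D then rho / q else 0 else 0).
    rewrite /fresh_leaf; case: t => [l|a us]; last by rewrite subr0.
    rewrite /=; case: ifP => _; last by rewrite subr0.
    by rewrite expr1 -natr1 mulrDl mulrDr mul1r addrK.
  under eq_bigr do rewrite E.
  rewrite sumrB -mulr_suml sum_trees_upto_expr.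
  have -> : \sum_(t <- trees_upto n h.+1 c)
      (if t is Leaf l then if l \notin D then rho / q else 0 else 0) =
      rho / q *+ (n.*2 - #|D|).
    rewrite big_trees_upto [X in _ + X]big1// addr0 -big_mkcond sumr_const.
    by congr (_ *+ _); rewrite -card_literal -(cardC (mem D)) addKn.
  have h1 : tree_gf n rho h.+1 * (e.+1%:R / q) <= e.+1%:R / q.
    by rewrite ler_piMl ?(ltW (tau_h_lt1 R n_gt0 _))// divr_ge0// ltW.
  have h2 : 1 <= rho / q *+ (n.*2 - #|D|).
    rewrite -mulr_natr mulrAC ler_pdivlMr// mul1r /q mulrC ler_wpM2l ?(ltW rho_gt0)//.
    by rewrite ler_nat leq_sub2l// (leq_trans _ De)// leq_addr.
  lra.
- exact: fintype.subset_predT.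
- by rewrite cards0.
Qed.

(** Deleting the leaves of [S] lowers the weight of a letter to at most tau - #|S| rho; the bound is
    the corresponding geometric series, with 1 - tau = 1/(sigma + 1). *)
Lemma avoiding_weight h c (S : {set literal n}) k :
  \sum_(rs <- words k (trees_upto n h.+1 c) | [forall l in S, Leaf l \notin rs])
     rho ^+ forest_size rs <= ((sigma + 1)^-1 + #|S|%:R * rho)^-1.
Proof.
pose v t : R := if t is Leaf l then if l \in S then 0 else rho else rho ^+ tree_size t.
have v0 t : 0 <= v t.
  by rewrite /v; case: t => [l|a us]; [case: ifP|]; rewrite ?exprn_ge0// ltW.
have -> : \sum_(rs <- words k (trees_upto n h.+1 c) | [forall l in S, Leaf l \notin rs])
     rho ^+ forest_size rs =
   \sum_(rs <- words k (trees_upto n h.+1 c)) \prod_(t <- rs) v t.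
  rewrite big_mkcond; apply: eq_bigr => rs _; rewrite expr_forest_size.
  case: ifPn => [/forall_inP h1|/forall_inPn[l lS]].
    apply: eq_big_seq => -[l|//] lrs; rewrite /v; case: ifP => // lS.
    by have := h1 l lS; rewrite lrs.
  rewrite negbK => lrs; elim: rs lrs => // t rs IH.
  rewrite inE big_cons => /predU1P[<-|/IH <-]; first by rewrite /v lS mul0r.
  by rewrite mulr0.
rewrite big_words_prod.
have sv : \sum_(t <- trees_upto n h.+1 c) v t = tree_gf n rho h.+1 - #|S|%:R * rho.
  rewrite -(sum_trees_upto_expr n rho h.+1 c) !big_trees_upto /v /= addrAC; congr (_ + _).
  rewrite expr1 sumr_const card_literal (bigID (mem S)) /= big1 ?add0r; last by move=> l ->.
  under eq_bigr => l lS do rewrite (negPf lS).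
  rewrite sumr_const -(card_literal n) -(cardC (mem S)) mulrnDr mulr_natl addrC addKr.
  by congr (_ *+ _); apply: eq_card.
have sv1 : \sum_(t <- trees_upto n h.+1 c) v t <= tau - #|S|%:R * rho.
  by rewrite sv lerD2r tau_h_le.
have sv0 : 0 <= \sum_(t <- trees_upto n h.+1 c) v t by apply: sumr_ge0.
have e1 : (sigma + 1)^-1 = 1 - tau.
  by rewrite -(onem_tauV R n_gt0) invrK.
have Sr0 : 0 <= #|S|%:R * rho by rewrite mulr_ge0// ltW.
have t1 := tau_lt1 R n_gt0.
apply: le_trans (geometric_sum_le _ _) _; first by rewrite sv0 /=; lra.
by rewrite e1 lef_pV2 ?posrE; lra.
Qed.

(** The left word is asked to contain [d] distinct leaves, and the right word not to avoid all their
    negations. *)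
Lemma absorbing_weight_lower h c d : (d < n.*2)%N ->
  let W := words_weight R n h.+1 in
  d%:R / ((n.*2 - d)%:R * rho) <= W ->
  ((sigma + 1)^-1 + d%:R * rho)^-1 <= W ->
  rho * (W - d%:R / ((n.*2 - d)%:R * rho)) * (W - ((sigma + 1)^-1 + d%:R * rho)^-1)
  <= absorbing_weight R n h.+1 c.
Proof.
move=> dn W W1 W2.
set A := words h.+1 (trees_upto n h.+1 (dual_connective c)).
have few := few_distinct_leaves_weight h (dual_connective c) h.+1 dn.
rewrite -/A in few.
have WE : \sum_(ts <- A) rho ^+ forest_size ts = W by exact: words_weightE.
have many : W - d%:R / ((n.*2 - d)%:R * rho) <=
    \sum_(ls <- A | (d <= #|leaf_set predT ls|)%N) rho ^+ forest_size ls.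
  rewrite lerBlDr -WE (bigID (fun ts => (#|leaf_set predT ts| < d)%N)) /= addrC.
  by apply: lerD => //; rewrite le_eqVlt; apply/orP; left; apply/eqP/eq_bigl => ls; rewrite leqNgt negbK.
have hit ls : (d <= #|leaf_set predT ls|)%N ->
    W - ((sigma + 1)^-1 + d%:R * rho)^-1 <=
    \sum_(rs <- A | complementary (ls ++ rs)) rho ^+ forest_size rs.
  move=> dls.
  pose S : {set literal n} := (@neg_literal n @: leaf_set predT ls)%SET.
  have negK : involutive (@neg_literal n) by case=> i b; rewrite /neg_literal /= negbK.
  have cS : #|S| = #|leaf_set predT ls| by rewrite card_imset//; exact: inv_inj negK.
  have av := avoiding_weight h (dual_connective c) S h.+1; rewrite -/A in av.
  rewrite lerBlDr -WE (bigID (fun rs => complementary (ls ++ rs))) /= lerD2l.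
  apply: le_trans (_ : _ <= ((sigma + 1)^-1 + #|S|%:R * rho)^-1) _; last first.
    have pos (k : nat) : 0 < (sigma + 1)^-1 + k%:R * rho.
      by rewrite ltr_wpDr ?mulr_ge0 ?(ltW rho_gt0)// invr_gt0 addr_gt0.
    by rewrite lef_pV2 ?posrE// lerD2l ler_wpM2r ?(ltW rho_gt0)// ler_nat cS.
  apply: le_trans av; rewrite big_mkcond [leRHS]big_mkcond; apply: ler_sum => rs _.
  case: ifPn => [/existsPn nc|_]; last by case: ifP => // _; rewrite exprn_ge0// ltW.
  case: ifPn => // /forall_inPn[m /imsetP[l lls ->]]; rewrite negbK => lrs.
  have := nc l; rewrite !mem_cat lrs orbT andbT.
  by move: lls; rewrite inE /= => ->.
rewrite /absorbing_weight big_mkcond big_layers.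
apply: le_trans (_ : _ <= \sum_(ls <- A) \sum_(rs <- A | complementary (ls ++ rs))
   rho * (rho ^+ forest_size ls * rho ^+ forest_size rs)) _; last first.
  apply: ler_sum => ls _; rewrite big_mkcond [leRHS]big_mkcond; apply: ler_sum => rs _.
  case: ifPn => cpl.
    rewrite /absorbing /= cpl /layer_size exprS exprD.
    suff -> : (0 < size ls + size rs)%N by [].
    rewrite -size_cat; case: (ls ++ rs) cpl => // /existsP[l].
    by rewrite in_nil.
  by case: ifP => // _; rewrite /absorbing (negPf cpl).
rewrite -mulrA; under eq_bigr do rewrite -mulr_sumr -mulr_sumr.
rewrite -mulr_sumr; apply: ler_wpM2l; first exact: ltW.
apply: le_trans (_ : _ <= \sum_(ls <- A | (d <= #|leaf_set predT ls|)%N)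
   rho ^+ forest_size ls * (W - ((sigma + 1)^-1 + d%:R * rho)^-1)) _.
  by rewrite -mulr_suml; apply: ler_wpM2r => //; rewrite subr_ge0.
rewrite big_mkcond; apply: ler_sum => ls _; case: ifPn => [/hit hl|_].
  by apply: ler_wpM2l => //; rewrite exprn_ge0// ltW.
by rewrite mulr_ge0 ?exprn_ge0 ?(ltW rho_gt0)//; apply: sumr_ge0 => rs _; rewrite exprn_ge0// ltW.
Qed.

End AbsorbingWeight.

(** * Bounds uniform in the number of variables *)

Section UniformBounds.
Variables (R : realType) (n : nat).
Hypothesis n_gt0 : (0 < n)%N.
Local Notation sigma := (sigma_of R n).
Local Notation rho := (rho_of R n).
Implicit Types (c : connective) (t : tree n) (ts ls rs qs : seq (tree n)).

Let sigma_gt0 := sigma_gt0 R n_gt0.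
Let rho_gt0 := rho_gt0 R n_gt0.

(** With [d] about (sigma + 1)/4, words with fewer than [d] distinct leaves weigh at most 1/2, and
    words avoiding [d] given leaves at most 8/9, in units of sigma + 1, while all words weigh at
    least 99/100. The gaps 49/100 and 1/10 multiply to more than 1/50, and rho (sigma + 1)^2 = 1 +
    rho. *)
Lemma absorbing_weight_uniform : 8 <= sigma ->
  exists H, forall h c, (H <= h)%N -> 1 / 50 <= absorbing_weight R n h c.
Proof.
move=> s8; have sg0 : 0 < sigma := sigma_gt0; pose d := Num.truncn ((sigma + 1) / 4).
have : 0 <= (sigma + 1) / 4 by rewrite divr_ge0// addr_ge0// ltW.
move=> /truncn_itv; rewrite -/d -(natr1 d) => /andP[d1 d2].
have rs : rho * (sigma * (sigma + 2)) = 1.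
  by rewrite mulVf// gt_eqF// mulr_gt0// addr_gt0.
have n2E : n.*2%:R = sigma ^+ 2 by rewrite sigma2.
have ss : 8 * sigma <= sigma * sigma by rewrite ler_pM2r.
have dn : (d < n.*2)%N.
  rewrite -(ltr_nat R) n2E expr2; lra.
have := @cvgn_words_weight R n n_gt0.
have e0 : 0 < (sigma + 1) / 100 by rewrite divr_gt0// addr_gt0.
move=> /cvgrPdist_le/(_ _ e0) [H _ hH].
exists H.+1 => -[//|h] c Hh.
have := hH h.+1 (leqW Hh); rewrite /= ler_distlC => /andP[W1 _].
have d0 : 0 <= d%:R :> R by [].
have s1 : 0 < sigma + 1 by rewrite addr_gt0.
have ndE : (n.*2 - d)%:R * rho = (sigma ^+ 2 - d%:R) * rho.
  by rewrite natrB 1?ltnW// n2E.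
have nd : 1 / 2 <= (n.*2 - d)%:R * rho.
  rewrite ndE -(ler_pM2r (x := sigma * (sigma + 2))) ?mulr_gt0 ?addr_gt0//.
  by rewrite -(mulrA _ rho) rs mulr1 expr2; lra.
have Ale : d%:R / ((n.*2 - d)%:R * rho) <= (sigma + 1) / 2.
  rewrite ler_pdivrMr; last by apply: lt_le_trans nd; rewrite divr_gt0.
  apply: le_trans (_ : (sigma + 1) / 2 * (1 / 2) <= _); first by lra.
  by rewrite ler_wpM2l// divr_ge0// ltW.
have sd : 1 / 8 <= (sigma + 1) * (d%:R * rho).
  rewrite -(ler_pM2r (x := sigma * (sigma + 2))) ?mulr_gt0 ?addr_gt0//.
  rewrite -(mulrA (sigma + 1)) -(mulrA d%:R) rs mulr1.
  have : (sigma + 1) * ((sigma + 1) / 8) <= (sigma + 1) * d%:R.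
    by rewrite ler_wpM2l ?ltW//; lra.
  by lra.
have qle : ((sigma + 1)^-1 + d%:R * rho)^-1 <= (8 / 9) * (sigma + 1).
  have q0 : 0 < (sigma + 1)^-1 + d%:R * rho.
    by rewrite ltr_wpDr ?mulr_ge0 ?(ltW rho_gt0)// invr_gt0.
  rewrite -div1r ler_pdivrMr//.
  have -> : 8 / 9 * (sigma + 1) * ((sigma + 1)^-1 + d%:R * rho) =
      8 / 9 * (1 + (sigma + 1) * (d%:R * rho)) by field; rewrite gt_eqF.
  by lra.
have := @absorbing_weight_lower R n n_gt0 h c d dn; rewrite /=.
set A := d%:R / _ in Ale *; set q := _^-1 in qle *; set W := words_weight _ _ _ in W1 *.
move=> /(_ _ _) lower; apply: le_trans (lower _ _); last 2 first.
- lra.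
- lra.
apply: le_trans (_ : rho * ((49 / 100) * (sigma + 1)) * ((1 / 10) * (sigma + 1)) <= _).
  have -> : rho * (49 / 100 * (sigma + 1)) * (1 / 10 * (sigma + 1)) =
    49 / 1000 * (rho * (sigma * (sigma + 2)) + rho) by field.
  by have r0 : 0 < rho := rho_gt0; rewrite rs; lra.
rewrite -!(mulrA rho) ler_wpM2l ?(ltW rho_gt0)//.
by apply: ler_pM; lra.
Qed.

Lemma big_seq_ge (I : eqType) (s : seq I) (P : pred I) (F : I -> R) i :
  uniq s -> i \in s -> P i -> (forall j, 0 <= F j) -> F i <= \sum_(j <- s | P j) F j.
Proof.
move=> us si Pi F0; rewrite big_mkcond (bigD1_seq i)//= Pi lerDl.
by apply: sumr_ge0 => j _; case: ifP.
Qed.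

Lemma context_weight_const_ge h c :
  absorbing_weight R n h c <= context_weight R 1 h c (const_fun n (~~ bool_of_connective c)).
Proof.
rewrite /context_weight big_mkcond big_contexts /absorbing_weight big_mkcond.
apply: ler_sum => p _; rewrite big_seq1; case: ifPn => [pA|_]; last first.
  by case: ifP => // _; rewrite exprn_ge0// ltW.
by rewrite absorbing_computes// /context_size /= addn0.
Qed.

(* An absorbing second layer makes the rest of the tree neutral for the
   connective of the root. *)
Lemma context_weight_forest_ge h c qs (f : boolfun n) :
  (0 < size qs)%N -> all (in_class (dual_connective c)) qs ->
  (forest_size qs <= h)%N -> (forall x, f x = eval_forest x c qs) ->
  rho ^+ (forest_size qs).+1 * absorbing_weight R n h (dual_connective c) <=
  context_weight R 2 h c f.
Proof.
move=> qs0 qsC qsh fE; rewrite /context_weight big_mkcond big_contexts.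
pose G (p : layer n) := \sum_(w <- contexts n 1 h (dual_connective c))
  (if context_computes c (p :: w) f then rho ^+ context_size (p :: w) else 0).
have G0 p : 0 <= G p.
  by apply: sumr_ge0 => w _; case: ifP => // _; rewrite exprn_ge0// ltW.
pose p : layer n := (qs, [::]).
have pL : p \in layers n h c.
  rewrite mem_layers addn0 qs0 /= andbT (leq_trans (size_le_forest_size _) qsh) /=.
  apply/allP => t tqs; apply: in_class_mem_trees_upto; last exact: (allP qsC).
  apply: leq_trans qsh; rewrite /forest_size.
  elim: qs tqs {qs0 qsC fE p G G0} => //= u us IH; rewrite inE => /predU1P[->|/IH].
    exact: leq_addr.
  by move=> /leq_trans; apply; apply: leq_addl.
apply: le_trans (_ : G p <= _); last first.
  exact: (big_seq_ge (P := predT)) (layers_uniq _ _ _) pL isT G0.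
rewrite /G (big_contexts 0) /absorbing_weight mulr_sumr big_mkcond.
apply: ler_sum => q _; rewrite big_seq1.
case: ifPn => [qA|_]; last by case: ifP => // _; rewrite exprn_ge0// ltW.
rewrite (context_computes_cons (g := const_fun n (~~ bool_of_connective (dual_connective c)))).
- by rewrite -exprD /context_size /= /layer_size /= !addn0.
- exact: absorbing_computes.
- by move=> x; rewrite fE cats0 ffunE; case: (c) => /=; rewrite ?andbT ?orbF.
Qed.

(** The exponent is the size of the first layer: the forest and its parent. For a forest with at
    least two trees this is the size of the tree they form; for a single literal it is 2. *)
Lemma prob_ge_forest c qs (f : boolfun n) H a :
  (0 < size qs)%N -> all (in_class (dual_connective c)) qs ->
  (forall x, f x = eval_forest x c qs) ->
  (forall h d, (H <= h)%N -> a <= absorbing_weight R n h d) ->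
  rho ^+ (forest_size qs).+1 * a / 2 <= prob R f.
Proof.
move=> qs0 qsC fE aH; pose h := maxn H (forest_size qs).
apply: le_trans (prob_ge_context_weight R n_gt0 f 1 h).
rewrite ler_wpM2r//.
have := context_weight_forest_ge qs0 qsC (leq_maxr H _) fE; rewrite -/h => h1.
have h2 d : 0 <= context_weight R 2 h d f.
  by apply: sumr_ge0 => w _; rewrite exprn_ge0// ltW.
apply: le_trans (_ : context_weight R 2 h c f <= _); last first.
  by case: c {qsC fE h1} => /=; rewrite ?lerDl ?lerDr.
apply: le_trans h1; rewrite ler_wpM2l ?exprn_ge0 ?(ltW rho_gt0)//.
by rewrite aH// leq_maxl.
Qed.

Lemma prob_true_ge H a : (forall h d, (H <= h)%N -> a <= absorbing_weight R n h d) ->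
  a / 2 <= prob R (const_fun n true).
Proof.
move=> aH; apply: le_trans (prob_ge_context_weight R n_gt0 _ 0 H).
rewrite ler_wpM2r//; apply: le_trans (aH H Or (leqnn H)) _.
apply: le_trans (context_weight_const_ge H Or) _; rewrite /= lerDr.
by apply: sumr_ge0 => w _; rewrite exprn_ge0// ltW.
Qed.

Lemma prob_gt0 (f : boolfun n) : 0 < prob R f.
Proof.
have [t tA tf] := ex_associative_tree f n_gt0.
have [qs [qs0 qsC qsE]] : exists qs, [/\ (0 < size qs)%N, all (in_class Or) qs &
    forall x, f x = eval_forest x And qs].
  case: t tA tf => [l|[] ts] tA tf.
  - by exists [:: Leaf l]; split => // x; rewrite -tf ffunE /= andbT.
  - exists ts; split; last by move=> x; rewrite -tf ffunE.
      by move: tA => /andP[/ltnW].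
    move: tA => /andP[_ /allP h]; apply/allP => u /h.
    by rewrite /in_class andbC.
  - exists [:: Node Or ts]; split => //; first by rewrite /= andbT /in_class tA.
    by move=> x; rewrite -tf ffunE /= andbT.
apply: lt_le_trans (_ : rho ^+ (forest_size qs).+1 * rho ^+ 3 / 2 <= _).
  by rewrite divr_gt0// mulr_gt0// exprn_gt0.
by apply: (prob_ge_forest (c := And) qs0 qsC qsE (H := 2)) => h d; exact: absorbing_weight_ge.
Qed.

(** Words of leaves in which no literal follows its negation, [D] being what has been read so far.
    Their conjunction is satisfiable, hence not constant if nonempty; such layers provide the mass
    that keeps P_n(False) away from 1/2. *)
Fixpoint consistent (D : seq (literal n)) (ts : seq (tree n)) : bool :=
  match ts with
  | [::] => true
  | Leaf l :: ts' => (neg_literal l \notin D) && consistent (l :: D) ts'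
  | _ => false
  end.

Definition leaf_literal t : literal n := if t is Leaf l then l else (Ordinal n_gt0, true).

Lemma consistent_cat D ls rs :
  consistent D (ls ++ rs) = consistent D ls &&
  consistent (rev (map leaf_literal ls) ++ D) rs.
Proof.
elim: ls D => [//|[l|//] ls IH] D /=.
by rewrite IH rev_cons cat_rcons andbA.
Qed.

Lemma consistent_notin D ts l : consistent D ts -> Leaf l \in ts -> neg_literal l \notin D.
Proof.
elim: ts D => [//|[m|//] ts IH] D /= /andP[mD /IH h].
rewrite inE => /predU1P[[->]//|/h].
by rewrite inE negb_or => /andP[].
Qed.

Lemma neg_literalK : involutive (@neg_literal n).
Proof. by case=> i b; rewrite /neg_literal /= negbK. Qed.

Lemma consistent_complementary D ts : consistent D ts -> ~~ complementary ts.
Proof.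
elim: ts D => [|[m|//] ts IH] D /=.
  by move=> _; apply/existsPn => l; rewrite in_nil.
move=> /andP[_ tsm]; apply/existsPn => l; apply/negP => /andP[].
rewrite !inE => /predU1P[[lm]|lts] /predU1P[[lm']|lts'].
- by move: lm'; rewrite -lm; case: l {lm} => i [].
- by have := consistent_notin tsm lts'; rewrite neg_literalK lm mem_head.
- by have := consistent_notin tsm lts; rewrite lm' mem_head.
- by move/existsPn : (IH _ tsm) => /(_ l); rewrite lts lts'.
Qed.

Lemma consistent_all_leaf D ts : consistent D ts ->
  all (fun t => if t is Leaf _ then true else false) ts.
Proof. by elim: ts D => [//|[m|//] ts IH] D /= /andP[_ /IH]. Qed.

Lemma consistent_nonconst D ts : (0 < size ts)%N -> consistent D ts ->
  ~~ is_constant [ffun x => eval_forest x And ts].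
Proof.
move=> ts0 tsD; apply/existsPn => b; apply/eqP => /ffunP E.
have nc := consistent_complementary tsD.
have lf := allP (consistent_all_leaf tsD).
pose x : assignment n := [ffun i => Leaf (i, true) \in ts].
have x1 : eval_forest x And ts.
  apply/allP => -[[i [] ]|e us] uts; last by have := lf _ uts.
    by rewrite /= /eval_literal /= ffunE.
  rewrite /= /eval_literal /= ffunE; apply/negP => its.
  by move/existsPn : nc => /(_ (i, true)); rewrite its uts.
have [l lts] : exists l, Leaf l \in ts.
  case: ts ts0 lf {tsD E nc x x1} => // t ts _ /(_ t (mem_head _ _)).
  by case: t => // l _; exists l; rewrite mem_head.
pose x' : assignment n := [ffun i => ~~ l.2].
have x0 : ~~ eval_forest x' And ts.
  apply/allPn; exists (Leaf l) => //=; rewrite /eval_literal ffunE.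
  by case: l.2.
have := E x; have := E x'; rewrite !ffunE x1 (negPf x0).
by move=> <-.
Qed.

(** Only the negations of the literals already read are forbidden. There are at most [N] of them, so
    each new letter has weight at least [y]. *)
Lemma consistent_weight_ge h c (y : R) N k D : 0 <= y ->
  y <= (n.*2 - N)%:R * rho -> (size D + k <= N)%N ->
  \sum_(j < k.+1) y ^+ j <=
  \sum_(ts <- words k (trees_upto n h.+1 c) | consistent D ts) rho ^+ forest_size ts.
Proof.
move=> y0 yN; elim: k D => [|k IH] D DN.
  by rewrite [leRHS]big_mkcond [leRHS]big_seq1 big_ord1 !expr0.
rewrite big_words_cond big_ord_recl /= !expr0 lerD2l.
rewrite big_trees_upto -[leLHS]addr0; apply: lerD; last first.
  by apply: sumr_ge0 => ts _; rewrite big_pred0.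
apply: le_trans (_ : \sum_(l : literal n | neg_literal l \notin D) rho * \sum_(j < k.+1) y ^+ j <= _).
  rewrite sumr_const -mulrnAl.
  under eq_bigr do rewrite /bump /= exprS.
  rewrite -mulr_sumr; apply: ler_wpM2r; first by apply: sumr_ge0 => j _; rewrite exprn_ge0.
  apply: le_trans yN _; rewrite -[rho *+ _]mulr_natl ler_wpM2r ?(ltW rho_gt0)// ler_nat.
  rewrite leq_subLR -card_literal -(cardC (fun l : literal n => neg_literal l \notin D)) addnC leq_add2r.
  apply: leq_trans (_ : (size D <= _)%N); last by apply: leq_trans DN; rewrite leq_addr.
  rewrite -(size_map (@neg_literal n)); apply: leq_trans (card_size _).
  apply/subset_leq_card/fintype.subsetP => l; rewrite !inE negbK => lD.
  by rewrite -[l]neg_literalK map_f.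
rewrite big_mkcond; apply: ler_sum => l _; case: ifPn => lD; last first.
  by rewrite big_pred0// => ts /=; rewrite (negPf lD).
under eq_bigr do rewrite exprS.
rewrite -mulr_sumr ler_wpM2l ?(ltW rho_gt0)//.
apply: le_trans (IH (l :: D) _) _; first by rewrite /= addSnnS.
by rewrite le_eqVlt; apply/orP; left; apply/eqP; apply: eq_bigl.
Qed.

Definition consistent_layer_weight h : R :=
  \sum_(p <- layers n h And | consistent [::] (p.1 ++ p.2)) rho ^+ layer_size p.

(** Both words have length at most [k], so at most [k.*2] literals are read in all. *)
Lemma consistent_layer_weight_ge h (y : R) k : 0 <= y -> (k <= h)%N ->
  y <= (n.*2 - k.*2)%:R * rho ->
  rho * ((\sum_(j < k.+1) y ^+ j) ^+ 2 - 1) <= consistent_layer_weight h.+1.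
Proof.
move=> y0 kh yk.
pose G (p : layer n) : R :=
  if consistent [::] (p.1 ++ p.2) then rho ^+ layer_size p else 0.
have G0 p : 0 <= G p by rewrite /G; case: ifP => // _; rewrite exprn_ge0// ltW.
have E := big_layers_nil h.+1 And G; cbv zeta in E.
rewrite /consistent_layer_weight [leRHS]big_mkcond -/(\sum_(p <- layers n h.+1 And) G p).
have Gnil : G ([::], [::]) = rho by rewrite /G /= -[layer_size _]/1%N expr1.
rewrite mulrBr mulr1 lerBlDl -[X in _ <= X + _]Gnil E.
have mono (F : seq (tree n) -> R) : (forall ts, 0 <= F ts) ->
    \sum_(ts <- words k (trees_upto n h.+1 Or)) F ts <=
    \sum_(ts <- words h.+1 (trees_upto n h.+1 Or)) F ts.
  by move=> F0; apply: le_big_words => //; exact: leqW.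
apply: le_trans (mono _ _); last by move=> ls; apply: sumr_ge0.
have S0 : 0 <= \sum_(j < k.+1) y ^+ j by apply: sumr_ge0 => j _; rewrite exprn_ge0.
apply: le_trans (_ : rho * ((\sum_(ls <- words k (trees_upto n h.+1 Or) | consistent [::] ls)
     rho ^+ forest_size ls) * \sum_(j < k.+1) y ^+ j) <= _).
  rewrite ler_wpM2l ?(ltW rho_gt0)// expr2 ler_wpM2r//.
  by apply: consistent_weight_ge yk _ => //; rewrite -addnn leq_addr.
rewrite mulr_suml mulr_sumr [leLHS]big_mkcond [leLHS]big_seq [leRHS]big_seq.
apply: ler_sum => ls; rewrite mem_words => /andP[lsk _].
case: ifPn => lsC; last by apply: sumr_ge0.
apply: le_trans (mono _ _) => //.
apply: le_trans (_ : rho * (rho ^+ forest_size ls *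
  \sum_(rs <- words k (trees_upto n h.+1 Or) | consistent (rev (map leaf_literal ls)) rs)
     rho ^+ forest_size rs) <= _).
  apply: ler_wpM2l; first exact: ltW.
  apply: ler_wpM2l; first by rewrite exprn_ge0// ltW.
  apply: (consistent_weight_ge h Or y0 yk).
  by rewrite size_rev size_map -addnn leq_add2r.
rewrite !mulr_sumr big_mkcond; apply: ler_sum => rs _.
rewrite /G /= consistent_cat lsC /= cats0; case: ifP => // _.
by rewrite /layer_size exprS exprD.
Qed.

(** A consistent layer under [And] followed by an absorbing layer under [Or]: the second is always
    true, so the conjunction of the first is computed. *)
Lemma sum_nonconstant_ge h :
  consistent_layer_weight h * absorbing_weight R n h Or <=
  \sum_(f : boolfun n | ~~ is_constant f) context_weight R 2 h And f.
Proof.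
pose F (w : seq (layer n)) : R := rho ^+ context_size w.
pose P (w : seq (layer n)) := if w is [:: p; q] then
  consistent [::] (p.1 ++ p.2) && (0 < size (p.1 ++ p.2))%N && absorbing q else false.
have F0 w : 0 <= F w by rewrite exprn_ge0// ltW.
have PE w : P w -> exists f : boolfun n, ~~ is_constant f /\ context_computes And w f.
  case: w => [//|p [//|q [|//]]] /andP[/andP[pC p0] qA].
  exists [ffun x => eval_forest x And (p.1 ++ p.2)]; split; first exact: consistent_nonconst pC.
  apply: (@context_computes_cons n And p [:: q] _ _ (absorbing_computes Or [::] qA)) => x.
  by rewrite !ffunE [RHS]andbT.
apply: le_trans (_ : \sum_(w <- contexts n 2 h And) (if P w then F w else 0) <= _); last first.
  under [leRHS]eq_bigr do rewrite /context_weight big_mkcond.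
  rewrite exchange_big /=; apply: ler_sum => w _.
  case: ifPn => [/PE[f [fN wf]]|_]; last first.
    by apply: sumr_ge0 => f _; case: ifP => // _; exact: F0.
  rewrite (bigD1 f)//= wf lerDl; apply: sumr_ge0 => g _.
  by case: ifP => // _; exact: F0.
rewrite big_contexts /consistent_layer_weight mulr_suml.
rewrite [leLHS]big_mkcond [leLHS]big_seq [leRHS]big_seq.
apply: ler_sum => p pL; case: ifPn => [pC|_]; last first.
  by apply: sumr_ge0 => q _; case: ifP.
rewrite (big_contexts 0) /absorbing_weight mulr_sumr big_mkcond.
apply: ler_sum => q _; rewrite big_seq1 /P pC.
have -> : (0 < size (p.1 ++ p.2))%N.
  by move: pL; rewrite size_cat mem_filter => /andP[].
by case: ifP => // _; rewrite /F /context_size /= addn0 exprD.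
Qed.

Lemma Bernoulli_le (z : R) k : 0 <= z <= 1 -> 1 - k%:R * (1 - z) <= z ^+ k.
Proof.
move=> /andP[z0 z1]; elim: k => [|k IH]; first by rewrite expr0 mul0r subr0.
rewrite exprS; apply: le_trans (ler_wpM2l z0 IH); rewrite -natr1.
have : 0 <= k%:R * ((1 - z) * (1 - z)) by rewrite mulr_ge0// mulr_ge0// subr_ge0.
by lra.
Qed.

(** For [k] about sigma/8 one has k (1 - y) <= 1/2, so by Bernoulli's inequality the powers of [y]
    up to [k] are at least 1/2. Each side then weighs at least sigma/16, and rho (sigma^2/256 - 1)
    >= 1/500 once sigma >= 40. *)
Lemma consistent_layer_weight_uniform : 40 <= sigma ->
  exists H, forall h, (H <= h)%N -> 1 / 500 <= consistent_layer_weight h.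
Proof.
move=> s40; have sg0 : 0 < sigma := sigma_gt0; have r0 : 0 < rho := rho_gt0.
pose k := Num.truncn (sigma / 8).
have : 0 <= sigma / 8 by rewrite divr_ge0// ltW.
move=> /truncn_itv; rewrite -/k -(natr1 k) => /andP[k1 k2].
have k0 : 0 <= k%:R :> R by [].
have rs : rho * (sigma * (sigma + 2)) = 1.
  by rewrite mulVf// gt_eqF// mulr_gt0// addr_gt0.
have n2E : n.*2%:R = sigma ^+ 2 by rewrite sigma2.
have ss : 40 * sigma <= sigma * sigma by rewrite ler_pM2r.
have kn : (k.*2 <= n.*2)%N by rewrite -(ler_nat R) n2E -mul2n natrM expr2; lra.
pose y := (n.*2 - k.*2)%:R * rho.
have yE : y = (sigma * sigma - 2 * k%:R) * rho.
  by rewrite /y natrB// n2E -mul2n natrM expr2.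
have y0 : 0 <= y by rewrite mulr_ge0// ltW.
have y1 : y <= 1.
  by rewrite yE -[leRHS]rs mulrC; apply: ler_wpM2l; [exact: ltW|lra].
have ky : k%:R * (1 - y) <= 1 / 2.
  have h1 : 1 - y <= (9 / 4 * sigma) * rho.
    have -> : 1 - y = (sigma * 2 + 2 * k%:R) * rho.
      by rewrite yE -[X in X - _]rs; ring.
    by apply: ler_wpM2r; [exact: ltW|lra].
  apply: le_trans (ler_wpM2l k0 h1) _.
  apply: le_trans (_ : sigma / 8 * (9 / 4 * sigma * rho) <= _).
    by rewrite ler_wpM2r// !mulr_ge0 ?ltW.
  rewrite -(ler_pM2r (x := sigma * (sigma + 2))) ?mulr_gt0 ?addr_gt0//.
  rewrite -(mulrA (sigma / 8)) -(mulrA (9 / 4 * sigma)) rs; lra.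
exists k.+1 => -[//|h] kh.
have low : rho * ((\sum_(j < k.+1) y ^+ j) ^+ 2 - 1) <= consistent_layer_weight h.+1.
  exact: consistent_layer_weight_ge.
apply: le_trans low.
have S1 : sigma / 16 <= \sum_(j < k.+1) y ^+ j.
  apply: le_trans (_ : \sum_(j < k.+1) (1 / 2 : R) <= _).
    by rewrite sumr_const card_ord -[1 / 2 *+ _]mulr_natl -(natr1 k); lra.
  apply: ler_sum => j _; apply: le_trans (Bernoulli_le j _); last by rewrite y0.
  apply: le_trans (_ : 1 - k%:R * (1 - y) <= _); first by lra.
  by rewrite lerB// ler_wpM2r ?subr_ge0// ler_nat -ltnS.
apply: le_trans (_ : rho * ((sigma / 16) ^+ 2 - 1) <= _).
  rewrite -(ler_pM2l (x := sigma * (sigma + 2))) ?mulr_gt0 ?addr_gt0//.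
  rewrite [leRHS]mulrA [X in _ <= X * _]mulrC rs mul1r expr2; lra.
apply: ler_wpM2l; first exact: ltW.
rewrite lerB// lerXn2r ?nnegrE//.
  by rewrite divr_ge0// ltW.
by apply: le_trans S1; rewrite divr_ge0// ltW.
Qed.

(** True and False share equally the mass left by the nonconstant functions. *)
Lemma prob_false_le (a : R) :
  a <= \sum_(f : boolfun n | ~~ is_constant f) prob R f ->
  prob R (const_fun n false) <= (1 - a) / 2.
Proof.
move=> aN; have := sum_prob R n_gt0; rewrite (bigID (@is_constant n)) /=.
have ne : const_fun n true != const_fun n false.
  by apply/eqP => /ffunP/(_ [ffun=> true]); rewrite !ffunE.
rewrite (bigD1 (const_fun n true)) /=; last by apply/existsP; exists true.
rewrite (bigD1 (const_fun n false)) /=; last first.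
  by rewrite eq_sym ne andbT; apply/existsP; exists false.
rewrite (prob_true_false R n) [X in _ + (_ + X)]big1 ?addr0; last first.
  by move=> f /andP[/andP[/existsP[[] /eqP->]]]; rewrite eqxx.
by lra.
Qed.

Lemma prob_false_le_uniform : 40 <= sigma ->
  prob R (const_fun n false) <= (1 - 1 / 500 * (1 / 100)) / 2.
Proof.
move=> s40; apply: prob_false_le.
have [H1 h1] := consistent_layer_weight_uniform s40.
have [|H2 h2] := absorbing_weight_uniform; first by apply: le_trans s40; rewrite ler_nat.
pose h := maxn H1 H2.
(* Only contexts with root [And] are kept, so the average over root labels turns 1/50 into 1/100. *)
apply: le_trans (_ : \sum_(f : boolfun n | ~~ is_constant f) context_weight R 2 h And f / 2 <= _).
  rewrite -mulr_suml ler_pdivlMr//; apply: le_trans (sum_nonconstant_ge h).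
  have c1 := h1 h (leq_maxl _ _); have c2 := h2 h Or (leq_maxr _ _).
  apply: le_trans (_ : 1 / 500 * (1 / 50) <= _); first by lra.
  by apply: ler_pM; rewrite ?divr_ge0.
apply: ler_sum => f _; apply: le_trans (prob_ge_context_weight R n_gt0 f 1 h).
rewrite ler_wpM2r// lerDl; apply: sumr_ge0 => w _.
by rewrite exprn_ge0// ltW.
Qed.

End UniformBounds.

(** * Restriction to the essential variables *)

Section Simplification.
Variable m : nat.
Implicit Types (g : assignment m -> bool) (c : connective).

(** Constants are free: they disappear when the tree is simplified. *)
Definition computable_within g s :=
  (exists b, forall x, g x = b) \/
  (exists t : tree m, [/\ associative t, forall x, eval_tree x t = g x & (tree_size t <= s)%N]).

(** A partially simplified node [c]: either an absorbing constant has been met, or the surviving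
    children are listed. The list may have fewer than two elements; when empty it stands for the
    neutral constant. *)
Definition children_within c g s :=
  (forall x, g x = ~~ bool_of_connective c) \/
  (exists qs : seq (tree m), [/\ all (fun t => (root_label t != Some c) && associative t) qs,
     forall x, eval_forest x c qs = g x & (forest_size qs <= s)%N]).

Lemma children_within_neutral c : children_within c (fun=> bool_of_connective c) 0.
Proof. by right; exists [::]; split => // x; case: c. Qed.

Definition children_of c (t : tree m) :=
  if t is Node d ts then if d == c then ts else [:: t] else [:: t].

Lemma all_children_of c t : associative t ->
  all (fun s => (root_label s != Some c) && associative s) (children_of c t).
Proof.
case: t => [l|d ts] //= /[dup] /andP[_ h] h'.
by case: eqP => [<-//|/eqP dc] /=; rewrite h' andbT; apply/andP.
Qed.

Lemma eval_children_of c t x : eval_forest x c (children_of c t) = eval_tree x t.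
Proof.
have E1 : eval_forest x c [:: t] = eval_tree x t.
  by case: c => /=; rewrite ?andbT ?orbF.
case: t E1 => [//|d ts] E1 /=; case: eqP => [<-|//].
by rewrite -eval_Node.
Qed.

Lemma forest_size_children_of c t : (forest_size (children_of c t) <= tree_size t)%N.
Proof. by case: t => [//|d ts] /=; case: ifP => _; rewrite /forest_size /= ?addn0. Qed.

Lemma connect_absorbl c b : connect c (~~ bool_of_connective c) b = ~~ bool_of_connective c.
Proof. by case: c. Qed.

Lemma connect_neutrall c b : connect c (bool_of_connective c) b = b.
Proof. by case: c. Qed.

Lemma connectC c : commutative (connect c).
Proof. by case: c; [exact: andbC|exact: orbC]. Qed.

Lemma children_within_connect c g h s s' :
  computable_within g s -> children_within c h s' ->
  children_within c (fun x => connect c (g x) (h x)) (s + s').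
Proof.
move=> gs [hE|[qs [qsA qsE qss]]].
  by left => x; rewrite connectC hE connect_absorbl.
case: gs => [[b gb]|[t [tA tE ts]]].
  have [bc|bc] := eqVneq b (bool_of_connective c).
    right; exists qs; split => // [x|]; first by rewrite gb bc connect_neutrall.
    by rewrite (leq_trans qss)// leq_addl.
  left=> x; rewrite gb; have -> : b = ~~ bool_of_connective c by case: b c bc {gb qsA qsE} => -[].
  exact: connect_absorbl.
right; exists (children_of c t ++ qs); split.
- by rewrite all_cat all_children_of.
- by move=> x; rewrite eval_forest_cat eval_children_of tE qsE.
- by rewrite forest_size_cat leq_add// (leq_trans (forest_size_children_of _ _)).
Qed.

(** No child leaves a constant, one child replaces its parent, and from two children on the node
    costs 1. The conclusion [0 < s] says that a nonconstant function needs a leaf; it is the source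
    of the exponent 2 of the literals. *)
Lemma children_within_nonconst c g s : children_within c g s ->
  (exists b, forall x, g x = b) \/
  (exists t : tree m, [/\ associative t, forall x, eval_tree x t = g x,
     (tree_size t <= s.+1)%N & (0 < s)%N]).
Proof.
case=> [gE|[qs [qsA qsE qss]]]; first by left; exists (~~ bool_of_connective c).
case: qs qsA qsE qss => [|t [|u qs]] qsA qsE qss.
- by left; exists (bool_of_connective c) => x; rewrite -qsE; case: c {qsA qsE}.
- right; exists t; split.
  + by move: qsA => /andP[/andP[]].
  + by move=> x; rewrite -qsE; case: c {qsA qsE} => /=; rewrite ?andbT ?orbF.
  + by rewrite leqW// (leq_trans _ qss)// /forest_size /= addn0.
  + by rewrite (leq_trans _ qss)// /forest_size /= addn0 tree_size_gt0.
- right; exists (Node c [:: t, u & qs]); split.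
  + by rewrite /=; exact: qsA.
  + by move=> x; rewrite -qsE eval_Node.
  + by rewrite ltnS.
  + by rewrite (leq_trans _ qss)// /forest_size /= addn_gt0 tree_size_gt0.
Qed.

Lemma children_within_computable c g s :
  children_within c g s -> computable_within g s.+1.
Proof.
case/children_within_nonconst => [|[t [tA tE ts _]]]; first by left.
by right; exists t.
Qed.

End Simplification.

Section HittingAssignment.
Variable n : nat.

(** Greedy choice: fewer than [K] literals are already chosen when a set of at least [K] literals is
    treated, so it contains one whose negation has not been chosen. *)
Lemma hitting_assignment K (ds : seq {set literal n}) :
  (size ds <= K)%N -> all (fun d : {set literal n} => K <= #|d|)%N ds ->
  exists a : assignment n, forall d, d \in ds -> exists2 z, z \in d & eval_literal a z.
Proof.
move=> dsK dsA.
suff [C [_ Cc Ch]] : exists C : {set literal n}, [/\ (#|C| <= size ds)%N,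
    forall z, z \in C -> neg_literal z \notin C &
    forall d, d \in ds -> exists2 z, z \in d & z \in C].
  exists [ffun i => (i, true) \in C] => d /Ch[z zd zC]; exists z => //.
  rewrite /eval_literal ffunE; case: z {zd} zC => i [] //= zC.
  exact: Cc zC.
elim: ds dsK dsA => [_ _|d ds IH /= dsK /andP[dK dsA]].
  by exists finset.set0; split => [|z|//]; rewrite ?cards0 ?finset.in_set0.
have [C [CK Cc Ch]] := IH (ltnW dsK) dsA.
have [z zd zC] : exists2 z, z \in d & z \notin (@neg_literal n @: C)%SET.
  apply/fintype.subsetPn; apply/negP => /subset_leq_card h.
  have := leq_trans dK (leq_trans h (leq_imset_card _ _)).
  by rewrite leqNgt (leq_ltn_trans CK dsK).
have zC' : neg_literal z \notin C.
  by apply: contra zC => zC; rewrite -[z]neg_literalK imset_f.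
exists (z |: C); split.
- by rewrite cardsU1 -add1n leq_add// leq_b1.
- move=> y; rewrite !finset.in_setU1 negb_or => /predU1P[->|yC].
    by rewrite zC' andbT; case: z {zd zC zC'} => i []; apply/eqP => -[].
  rewrite Cc// andbT; apply: contra zC => /eqP <-.
  by rewrite imset_f.
- move=> e; rewrite inE => /predU1P[->|/Ch[y ye yC]].
    by exists z => //; rewrite finset.in_setU1 eqxx.
  by exists y => //; rewrite finset.in_setU1 yC orbT.
Qed.

End HittingAssignment.

(* A node is rich when it has at least [K] distinct leaves outside the first
   [n0] variables, and poor otherwise. Only the poor nodes that are reached
   from the root through poor nodes are explored; each of them has exponent 2,
   like the leaves on the first [n0] variables, and a rich node has exponent 1. *)
Section Region.
Variables (n0 k K : nat).
Local Notation n := (n0 + k)%N.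
Implicit Types (c : connective) (t : tree n) (ts : seq (tree n)) (w : seq (layer n)).

Definition outside (l : literal n) := (n0 <= l.1)%N.

Definition rich ts := (K <= #|leaf_set outside ts|)%N.

Fixpoint region_exp t : nat :=
  match t with
  | Leaf l => if outside l then 0 else 2
  | Node c ts => if rich ts then 1 else (sumn (map region_exp ts)).+2
  end.

Fixpoint region_size t : nat :=
  match t with
  | Leaf l => if outside l then 0 else 1
  | Node c ts => if rich ts then 0 else (sumn (map region_size ts)).+1
  end.

(** Making one of these literals true gives the node [c] its absorbing value. *)
Definition killing_set c ts : {set literal n} :=
  [set z | outside z && (Leaf (if c is And then neg_literal z else z) \in ts)].

Fixpoint demands t : seq {set literal n} :=
  match t with
  | Leaf l => [::]
  | Node c ts => if rich ts then [:: killing_set c ts] else flatten (map demands ts)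
  end.

Fixpoint context_region_exp w : nat :=
  if w is p :: w' then
    if rich (p.1 ++ p.2) then 0
    else ((sumn (map region_exp (p.1 ++ p.2))).+2 + context_region_exp w')%N
  else 0.

Fixpoint context_region_size w : nat :=
  if w is p :: w' then
    if rich (p.1 ++ p.2) then 0
    else ((sumn (map region_size (p.1 ++ p.2))).+1 + context_region_size w')%N
  else 0.

Fixpoint context_demands c w : seq {set literal n} :=
  if w is p :: w' then
    if rich (p.1 ++ p.2) then [:: killing_set c (p.1 ++ p.2)]
    else flatten (map demands (p.1 ++ p.2)) ++ context_demands (dual_connective c) w'
  else [::].

Lemma card_killing_set c ts : #|killing_set c ts| = #|leaf_set outside ts|.
Proof.
case: c => //.
rewrite -(card_imset _ (inv_inj (@neg_literalK n))); apply: eq_card => z.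
apply/imsetP/idP => [[y + ->]|]; first by rewrite !inE.
rewrite inE => /andP[zo zts]; exists (neg_literal z); last by rewrite neg_literalK.
by rewrite inE neg_literalK zts andbT.
Qed.

Lemma demands_card t : all (fun d : {set literal n} => K <= #|d|)%N (demands t).
Proof.
elim/tree_nested_ind: t => //= c ts IH; case: ifPn => [tsr|_].
  by rewrite /= card_killing_set -/(rich ts) tsr.
elim: ts IH => //= t ts IHts [tA /IHts tsA].
by rewrite all_cat tA.
Qed.

Lemma flatten_demands_card ts :
  all (fun d : {set literal n} => K <= #|d|)%N (flatten (map demands ts)).
Proof. by elim: ts => //= t ts IH; rewrite all_cat demands_card. Qed.

Lemma context_demands_card c w :
  all (fun d : {set literal n} => K <= #|d|)%N (context_demands c w).
Proof.
elim: w c => //= p w IH c; case: ifPn => [pr|_]; first by rewrite /= card_killing_set -/(rich _) pr.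
by rewrite all_cat flatten_demands_card IH.
Qed.

Lemma size_demands t : (size (demands t) + (region_size t).*2 <= region_exp t)%N.
Proof.
elim/tree_nested_ind: t => [l|c ts IH] /=; first by case: ifP.
case: ifP => // _; rewrite doubleS !addnS !ltnS.
elim: ts IH => //= t ts IHts [tE /IHts tsE].
by rewrite size_cat doubleD addnACA leq_add.
Qed.

Lemma size_flatten_demands ts :
  (size (flatten (map demands ts)) + (sumn (map region_size ts)).*2 <=
   sumn (map region_exp ts))%N.
Proof.
elim: ts => //= t ts IH.
by rewrite size_cat doubleD addnACA leq_add// size_demands.
Qed.

(** The extra 1 is the rich layer that stops the exploration of the path: it has a demand but
    exponent 0. *)
Lemma size_context_demands c w :
  (size (context_demands c w) + (context_region_size w).*2 <= (context_region_exp w).+1)%N.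
Proof.
elim: w c => //= p w IH c; case: ifP => // _.
have h1 := size_flatten_demands (p.1 ++ p.2); have h2 := IH (dual_connective c).
by rewrite size_cat; lia.
Qed.

Lemma context_region_size_le w : ((context_region_size w).*2 <= context_region_exp w)%N.
Proof.
elim: w => //= p w IH; case: ifP => // _.
by have := size_flatten_demands (p.1 ++ p.2); lia.
Qed.

Section Restriction.
Variable a : assignment n.

Definition extend_assignment (x : assignment n0) : assignment n :=
  [ffun i => match fintype.split i with inl j => x j | inr _ => a i end].

Lemma extend_extend_assignment (f : boolfun n0) x :
  extend k f (extend_assignment x) = f x.
Proof.
rewrite ffunE; congr (f _); apply/ffunP => i; rewrite !ffunE.
by rewrite -[lshift k i]/(unsplit (inl i)) unsplitK.
Qed.

Lemma eval_outside x (l : literal n) : outside l ->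
  eval_literal (extend_assignment x) l = eval_literal a l.
Proof.
rewrite /outside /eval_literal ffunE; case: fintype.splitP => //= j ->.
by rewrite leqNgt ltn_ord.
Qed.

Lemma computable_within_inside (l : literal n) : ~~ outside l ->
  computable_within (fun x => eval_literal (extend_assignment x) l) 1.
Proof.
rewrite /outside -ltnNge => ln; right.
exists (Leaf (Ordinal ln, l.2)); split => // x.
rewrite /= /eval_literal ffunE /=; case: fintype.splitP => j lj.
  by have -> : Ordinal ln = j by apply: val_inj.
by exfalso; have := ln; rewrite lj ltnNge leq_addr.
Qed.

Lemma eval_killed x c ts z : z \in killing_set c ts -> eval_literal a z ->
  eval_forest (extend_assignment x) c ts = ~~ bool_of_connective c.
Proof.
rewrite inE => /andP[zo zts] az.
have xz : eval_literal (extend_assignment x) z by rewrite eval_outside.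
case: c zts => /= zts; last by apply/hasP; exists (Leaf z).
by apply/negbTE/allPn; exists (Leaf (neg_literal z)) => //=; rewrite eval_neg_literal xz.
Qed.

Lemma computable_within_region t :
  (forall d, d \in demands t -> exists2 z, z \in d & eval_literal a z) ->
  computable_within (fun x => eval_tree (extend_assignment x) t) (region_size t).
Proof.
elim/tree_nested_ind: t => [l _|c ts IH].
  rewrite /=; case: ifPn => lo; last exact: computable_within_inside.
  by left; exists (eval_literal a l) => x; rewrite eval_outside.
rewrite [region_size _]/= [demands _]/=; case: ifPn => [tsr dh|_ dh].
  have [z zd az] := dh _ (mem_head _ _).
  by left; exists (~~ bool_of_connective c) => x; rewrite eval_Node (eval_killed _ zd).
suff : children_within c (fun x => eval_forest (extend_assignment x) c ts)
     (sumn (map region_size ts)).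
  case/children_within_computable => [[b bE]|[t [tA tE tS]]]; [left|right].
    by exists b => x; rewrite eval_Node.
  by exists t; split => // x; rewrite eval_Node.
elim: ts IH dh => [_ _|t ts IHts [tH /IHts tsH] dh].
  by have := children_within_neutral n0 c; case: c.
have := children_within_connect (tH _) (tsH _).
case=> [d dt|d dt|cE|[qs [qsA qsE qss]]].
- by apply: dh; rewrite /= mem_cat dt.
- by apply: dh; rewrite /= mem_cat dt orbT.
- by left => x; rewrite eval_forest_cons cE.
- by right; exists qs; split => // x; rewrite eval_forest_cons qsE.
Qed.

Lemma children_within_forest c ts :
  (forall d, d \in flatten (map demands ts) -> exists2 z, z \in d & eval_literal a z) ->
  forall h s, children_within c h s ->
  children_within c (fun x => connect c (eval_forest (extend_assignment x) c ts) (h x))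
    (sumn (map region_size ts) + s).
Proof.
move=> dh h s hs; elim: ts dh => [_|t ts IH dh].
  have -> : (fun x => connect c (eval_forest (extend_assignment x) c [::]) (h x)) = h.
    by apply/funext => x; case: c {hs}.
  exact: hs.
have := children_within_connect (computable_within_region (t := t) _) (IH _).
have E x : connect c (eval_tree (extend_assignment x) t)
   (connect c (eval_forest (extend_assignment x) c ts) (h x)) =
   connect c (eval_forest (extend_assignment x) c (t :: ts)) (h x).
  by rewrite eval_forest_cons; case: c {hs IH} => /=; rewrite ?andbA ?orbA.
rewrite /= -addnA => /(_ _ _) H.
have -> : (fun x => connect c (eval_forest (extend_assignment x) c (t :: ts)) (h x)) =
  (fun x => connect c (eval_tree (extend_assignment x) t)
   (connect c (eval_forest (extend_assignment x) c ts) (h x))).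
  by apply/funext => x; rewrite E.
by apply: H => d dt; apply: dh; rewrite /= mem_cat dt ?orbT.
Qed.

(** Once the demands are met, a rich layer cuts everything below it and rich siblings become
    constants, so only the explored nodes and essential leaves survive. The bound 2 counts one
    explored node of the path and one leaf. *)
Lemma context_simplification c w :
  (forall d, d \in context_demands c w -> exists2 z, z \in d & eval_literal a z) ->
  (exists b, forall x, eval_context (extend_assignment x) c w true = b) \/
  (exists t : tree n0, [/\ associative t,
     forall x, eval_tree x t = eval_context (extend_assignment x) c w true,
     (tree_size t <= context_region_size w)%N & (2 <= context_region_size w)%N]).
Proof.
elim: w c => [|p w IH] c; first by left; exists true.
rewrite [context_demands _ _]/= [context_region_size _]/=; case: ifPn => [pr dh|_ dh].
  have [z zd az] := dh _ (mem_head _ _).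
  by left; exists (~~ bool_of_connective c) => x; rewrite /= (eval_killed _ zd)// connect_absorbl.
have wS : computable_within (fun x => eval_context (extend_assignment x) (dual_connective c) w true)
    (context_region_size w).
  have [d dw|[b bE]|[t [tA tE tS _]]] := IH (dual_connective c).
  - by apply: dh; rewrite mem_cat dw orbT.
  - by left; exists b.
  - by right; exists t.
have := children_within_connect wS (children_within_neutral n0 c).
have -> : (fun x => connect c (eval_context (extend_assignment x) (dual_connective c) w true)
    (bool_of_connective c)) =
   (fun x => eval_context (extend_assignment x) (dual_connective c) w true).
  by apply/funext => x; rewrite connectC connect_neutrall.
rewrite addn0 => wC.
have dh' d : d \in flatten (map demands (p.1 ++ p.2)) -> exists2 z, z \in d & eval_literal a z.
  by move=> dp; apply: dh; rewrite mem_cat dp.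
case: (children_within_nonconst (children_within_forest dh' wC)) => [|[t [tA tE tS s0]]].
  by left.
by right; exists t; split.
Qed.

End Restriction.

(** Otherwise there are at most [L.*2] demands, hence at most [K], and one assignment meets them
    all. The function [f] then has a tree of size at most [context_region_size w], which is less
    than [L]: this contradicts minimality, or, if [L <= 2], the lower bound 2 on this region
    size. *)
Lemma le_context_region_exp (f : boolfun n0) L c w : (L.*2 <= K)%N ->
  ~~ is_constant f ->
  (L <= 2)%N \/ (forall t : tree n0, associative t -> tree_fun t = f -> (L <= tree_size t)%N) ->
  context_computes c w (extend k f) -> (L.*2 <= context_region_exp w)%N.
Proof.
move=> LK fN fL /context_computesP wf; rewrite leqNgt; apply/negP => wL.
have sd := size_context_demands c w; have sw := context_region_size_le w.
have [|a ah] := hitting_assignment (K := K) _ (context_demands_card c w).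
  by lia.
have [[b bE]|[t [tA tE tS s2]]] := context_simplification ah.
  move/existsPn : fN => /(_ b); apply/negP; rewrite negbK; apply/eqP/ffunP => x.
  by rewrite ffunE -(bE x) wf extend_extend_assignment.
have tf : tree_fun t = f.
  by apply/ffunP => x; rewrite ffunE tE wf extend_extend_assignment.
case: fL => [L2|/(_ t tA tf) Lt]; lia.
Qed.

End Region.

(** * Weight of the explored region *)

Section RegionWeight.
Variables (R : realType) (n0 k K : nat) (delta : R).
Local Notation n := (n0 + k)%N.
Hypothesis n_gt0 : (0 < n)%N.
Local Notation sigma := (sigma_of R n).
Local Notation rho := (rho_of R n).
Local Notation lambda := (delta * sigma).
Implicit Types (c : connective) (t : tree n) (ts : seq (tree n)) (w : seq (layer n)).
Hypothesis delta_gt0 : 0 < delta.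
Hypothesis lambda_ge1 : 1 <= delta * sigma.
Hypothesis delta_small :
  n0.*2%:R * delta ^+ 2 + delta + delta ^+ 2 * 2 ^+ K.+1 <= 1 / 4.
Hypothesis delta_small' : (delta * 2 ^+ K.+1) ^+ 2 <= 1 / 2.
Hypothesis rho_small : K%:R * rho <= 1 / 4.

Let sigma_gt0 := sigma_gt0 R n_gt0.
Let rho_gt0 := rho_gt0 R n_gt0.
Local Notation rexp := (@region_exp n0 k K).
Local Notation cexp := (@context_region_exp n0 k K).
Local Notation poor := (fun ts => ~~ @rich n0 k K ts).

Let lambda_gt0 : 0 < delta * sigma. Proof. by rewrite mulr_gt0. Qed.

Let rho_sigma2 : rho * sigma ^+ 2 <= 1.
Proof.
have rs : rho * (sigma * (sigma + 2)) = 1.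
  by rewrite mulVf// gt_eqF// mulr_gt0// addr_gt0.
rewrite -[leRHS]rs ler_wpM2l ?(ltW rho_gt0)// expr2 ler_wpM2l ?(ltW sigma_gt0)//.
by rewrite lerDl.
Qed.

(** Exponential tilting of the critical weight. As rho is about 1/sigma^2, the factor [lambda ^+ 2]
    cancels the cost of an explored node or essential leaf up to delta^2. *)
Definition region_weight t : R := rho ^+ tree_size t * lambda ^+ rexp t.

Definition outer_leaf t := if t is Leaf l then @outside n0 k l else false.

Definition inner_weight h c : R :=
  \sum_(t <- trees_upto n h c | ~~ outer_leaf t) region_weight t.

Lemma region_weight_ge0 t : 0 <= region_weight t.
Proof. by rewrite mulr_ge0// exprn_ge0// ltW. Qed.

Lemma region_weight_prod ts :
  rho ^+ forest_size ts * lambda ^+ sumn (map rexp ts) = \prod_(t <- ts) region_weight t.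
Proof.
elim: ts => [|t ts IH]; first by rewrite big_nil !expr0 mulr1.
by rewrite big_cons -IH /= /region_weight !exprD mulrACA.
Qed.

(** The bound [2 ^+ d.+1 - 2] solves the recursion exactly: fresh outer leaves weigh at most 1 in
    all and decrease [d], while outer leaves already read and inner trees weigh at most 1/4 each and
    keep [d.+1]. *)
Lemma poor_words_weight h c j : inner_weight h c <= 1 / 4 ->
  \sum_(ts <- words j (trees_upto n h c) | poor ts) \prod_(t <- ts) region_weight t <=
  2 ^+ K.+1.
Proof.
move=> hV.
have b0 d : 0 <= 2 ^+ d.+1 - 2 :> R.
  by rewrite subr_ge0 exprS ler_peMr// exprn_ege1// ler1n.
apply: le_trans (_ : 2 ^+ K.+1 - 2 <= _); last by rewrite gerBl.
under eq_bigl do rewrite -ltnNge -[leaf_set _ _]finset.setD0.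
apply: (@few_distinct_leaves R n _ region_weight (@outside n0 k) K (fun d => 2 ^+ d.+1 - 2)) => //.
- exact: region_weight_ge0.
- move=> D d DO Dd.
  pose phi t : R := if fresh_leaf (@outside n0 k) D t then 2 ^+ d.+1 - 2 else 2 ^+ d.+2 - 2.
  have phi0 t : 0 <= phi t by rewrite /phi; case: ifP.
  rewrite (bigID outer_leaf) /=.
  have out : \sum_(t <- trees_upto n h c | outer_leaf t) region_weight t * phi t <=
     2 ^+ d.+1 - 2 + 1 / 4 * (2 ^+ d.+2 - 2).
    apply: le_trans (_ : \sum_(l : literal n | outside l) region_weight (Leaf l) * phi (Leaf l) <= _).
      case: h {hV} => [|h]; first by rewrite big_nil; apply: sumr_ge0 => l _; rewrite mulr_ge0 ?region_weight_ge0.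
      by rewrite big_mkcond big_trees_upto [X in _ + X]big1// addr0 -big_mkcond.
    apply: le_trans (_ : \sum_(l : literal n) (rho * (2 ^+ d.+1 - 2) +
       (if l \in D then rho * (2 ^+ d.+2 - 2) else 0)) <= _).
      rewrite big_mkcond; apply: ler_sum => l _.
      have rd e : 0 <= rho * (2 ^+ e.+1 - 2) by rewrite mulr_ge0// ltW.
      case: ifPn => lo; last by rewrite addr_ge0//; case: ifP.
      rewrite /region_weight /= lo expr0 mulr1 expr1 /phi /= lo /=.
      by case: (l \in D) => /=; rewrite ?addr0 ?lerDr ?rd.
    rewrite big_split /= sumr_const card_literal -big_mkcond sumr_const.
    apply: lerD.
      rewrite -mulrnAl -mulr_natr -sigma2 ler_piMl//.
    rewrite -mulrnAl ler_wpM2r//; apply: le_trans rho_small.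
    rewrite -[rho *+ _]mulr_natl ler_wpM2r ?(ltW rho_gt0)// ler_nat.
    by apply: leq_trans Dd; rewrite leq_addr.
  have inn : \sum_(t <- trees_upto n h c | ~~ outer_leaf t) region_weight t * phi t <=
     1 / 4 * (2 ^+ d.+2 - 2).
    apply: le_trans (_ : inner_weight h c * (2 ^+ d.+2 - 2) <= _); last exact: ler_wpM2r.
    rewrite mulr_suml; apply: ler_sum => t to; rewrite /phi.
    suff -> : fresh_leaf (@outside n0 k) D t = false by [].
    by case: t to => //= l /negPf ->.
  have := lerD out inn; rewrite /phi => /(lerD (lexx (1 : R))) /le_trans; apply.
  by rewrite [2 ^+ d.+2]exprS; lra.
- by apply/fintype.subsetP => l; rewrite finset.in_set0.
- by rewrite cards0.
Qed.

Lemma card_inside : (#|[pred l : literal n | ~~ outside l]| <= n0.*2)%N.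
Proof.
rewrite -(card_literal n0).
pose f (l : literal n0) : literal n := (lshift k l.1, l.2).
apply: leq_trans (leq_image_card f (fun=> true)); last first.
apply/subset_leq_card/fintype.subsetP => -[i b]; rewrite inE /outside /= -ltnNge => i0.
apply/fintype.imageP; exists (Ordinal i0, b) => //.
by congr pair; apply: val_inj.
Qed.

(** By induction on [h], the three terms of [delta_small] bound the essential leaves, the rich nodes
    and the poor nodes. All internal nodes together weigh rho tau sigma, of order 1/sigma, which is
    why a rich node can carry only one factor [lambda]. *)
Lemma inner_weight_le h c : inner_weight h c <= 1 / 4.
Proof.
elim: h c => [|h IH] c; first by rewrite /inner_weight big_nil divr_ge0.
rewrite /inner_weight big_mkcond big_trees_upto.
have d2 : delta ^+ 2 * (rho * sigma ^+ 2) <= delta ^+ 2.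
  by rewrite ler_piMr// exprn_ge0// ltW.
have leaf : \sum_(l : literal n) (if ~~ outer_leaf (Leaf l) then region_weight (Leaf l) else 0)
   <= n0.*2%:R * delta ^+ 2.
  rewrite -big_mkcond.
  apply: le_trans (_ : \sum_(l : literal n | ~~ outside l) rho * lambda ^+ 2 <= _).
    apply: ler_sum => l lo; have lo' : ~~ outside l := lo.
    by rewrite /region_weight /= (negPf lo') expr1.
  rewrite sumr_const -[_ *+ _]mulr_natl.
  apply: ler_pM => //; first by rewrite mulr_ge0 ?(ltW rho_gt0)// exprn_ge0// ltW.
    by rewrite ler_nat card_inside.
  by rewrite exprMn mulrCA.
set A := words h (trees_upto n h (dual_connective c)).
have richs : \sum_(ts <- A | (2 <= size ts)%N && rich K ts) region_weight (Node c ts) <= delta.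
  apply: le_trans (_ : lambda * (rho * tau_of R n * sigma) <= _); last first.
    have -> : lambda * (rho * tau_of R n * sigma) = delta * (rho * sigma ^+ 2 * tau_of R n) by ring.
    rewrite ler_piMr ?(ltW delta_gt0)// mulr_ile1 ?tau_ge0 ?(ltW (tau_lt1 _ _))//.
    by rewrite mulr_ge0 ?exprn_ge0// ltW.
  apply: le_trans (_ : lambda * \sum_(ts <- A | (2 <= size ts)%N) rho ^+ tree_size (Node c ts) <= _).
    rewrite mulr_sumr [leLHS]big_mkcond [leRHS]big_mkcond; apply: ler_sum => ts _.
    case: (1 < size ts)%N => //=; case: ifPn => [tr|_]; last first.
      by rewrite mulr_ge0 ?exprn_ge0// ltW.
    have E : rexp (Node c ts) = 1%N by rewrite /= tr.
    by rewrite /region_weight E expr1 mulrC.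
  rewrite ler_wpM2l ?(ltW lambda_gt0)//.
  have := tau_h_le R n_gt0 h.+1.
  rewrite [leRHS](tauE R n_gt0) -(sum_trees_upto_expr n rho h.+1 c) big_trees_upto.
  have -> : \sum_(l : literal n) rho ^+ tree_size (Leaf l) = rho *+ n.*2.
    by rewrite /= sumr_const card_literal.
  by rewrite lerD2l.
have poors : \sum_(ts <- A | (2 <= size ts)%N && ~~ rich K ts) region_weight (Node c ts)
   <= delta ^+ 2 * 2 ^+ K.+1.
  have P0 ts : 0 <= \prod_(t <- ts) region_weight t.
    by apply: prodr_ge0 => t _; exact: region_weight_ge0.
  apply: le_trans (_ : rho * lambda ^+ 2 * \sum_(ts <- A | poor ts) \prod_(t <- ts) region_weight t <= _).
    rewrite mulr_sumr [leLHS]big_mkcond [leRHS]big_mkcond; apply: ler_sum => ts _.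
    rewrite andbC; case: ifPn => [/andP[tr _]|_]; last first.
      by case: ifP => // _; rewrite !mulr_ge0 ?exprn_ge0// ltW.
    rewrite tr; have E : rexp (Node c ts) = (sumn (map rexp ts)).+2 by rewrite /= (negPf tr).
    rewrite /region_weight E -/(region_weight) -region_weight_prod /= exprS -/(forest_size ts) !exprS.
    by rewrite le_eqVlt; apply/orP; left; apply/eqP; ring.
  apply: ler_pM.
  - by rewrite mulr_ge0 ?exprn_ge0// ltW.
  - by apply: sumr_ge0.
  - by rewrite exprMn mulrCA.
  - exact: poor_words_weight.
rewrite [X in _ + X](bigID (@rich n0 k K)) /=.
by apply: le_trans (lerD leaf (lerD richs poors)) _; rewrite addrA.
Qed.

Definition context_region_weight w : R := rho ^+ context_size w * lambda ^+ cexp w.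

Lemma context_region_weight_ge0 w : 0 <= context_region_weight w.
Proof. by rewrite mulr_ge0// exprn_ge0// ltW. Qed.

Lemma poor_layers_weight h c :
  \sum_(p <- layers n h c | poor (p.1 ++ p.2))
    rho ^+ layer_size p * lambda ^+ (sumn (map rexp (p.1 ++ p.2))).+2 <= 1 / 2.
Proof.
set A := words h (trees_upto n h (dual_connective c)).
have wA : \sum_(ts <- A | poor ts) \prod_(t <- ts) region_weight t <= 2 ^+ K.+1.
  exact: poor_words_weight (inner_weight_le _ _).
have w0 : 0 <= \sum_(ts <- A | poor ts) \prod_(t <- ts) region_weight t.
  by apply: sumr_ge0 => ts _; apply: prodr_ge0 => t _; exact: region_weight_ge0.
apply: le_trans (_ : rho * lambda ^+ 2 *
   ((\sum_(ts <- A | poor ts) \prod_(t <- ts) region_weight t) *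
    (\sum_(ts <- A | poor ts) \prod_(t <- ts) region_weight t)) <= _); last first.
  apply: le_trans delta_small'; rewrite [leRHS]exprMn; apply: ler_pM.
  - by rewrite mulr_ge0 ?exprn_ge0// ltW.
  - by rewrite mulr_ge0.
  - by rewrite exprMn mulrCA ler_piMr// exprn_ge0// ltW.
  - by rewrite expr2; apply: ler_pM.
rewrite big_mkcond big_layers mulr_suml mulr_sumr [leRHS]big_mkcond.
apply: ler_sum => ls _.
have P0 ts : 0 <= \prod_(t <- ts) region_weight t.
  by apply: prodr_ge0 => t _; exact: region_weight_ge0.
have poor_cat rs : poor (ls ++ rs) -> poor ls && poor rs.
  rewrite /rich -!ltnNge => h1.
  by apply/andP; split; apply: leq_ltn_trans h1; apply/subset_leq_card/fintype.subsetP => l;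
    rewrite !inE mem_cat => /andP[-> ->]; rewrite ?orbT.
case: ifPn => [lp|lr]; last first.
  rewrite big1// => rs _; case: ifPn => // /poor_cat.
  by rewrite (negPf lr).
rewrite !mulr_sumr [leLHS]big_mkcond [leRHS]big_mkcond; apply: ler_sum => rs _.
case: ifPn => [_|_]; last by case: ifP => // _; rewrite !mulr_ge0// ?exprn_ge0// ltW.
case: ifPn => [/poor_cat/andP[_ rp]|_]; last by case: ifP => // _; rewrite !mulr_ge0// ?exprn_ge0// ltW.
rewrite rp -!region_weight_prod map_cat sumn_cat /layer_size /= !exprS !exprD.
by rewrite le_eqVlt; apply/orP; left; apply/eqP; ring.
Qed.

(** If S bounds the sum for [j], the next sum is at most 1 + S/2: after a rich layer the tilting
    stops and the layers have total weight at most 1, while poor layers weigh at most 1/2. The value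
    S = 2 is preserved. *)
Lemma context_region_weight_le j h c :
  \sum_(w <- contexts n j h c) context_region_weight w <= 2.
Proof.
elim: j c => [|j IH] c.
  by rewrite big_seq1 /context_region_weight !expr0 mulr1 ler1n.
rewrite big_contexts (bigID (fun p => rich K (p.1 ++ p.2))) /=.
have r1 : \sum_(p <- layers n h c | rich K (p.1 ++ p.2))
   \sum_(w <- contexts n j h (dual_connective c)) context_region_weight (p :: w) <= 1.
  apply: le_trans (layers_weight_le1 R n_gt0 h).
  rewrite -(layers_weightE R n h c) big_mkcond; apply: ler_sum => p _.
  case: ifPn => [pr|_]; last by rewrite exprn_ge0// ltW.
  under eq_bigr do rewrite /context_region_weight /= pr expr0 mulr1 exprD.
  rewrite -mulr_sumr ler_piMr ?exprn_ge0 ?(ltW rho_gt0)//.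
  under eq_bigr do rewrite expr_context_size.
  rewrite (big_contexts_prod _ _ (layers_weightE R n h)).
  by rewrite exprn_ile1 ?layers_weight_ge0 ?layers_weight_le1.
have r2 : \sum_(p <- layers n h c | poor (p.1 ++ p.2))
   \sum_(w <- contexts n j h (dual_connective c)) context_region_weight (p :: w) <= 1.
  apply: le_trans (_ : (\sum_(p <- layers n h c | poor (p.1 ++ p.2))
    rho ^+ layer_size p * lambda ^+ (sumn (map rexp (p.1 ++ p.2))).+2) * 2 <= _); last first.
    by have := poor_layers_weight h c; lra.
  rewrite mulr_suml; apply: ler_sum => p pp.
  apply: le_trans (ler_wpM2l _ (IH (dual_connective c))); last first.
    by rewrite mulr_ge0// exprn_ge0// ltW.
  rewrite mulr_sumr; apply: ler_sum => w _.
  rewrite /context_region_weight /= (negPf pp) !exprD.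
  by rewrite le_eqVlt; apply/orP; left; apply/eqP; rewrite !exprS !exprD; ring.
by have := lerD r1 r2; lra.
Qed.

(** Markov's inequality: the contexts that compute [extend k f] have exponent at least [L.*2] under
    a tilted weight of total at most 2. *)
Lemma context_weight_le (f : boolfun n0) L j h c : (L.*2 <= K)%N ->
  ~~ is_constant f ->
  (L <= 2)%N \/ (forall t : tree n0, associative t -> tree_fun t = f -> (L <= tree_size t)%N) ->
  context_weight R j h c (extend k f) <= 2 / (delta ^+ L.*2 * n.*2%:R ^+ L).
Proof.
move=> LK fN fL.
have -> : delta ^+ L.*2 * n.*2%:R ^+ L = lambda ^+ L.*2.
  by rewrite exprMn -sigma2 -exprM mul2n.
rewrite ler_pdivlMr ?exprn_gt0// mulr_suml.
apply: le_trans (context_region_weight_le j h c).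
rewrite big_mkcond; apply: ler_sum => w _; case: ifPn => [wf|_]; last first.
  exact: context_region_weight_ge0.
rewrite ler_wpM2l ?exprn_ge0 ?(ltW rho_gt0)//.
by rewrite ler_weXn2l// (le_context_region_exp LK fN fL wf).
Qed.

End RegionWeight.

(** * Asymptotics *)

Section Embedding.
Variables (n0 k : nat).

Definition embed_literal (l : literal n0) : literal (n0 + k) := (lshift k l.1, l.2).

Fixpoint embed_tree (t : tree n0) : tree (n0 + k) :=
  match t with
  | Leaf l => Leaf (embed_literal l)
  | Node c ts => Node c (map embed_tree ts)
  end.

Lemma tree_size_embed t : tree_size (embed_tree t) = tree_size t.
Proof.
elim/tree_nested_ind: t => //= c ts IH; congr _.+1; rewrite -map_comp.
by elim: ts IH => //= t ts IHts [-> /IHts ->].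
Qed.

Lemma root_label_embed t : root_label (embed_tree t) = root_label t.
Proof. by case: t. Qed.

Lemma associative_embed t : associative (embed_tree t) = associative t.
Proof.
elim/tree_nested_ind: t => //= c ts IH; rewrite size_map all_map; congr (_ && _).
by elim: ts IH => //= t ts IHts [tE /IHts ->]; rewrite tE root_label_embed.
Qed.

Lemma eval_embed (x : assignment (n0 + k)) t :
  eval_tree x (embed_tree t) = eval_tree [ffun i => x (lshift k i)] t.
Proof.
elim/tree_nested_ind: t => [l|c ts IH]; first by rewrite /= /eval_literal ffunE.
rewrite -[embed_tree _]/(Node _ _) !eval_Node.
elim: ts IH => [//|t ts IHts [tE tsE]].
by rewrite map_cons !eval_forest_cons tE IHts.
Qed.

Lemma eval_forest_embed (x : assignment (n0 + k)) c ts :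
  eval_forest x c (map embed_tree ts) = eval_forest [ffun i => x (lshift k i)] c ts.
Proof. by elim: ts => // t ts IH; rewrite map_cons !eval_forest_cons eval_embed IH. Qed.

End Embedding.

Section Asymptotics.
Variable R : realType.

Lemma le_sigma M n : (M ^ 2 <= n)%N -> M%:R <= sigma_of R n.
Proof.
move=> Mn; rewrite -[leLHS]ger0_norm// -sqrtr_sqr ler_wsqrtr// -natrX ler_nat.
by rewrite (leq_trans Mn)// -addnn leq_addr.
Qed.

Lemma positive_lower_bound (a : nat -> R) N : (forall n, (1 <= n)%N -> 0 < a n) ->
  exists2 e : R, 0 < e & forall n, (1 <= n <= N)%N -> e <= a n.
Proof.
move=> a0; elim: N => [|N [e e0 eN]].
  by exists 1 => // n /andP[/leq_trans h /h].
exists (Num.min e (a N.+1)); first by rewrite lt_min e0 a0.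
move=> n /andP[n1]; rewrite leq_eqVlt => /predU1P[->|nN].
  by rewrite ge_min lexx orbT.
by rewrite ge_min eN// n1.
Qed.

Lemma literal_nonconst n (l : literal n) : ~~ is_constant (literal_fun l).
Proof.
apply/existsPn => b; apply/eqP => /ffunP E.
have := E [ffun=> true]; have := E [ffun=> false].
by rewrite !ffunE /eval_literal !ffunE; case: l.2 => <-.
Qed.

Lemma prob_false_lt n : (1 <= n)%N -> prob R (const_fun n false) < 1 / 2.
Proof.
move=> n0; pose l : literal n := (Ordinal n0, true).
have l0 := prob_gt0 R n0 (literal_fun l).
apply: le_lt_trans (_ : (1 - prob R (literal_fun l)) / 2 < _); last by lra.
apply: prob_false_le => //; rewrite (bigD1 (literal_fun l)) ?literal_nonconst//=.
by rewrite lerDl; apply: sumr_ge0 => f _; exact: prob_ge0.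
Qed.

Lemma uniform_constant_bounds : exists alpha beta : R,
  [/\ 0 < alpha, beta < 1 / 2 & forall n, (1 <= n)%N ->
    alpha <= prob R (const_fun n true) /\ prob R (const_fun n false) <= beta].
Proof.
(* Beyond this threshold sigma >= 40 and the uniform bounds apply; the finitely many smaller n are
   covered by strict inequalities at each n. *)
pose N := (40 ^ 2)%N.
have [a a0 aN] := @positive_lower_bound (fun n => prob R (const_fun n true)) N
  (fun n n1 => prob_gt0 R n1 _).
have [|b b0 bN] := @positive_lower_bound (fun n => 1 / 2 - prob R (const_fun n false)) N.
  by move=> n n1; rewrite subr_gt0 prob_false_lt.
exists (Num.min a (1 / 50 / 2)), (Num.max (1 / 2 - b) ((1 - 1 / 500 * (1 / 100)) / 2)).
split.
- by rewrite lt_min a0 /=; lra.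
- by rewrite gt_max; apply/andP; split; lra.
move=> n n1; rewrite ge_min le_max.
have [nN|Nn] := leqP n N.
  have h := bN n; rewrite n1 nN in h; have {}h := h isT.
  rewrite aN ?n1//; split => //.
  by apply/orP; left; lra.
have s40 : 40 <= sigma_of R n by apply: le_sigma; exact: ltnW.
rewrite prob_false_le_uniform ?orbT//; split => //; apply/orP; right.
have [|H hH] := absorbing_weight_uniform (R := R) n1.
  by apply: le_trans s40; rewrite ler_nat.
exact: prob_true_ge hH.
Qed.

(** Common form of the literal case, where [qs] is one leaf and [L] is 2, and of the general case,
    where [qs] lists the children of a minimal tree. *)
Lemma Theta_prob_extend n0 (f : boolfun n0) L c (qs : seq (tree n0)) :
  (1 <= n0)%N -> ~~ is_constant f ->
  (L <= 2)%N \/ (forall t : tree n0, associative t -> tree_fun t = f -> (L <= tree_size t)%N) ->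
  (0 < size qs)%N -> all (in_class (dual_connective c)) qs ->
  (forall x, f x = eval_forest x c qs) -> (forest_size qs).+1 = L ->
  (fun k : nat => prob R (extend k f) : R^o) =Theta_\oo
  (fun k : nat => ((n0 + k)%:R ^+ L)^-1 : R^o).
Proof.
move=> n1 fN fL qs0 qsC fE qsL.
(* There are at most [L.*2] demands to meet at once. The size of [M] makes [delta = 1 / M] satisfy
   both smallness conditions, and [M ^ 2 <= n0 + k] ensures [1 <= delta * sigma]. *)
pose K := L.*2; pose M := (16 * (n0.+1 * 2 ^ K))%N.
pose delta : R := M%:R^-1.
have M16 : (16 <= M)%N by rewrite /M leq_pmulr// muln_gt0 expn_gt0.
have M0 : 0 < M%:R :> R by rewrite ltr0n (leq_trans _ M16).
have d0 : 0 < delta by rewrite invr_gt0.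
have dE : delta * (16 * ((n0%:R + 1) * 2 ^+ K)) = 1.
  by rewrite /delta natr1 -natrX -!natrM mulVf// gt_eqF.
have D1 : 1 <= 2 ^+ K :> R by rewrite exprn_ege1// ler1n.
have a0 : 0 <= n0%:R :> R by [].
have dD : 16 * (delta * 2 ^+ K) <= 1.
  rewrite -[leRHS]dE mulrCA ler_wpM2l ?(ltW d0)// ler_wpM2l//.
  by rewrite ler_peMl ?lerDr// (le_trans ler01).
have da : 16 * (delta * (n0%:R + 1)) <= 1.
  rewrite -[leRHS]dE mulrCA ler_wpM2l ?(ltW d0)// ler_wpM2l//.
  by rewrite ler_peMr// addr_ge0.
have d16 : 16 * delta <= 1.
  by apply: le_trans dD; rewrite ler_wpM2l// ler_peMr// ltW.
have small1 : n0.*2%:R * delta ^+ 2 + delta + delta ^+ 2 * 2 ^+ K.+1 <= 1 / 4.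
  have h1 : delta * (16 * (delta * 2 ^+ K)) <= delta * 1 by rewrite ler_wpM2l// ltW.
  have h2 : delta * (16 * (delta * (n0%:R + 1))) <= delta * 1 by rewrite ler_wpM2l// ltW.
  by rewrite -mul2n natrM !expr2 [2 ^+ K.+1]exprS; nra.
have small2 : (delta * 2 ^+ K.+1) ^+ 2 <= 1 / 2.
  have h0 : 0 <= delta * 2 ^+ K by rewrite mulr_ge0 ?exprn_ge0// ltW.
  rewrite [2 ^+ K.+1]exprS mulrCA; move: (delta * 2 ^+ K) dD h0 => z z1 z0.
  by rewrite expr2; nra.
rewrite eqThetaE qualifE; apply/asboolP.
exists (4^-1 ^+ L * (1 / 50) / 2, 2 / delta ^+ L.*2) => /=.
  by rewrite !divr_gt0 ?mulr_gt0 ?exprn_gt0 ?invr_gt0.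
near=> k.
have kM : (M ^ 2 <= n0 + k)%N.
  by rewrite (leq_trans _ (leq_addl _ _))//; near: k; exact: nbhs_infty_ge.
have sM : M%:R <= sigma_of R (n0 + k) := le_sigma kM.
have n_gt0 : (0 < n0 + k)%N by rewrite addn_gt0 n1.
have s0 := sigma_gt0 R n_gt0; have r0 := rho_gt0 R n_gt0.
have s16 : 16 <= sigma_of R (n0 + k) by apply: le_trans sM; rewrite ler_nat.
have nR : 0 < (n0 + k)%:R :> R by rewrite ltr0n.
have rs : rho_of R (n0 + k) * (sigma_of R (n0 + k) * (sigma_of R (n0 + k) + 2)) = 1.
  by rewrite mulVf// gt_eqF// mulr_gt0// addr_gt0.
rewrite !ger0_norm ?invr_ge0 ?exprn_ge0 ?prob_ge0//; split.
  have [|H hH] := absorbing_weight_uniform (R := R) n_gt0.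
    by apply: le_trans s16; rewrite ler_nat.
  have low : rho_of R (n0 + k) ^+ (forest_size (map (embed_tree k) qs)).+1 * (1 / 50) / 2
     <= prob R (extend k f).
    apply: (@prob_ge_forest R _ n_gt0 c _ _ H) => //.
    - by rewrite size_map.
    - rewrite all_map; apply: sub_all qsC => t.
      by rewrite /in_class /= associative_embed root_label_embed.
    - by move=> x; rewrite ffunE eval_forest_embed fE.
  apply: le_trans low.
  have -> : (forest_size (map (embed_tree k) qs)).+1 = L.
    rewrite -qsL /forest_size -map_comp; congr (sumn _).+1.
    by apply: eq_map => t; rewrite /= tree_size_embed.
  (* The inverse of rho is sigma^2 + 2 sigma, at most 2 sigma^2 = 4(n0 + k). *)
  have key : 4^-1 ^+ L * ((n0 + k)%:R ^+ L)^-1 <= rho_of R (n0 + k) ^+ L.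
    rewrite -exprVn -exprMn lerXn2r ?nnegrE ?(ltW r0) ?mulr_ge0 ?invr_ge0//.
    rewrite /rho_of -invfM lef_pV2 ?posrE; [|exact: mulr_gt0|by rewrite mulr_gt0// addr_gt0].
    have : sigma_of R (n0 + k) ^+ 2 = 2 * (n0 + k)%:R by rewrite sigma2 -mul2n natrM.
    by rewrite expr2; nra.
  move: key; move: (4^-1 ^+ L) (((n0 + k)%:R ^+ L)^-1) (rho_of R (n0 + k) ^+ L) => A B C.
  by lra.
apply: prob_le_context_weight => // j h d.
apply: le_trans (context_weight_le n_gt0 d0 _ small1 small2 _ j.+1 h d (leqnn _) fN fL) _.
- by rewrite mulrC -ler_pdivrMr// div1r invrK.
- have KM : K%:R <= M%:R :> R.
    by rewrite ler_nat /M mulnA (leq_trans (ltnW (ltn_expl K (ltnSn 1))))// leq_pmull.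
  have r1 : rho_of R (n0 + k) * (M%:R * M%:R) <= 1.
    rewrite -[leRHS]rs ler_wpM2l ?(ltW r0)//; apply: ler_pM => //; lra.
  have M16' : 16 <= M%:R :> R by rewrite ler_nat.
  have : rho_of R (n0 + k) * (K%:R * 16) <= 1.
    apply: le_trans r1; rewrite ler_wpM2l ?(ltW r0)//.
    by apply: ler_pM.
  by lra.
rewrite invfM mulrA ler_wpM2l ?divr_ge0 ?exprn_ge0 ?(ltW d0)//.
rewrite lef_pV2 ?posrE ?exprn_gt0 ?ltr0n ?double_gt0//.
rewrite lerXn2r ?nnegrE// ler_nat.
by rewrite -addnn leq_addr.
Unshelve. all: by end_near. Qed.

Lemma complexity_ge3P n (f : boolfun n) : (1 <= n)%N -> (3 <= complexity f)%N ->
  [/\ ~~ is_constant f, ~~ is_literal f & min_tree_size f (complexity f)].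
Proof.
move=> n1; rewrite /complexity; case: ifPn => // fC; case: ifPn => // fL _.
split => //; apply: (@xgetPex _ 0%N (min_tree_size f)).
exact: ex_min_tree_size.
Qed.

End Asymptotics.

Theorem mainTheorem1 (R : realType) :
  (forall (n : nat) (f : boolfun n), (1 <= n)%N ->
     cvgn (fun m : nat => prob_size R m f) /\ 0 < prob R f) /\
  (exists alpha beta : R, [/\ 0 < alpha, beta < 1 / 2 &
     forall n : nat, (1 <= n)%N ->
       [/\ alpha <= prob R (const_fun n true),
           prob R (const_fun n true) = prob R (const_fun n false) &
           prob R (const_fun n false) <= beta]]) /\
  (forall (n0 : nat) (f : boolfun n0), (1 <= n0)%N -> is_literal f ->
     (fun k : nat => prob R (extend k f) : R^o) =Theta_\oo
     (fun k : nat => ((n0 + k)%:R ^+ 2)^-1 : R^o)) /\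
  (forall (n0 : nat) (f : boolfun n0), (1 <= n0)%N -> (3 <= complexity f)%N ->
     (fun k : nat => prob R (extend k f) : R^o) =Theta_\oo
     (fun k : nat => ((n0 + k)%:R ^+ complexity f)^-1 : R^o)).
Proof.
split; [|split; [|split]].
- move=> n f n1; split; last exact: prob_gt0.
  by apply/cvg_ex; exists (prob R f); exact: cvgn_prob.
- have [a [b [a0 b2 ab]]] := uniform_constant_bounds R.
  exists a, b; split => // n n1; have [h1 h2] := ab n n1; split => //.
  exact: prob_true_false.
- move=> n0 f n1 /existsP[l /eqP fl].
  apply: (@Theta_prob_extend R n0 f 2 And [:: Leaf l]) => //.
  + by rewrite fl literal_nonconst.
  + by left.
  + by move=> x; rewrite fl ffunE /= andbT.
- move=> n0 f n1 f3; have [fC fL [[t [tA tf tS]] tmin]] := complexity_ge3P n1 f3.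
  (* A minimal tree is not a leaf, since [f] is not a literal; its children and their parent have
     total size [complexity f]. *)
  case: t tA tf tS => [l _ tf|c ts tA tf tS].
    by case/existsP: fL; exists l; apply/eqP; rewrite -tf; apply/ffunP => x; rewrite !ffunE.
  apply: (@Theta_prob_extend R n0 f _ c ts) => //.
  + by right => u uA uf; exact: tmin.
  + by move: tA => /andP[/ltnW].
  + move: tA => /andP[_ /allP h]; apply/allP => u /h.
    by rewrite /in_class dual_connectiveK andbC.
  + by move=> x; rewrite -tf ffunE -eval_Node.
Qed.
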